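(* Let $0<p,q,u,v<\infty$, $\alpha>-2$ and $\beta>0$. Then the embedding $$\mathcal{AT}_{q,\alpha}^{p}\subset H(u,v,\beta)$$ holds if and only if one of the following conditions is satisfied: (i) $0<p<u$, and either (i.1) $p\le v$ and $\frac1p+\frac{\alpha+2}{q}=\frac1u+\beta$, or (i.2) $\frac1p+\frac{\alpha+2}{q}<\frac1u+\beta$; (ii) $p=u$, and either (ii.1) $v\ge\max\{p,q\}$ and $\frac{\alpha+2}{q}=\beta$, or (ii.2) $\frac{\alpha+2}{q}<\beta$; (iii) $p>u$, and either (iii.1) $v\ge\max\{u,q\}$ and $\frac{\alpha+2}{q}=\beta$, or (iii.2) $\frac{\alpha+2}{q}<\beta$.
   Context: $\mathbb{D}$ is the open unit disk, $\mathbb{T}$ the unit circle, $|d\xi|$ Lebesgue (arc length) measure on $\mathbb{T}$, $dA$ Euclidean area measure on $\mathbb{D}$, and $H(\mathbb{D})$ the space of analytic functions on $\mathbb{D}$. For $\xi\in\mathbb{T}$ let $\Gamma(\xi)=\{z\in\mathbb{D}: |1-z\bar\xi|<1-|z|^2\}$. Analytic tent spaces: for $0<p,q<\infty$ and $\alpha>-2$, $\mathcal{AT}_{q,\alpha}^p$ is the space of all $f\in H(\mathbb{D})$ with $$\|f\|_{\mathcal{AT}_{q,\alpha}^p}^p=\int_{\mathbb{T}}\left(\int_{\Gamma(\xi)}|f(z)|^q(1-|z|^2)^\alpha\,dA(z)\right)^{p/q}|d\xi|<\infty .$$ Mixed norm spaces: for $0<p,q,\alpha<\infty$, $H(p,q,\alpha)$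 is the space of all $f\in H(\mathbb{D})$ with $$\|f\|_{H(p,q,\alpha)}=\left(\int_0^1M_p(r,f)^q(1-r)^{\alpha q-1}\,dr\right)^{1/q}<\infty,\qquad M_p(r,f)=\left(\frac1{2\pi}\int_{\mathbb{T}}|f(r\xi)|^p|d\xi|\right)^{1/p}.$$ *)

(* Defs.v *)
From HB Require Import structures.
From mathcomp Require Import all_boot all_order all_algebra.
From mathcomp Require Import complex.
From mathcomp Require Import all_classical all_reals all_analysis.

Set Implicit Arguments.
Unset Strict Implicit.
Unset Printing Implicit Defensive.

Import Order.TTheory GRing.Theory Num.Theory.
Import numFieldNormedType.Exports.

Local Open Scope classical_set_scope.
Local Open Scope ring_scope.

Section Spaces.
Variable R : realType.
Local Notation C := R[i].
Implicit Types (f : C -> C) (z xi : C) (p q r alpha : R).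

Definition cabs z : R := ComplexField.Normc.normc z.

Definition unit_disk : set C := [set z | cabs z < 1].

(* Functions on the disk are represented by total functions C -> C; their
   values outside of the disk are irrelevant below.  The scalars of [derivable]
   are those of C^o, i.e., this is complex differentiability. *)
Definition analytic_on_disk f : Prop :=
  forall z, unit_disk z -> derivable (f : C^o -> C^o) z 1.

Definition Gamma xi : set C :=
  [set z | unit_disk z /\ cabs (1 - z * xi^*) < 1 - cabs z ^+ 2].

Definition expi (t : R) : C := Complex (cos t) (sin t).

(* Integration of F against |dxi|, through the parametrization xi = e^(it). *)
Definition circle_integral (F : C -> \bar R) : \bar R :=
  (\int[lebesgue_measure]_(t in `[0%R, (2 * pi)%R]) F (expi t))%E.

(* dA is the product Lebesgue measure in the coordinates z = x + i y. *)
Definition area_integral (A : set C) (F : C -> \bar R) : \bar R :=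
  (\int[lebesgue_measure \x lebesgue_measure]_(w in
      [set w : measurableTypeR R * measurableTypeR R | A (Complex w.1 w.2)])
    F (Complex w.1 w.2))%E.

(* The p-th power of the (quasi-)norm; the value is +oo when it diverges. *)
Definition AT_normp p q alpha f : \bar R :=
  circle_integral (fun xi =>
    (area_integral (Gamma xi) (fun z =>
       (cabs (f z) `^ q * (1 - cabs z ^+ 2) `^ alpha)%R%:E) `^ (p / q))%E).

Definition AT p q alpha : set (C -> C) :=
  [set f | analytic_on_disk f /\ (AT_normp p q alpha f < +oo)%E].

Definition integral_mean p r f : \bar R :=
  ((((2 * pi)^-1)%R%:E *
    circle_integral (fun xi => (cabs (f (r%:C%C * xi)) `^ p)%R%:E)) `^ p^-1)%E.

Definition mixed_norm p q alpha f : \bar R :=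
  ((\int[lebesgue_measure]_(r in `]0%R, 1%R[)
     (integral_mean p r f `^ q * ((1 - r) `^ (alpha * q - 1))%R%:E)) `^ q^-1)%E.

Definition mixed_norm_space p q alpha : set (C -> C) :=
  [set f | analytic_on_disk f /\ (mixed_norm p q alpha f < +oo)%E].

End Spaces.

(* Main.v *)
Require Import Defs.
From mathcomp Require Import all_boot all_order all_algebra.
From mathcomp Require Import complex.
From mathcomp Require Import all_classical all_reals all_analysis.
From mathcomp Require Import measurable_realfun.
From mathcomp Require Import ring lra.
Set Implicit Arguments.
Unset Strict Implicit.
Unset Printing Implicit Defensive.
Import Order.TTheory GRing.Theory Num.Theory.
Import numFieldNormedType.Exports.
Local Open Scope classical_set_scope.
Local Open Scope ring_scope.

(** The point is the local estimate [|f(r xi')|^q <= C (1-r)^(-(alpha+2)) tau_k(xi)] for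
    [|xi - xi'| <= (1-r)/16] and [2^-(k+1) < 1-r <= 2^-k], where [tau_k(xi)] is the integral over the
    cone at [xi] localized by a smooth weight [wt(2^k (1-|z|))] to the shell [1-|z| ~ 2^-k]; the
    weights sum to [O(1)], so [sum_k tau_k <= 2 A] with [A] the full cone integral.  It rests on a
    mean value inequality for [|f|^q], obtained from Goursat's theorem on rectangles.  For [u <= p]
    one integrates it with [xi = xi'].  For [p < u] one uses it on the level sets
    [E_j = {A^(1/q) > 2^j}]: a value of [|f|] at height [1-r ~ 2^-k] which is large on the scale [2^j]
    forces [|E_j| >= c 2^-k].

    Conversely, let [D_n(z) = (1 + z + ... + z^(n-1))/n].  The lacunary functions
    [sum_k (k+1)^-tau B^(k gam) z^(B^k) D_(n_k)(om_k z)^N] have modulus at least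
    [c (k+1)^-tau B^(k gam)] where [1-|z| ~ B^-k] and [D_(n_k)(om_k z)] is close to [1].  With
    [n_k = 1] they are spread over the circle, with [n_k = B^(k-1)] they concentrate at the point
    [1], and with [k = 2^m + j], [n_k = 2^m] and [om_k = exp(-2 pi i j/2^m)] they rotate through arcs
    of length [~ 2^-m].  The first family forces [(alpha+2)/q <= beta] and, in case of equality,
    [v >= q]; the second gives the conditions for [p < u]; the third forces [v >= u] in the
    critical case. *)

(** * Complex numbers in Cartesian coordinates *)

(** For [u <= p] the circle has finite measure, so [p] may be lowered to [u]. What remains is the
    convergence of [sum_k (int tau_k^(u/q))^(v/u)], given that [sum_k tau_k <= 2 A]; in the critical
    case this uses both [v/u >= 1] and [v/q >= 1]. For [p < u] the function [A^(u/q)] need not be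
    integrable: only the numbers [2^(jp) |E_j|] are summable, and the subadditive exponent [p/u < 1]
    lets levels and heights be summed separately. In the converse one parameter decides.
    [tau q > 1], or [tau p > 1] for the family at the point 1, makes the cone integrals summable,
    while [tau v <= 1] makes the radial integral diverge like the harmonic series; so [tau = 1/v]
    works as soon as [v < q], or [v < p]. In the rotating family the active arc at height [B^-k] has
    length about [1/k], which costs [k^(-1/u)], and Parseval's identity on roots of unity keeps the
    cone integrals bounded; hence [tau = 1/v - 1/u]. All exponents may be small, so convexity is not
    at hand. Splitting at a level [lam], and a weight whose powers are still summable over geometric
    progressions, take its place. *)

Section Complex.
Variable R : realType.
Local Notation C := R[i].
Local Notation Re := (@complex.Re R).
Local Notation Im := (@complex.Im R).
Implicit Types (z w : C) (f : C -> C).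

Lemma cabs_ge0 z : 0 <= cabs z.
Proof. by case: z => a b; rewrite /cabs /= sqrtr_ge0. Qed.

Lemma cabs0 : cabs (0 : C) = 0.
Proof. exact: ComplexField.Normc.normc0. Qed.

Lemma cabs1 : cabs (1 : C) = 1.
Proof. exact: ComplexField.Normc.normc1. Qed.

Lemma cabs_eq0 z : (cabs z == 0) = (z == 0).
Proof.
apply/eqP/eqP => [|->]; last exact: cabs0.
exact: ComplexField.Normc.eq0_normc.
Qed.

Lemma cabs_gt0 z : (0 < cabs z) = (z != 0).
Proof. by rewrite lt_def cabs_ge0 andbT cabs_eq0. Qed.

Lemma cabsM z w : cabs (z * w) = cabs z * cabs w.
Proof. exact: ComplexField.Normc.normcM. Qed.

Lemma cabsV z : cabs z^-1 = (cabs z)^-1.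
Proof. exact: ComplexField.Normc.normcV. Qed.

Lemma cabsX z n : cabs (z ^+ n) = cabs z ^+ n.
Proof. by elim: n => [|n IH]; rewrite ?cabs1// !exprS cabsM IH. Qed.

Lemma cabsN z : cabs (- z) = cabs z.
Proof. exact: (@normcN R z). Qed.

Lemma cabsD z w : cabs (z + w) <= cabs z + cabs w.
Proof. exact: (@le_normcD R z w). Qed.

Lemma cabsB z w : cabs (z - w) <= cabs z + cabs w.
Proof. by rewrite -(cabsN w) cabsD. Qed.

Lemma cabsBC z w : cabs (z - w) = cabs (w - z).
Proof. by rewrite -cabsN opprB. Qed.

Lemma cabs_lerB z w : cabs z - cabs w <= cabs (z - w).
Proof. by rewrite lerBlDr (le_trans _ (cabsD _ _))// subrK. Qed.

Lemma cabs_dist (x y z : C) : cabs (x - z) <= cabs (x - y) + cabs (y - z).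
Proof. by rewrite (le_trans _ (cabsD _ _))// addrA subrK. Qed.

Lemma cabs_real (x : R) : cabs (x%:C%C) = `|x|.
Proof. by rewrite /cabs /= expr0n /= addr0 sqrtr_sqr. Qed.

Lemma cabs_nat (n : nat) : cabs (n%:R : C) = n%:R.
Proof.
have -> : (n%:R : C) = (n%:R)%:C%C by rewrite (rmorph_nat (real_complex R)).
by rewrite cabs_real normr_nat.
Qed.

Lemma cabs_sum (I : Type) (s : seq I) (P : pred I) (F : I -> C) :
  cabs (\sum_(i <- s | P i) F i) <= \sum_(i <- s | P i) cabs (F i).
Proof.
elim/big_rec2: _ => [|i y x _ h]; first by rewrite cabs0.
by rewrite (le_trans (cabsD _ _))// lerD2l.
Qed.

Lemma cabs_sqr (a b : R) : cabs (Complex a b) ^+ 2 = a ^+ 2 + b ^+ 2.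
Proof. by rewrite /cabs /= sqr_sqrtr// addr_ge0// sqr_ge0. Qed.

Lemma Re_le_cabs z : `|Re z| <= cabs z.
Proof.
rewrite -(@ler_pXn2r _ 2)// ?nnegrE ?cabs_ge0//; case: z => a b.
by rewrite cabs_sqr real_normK ?num_real//= lerDl sqr_ge0.
Qed.

Lemma Im_le_cabs z : `|Im z| <= cabs z.
Proof.
rewrite -(@ler_pXn2r _ 2)// ?nnegrE ?cabs_ge0//; case: z => a b.
by rewrite cabs_sqr real_normK ?num_real//= lerDr sqr_ge0.
Qed.

Lemma cabs_le_ReIm z : cabs z <= `|Re z| + `|Im z|.
Proof.
rewrite -(@ler_pXn2r _ 2)// ?nnegrE ?cabs_ge0 ?addr_ge0//; case: z => a b.
rewrite cabs_sqr /= sqrrD !real_normK ?num_real// lerD2r lerDl.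
by rewrite mulrn_wge0// mulr_ge0.
Qed.

Lemma normCE z : `|z| = (cabs z)%:C%C.
Proof. by []. Qed.

(** The norm of [C] has values in [C], so the epsilons of the library are complex numbers; being
    positive they are real. The limit is restated with real [e] and [d], as a first-order expansion
    without division. *)
Lemma derivable_cabsP f z : derivable (f : C^o -> C^o) z 1 <->
  exists l : C, forall e : R, 0 < e -> exists2 d : R, 0 < d &
    forall w, cabs (w - z) < d -> cabs (f w - f z - l * (w - z)) <= e * cabs (w - z).
Proof.
split.
- move=> /cvg_ex[/= l /cvgrPdist_le/= H]; exists l => e e0.
  have e0' : 0 < e%:C%C by rewrite ltcR.
  have [d /= d0 {}H] := H _ e0'.
  have dre : d = (Re d)%:C%C.
    by move: d0 => /gtr0_real/complex_realP/= [x ->].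
  exists (Re d); first by rewrite dre ltcR in d0.
  move=> w wd; have [->|wz] := eqVneq w z.
    by rewrite !subrr mulr0 subr0 cabs0 mulr0.
  have wz0 : w - z != 0 by rewrite subr_eq0.
  have /= := H (w - z).
  rewrite /ball_ /= sub0r normrN normCE dre ltcR => /(_ wd wz0).
  rewrite scaler1 normCE lecR subrK => h.
  have -> : f w - f z - l * (w - z) = - ((l - (w - z)^-1 *: (f w - f z : C^o)) * (w - z)).
    by rewrite /GRing.scale /= mulrBl mulrAC mulVf// mul1r opprB.
  by rewrite cabsN cabsM ler_wpM2r// cabs_ge0.
- move=> [l H]; apply/cvg_ex; exists l; apply/cvgrPdist_le => /= e e0.
  have ere : e = (Re e)%:C%C.
    by move: e0 => /gtr0_real/complex_realP/= [x ->].
  have re0 : 0 < Re e by rewrite ere ltcR in e0.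
  have [d d0 {}H] := H _ re0.
  exists (d%:C%C); first by rewrite /= ltcR.
  move=> h /=; rewrite /ball_ /= sub0r normrN normCE ltcR => hd h0.
  have := H (h + z); rewrite addrK => /(_ hd) {}H.
  rewrite scaler1 normCE ere lecR.
  have -> : l - h^-1 *: (f (h + z) - f z : C^o) = - (h^-1 * (f (h + z) - f z - l * h)).
    rewrite [in RHS]mulrBr opprB (mulrCA _ l) mulVf// mulr1.
    by congr (_ - _).
  by rewrite cabsN cabsM cabsV mulrC ler_pdivrMr ?cabs_gt0.
Qed.

Lemma expiD (s t : R) : expi (s + t) = expi s * expi t.
Proof. by rewrite /expi cosD sinD; simpc; rewrite [sin s * _ + _]addrC. Qed.

Lemma expi0 : expi (0 : R) = 1.
Proof. by rewrite /expi cos0 sin0. Qed.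

Lemma cabs_expi (t : R) : cabs (expi t) = 1.
Proof.
apply/eqP; rewrite -(@eqrXn2 _ 2)// ?cabs_ge0// /expi cabs_sqr.
by rewrite cos2Dsin2 expr1n.
Qed.

Lemma conj_expi (t : R) : (expi t)^* = expi (- t).
Proof. by rewrite /expi cosN sinN. Qed.

Lemma expiN (t : R) : expi t * expi (- t) = 1.
Proof. by rewrite -expiD subrr expi0. Qed.

Lemma sin_le (x : R) : 0 <= x -> sin x <= x.
Proof.
rewrite le_eqVlt => /predU1P[<-|x0]; first by rewrite sin0.
have [c _] := @MVT_segment R sin cos 0 x (ltW x0) (fun y _ => is_derive_sin y)
  (continuous_subspaceT (@continuous_sin R)).
rewrite sin0 !subr0 => ->; rewrite ler_piMl ?cos_le1// ltW//.
Qed.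

Lemma abs_sin_le (x : R) : `|sin x| <= `|x|.
Proof.
wlog x0 : x / 0 <= x => [H|].
  have [/H//|/ltW x0] := leP 0 x.
  by rewrite -normrN -sinN -[`|x|]normrN; apply: H; rewrite oppr_ge0.
have [xp|xp] := leP x pi; last first.
  by rewrite (le_trans (_ : _ <= 1))// ?ler_norml ?sin_geN1 ?sin_le1// (ger0_norm x0)
    (le_trans _ (ltW xp))// (le_trans _ (pi_ge2 _))// ler1n.
by rewrite (ger0_norm x0) ger0_norm ?sin_le// sin_ge0_pi// x0 xp.
Qed.

(** With [h] half the difference of the angles, the chord is [2 |sin h|]. *)
Lemma cabs_expiB (s t : R) : cabs (expi s - expi t) <= `|s - t|.
Proof.
set h := (s - t) / 2.
have -> : s = t + h *+ 2 by rewrite /h -mulr_natr divfK// addrC subrK.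
rewrite expiD -{2}[expi t]mulr1 -mulrBr cabsM cabs_expi mul1r.
rewrite addrAC subrr add0r.
have -> : cabs (expi (h *+ 2) - 1) = 2 * `|sin h|.
  apply/eqP; rewrite -(@eqrXn2 _ 2)// ?cabs_ge0 ?mulr_ge0//.
  rewrite /expi (_ : Complex _ _ - 1 = Complex (cos (h *+ 2) - 1) (sin (h *+ 2))); last by simpc.
  rewrite cabs_sqr cos_mulr2n sin_mulr2n exprMn real_normK ?num_real//.
  have := cos2Dsin2 h => e; apply/eqP.
  have -> : cos h ^+ 2 = 1 - sin h ^+ 2 by rewrite -e addrK.
  have -> : (cos h * sin h *+ 2) ^+ 2 = 4 * (cos h ^+2 * sin h ^+2).
    by rewrite -mulr_natr; ring.
  have -> : cos h ^+ 2 = 1 - sin h ^+ 2 by rewrite -e addrK.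
  by rewrite -mulr_natr; ring.
by rewrite normrMn -[X in _ <= X]mulr_natl; apply: ler_wpM2l => //; exact: abs_sin_le.
Qed.

End Complex.

(** * Goursat's theorem *)

Section Bisection.
Variable R : realType.
Variables (F : R -> R -> R -> R -> R) (a0 b0 c0 d0 : R).
Hypothesis splitx : forall a m b c d, a0 <= a -> a <= m -> m <= b -> b <= b0 ->
  c0 <= c -> c <= d -> d <= d0 -> F a b c d = F a m c d + F m b c d.
Hypothesis splity : forall a b c n d, a0 <= a -> a <= b -> b <= b0 ->
  c0 <= c -> c <= n -> n <= d -> d <= d0 -> F a b c d = F a b c n + F a b n d.
Hypothesis local_small : forall x y, a0 <= x <= b0 -> c0 <= y <= d0 ->
  forall e : R, 0 < e -> exists2 del : R, 0 < del & forall a b c d,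
    a0 <= a -> a <= x <= b -> b <= b0 -> c0 <= c -> c <= y <= d -> d <= d0 ->
    b - a + (d - c) <= del -> `|F a b c d| <= e * (b - a + (d - c)) ^+ 2.

Let rect := (R * R * R * R)%type.
Let G (s : rect) := F s.1.1.1 s.1.1.2 s.1.2 s.2.

Let quarter (s : rect) (i j : bool) : rect :=
  let: (a, b, c, d) := s in
  let m := (a + b) / 2 in let n := (c + d) / 2 in
  (if i then m else a, if i then b else m, if j then n else c, if j then d else n).

(** A quarter that carries at least a fourth of [|G|]; the last one is taken without a test, since
    by additivity the four cannot all fail. *)
Let step (s : rect) : rect :=
  if `|G s| <= 4 * `|G (quarter s false false)| then quarter s false false else
  if `|G s| <= 4 * `|G (quarter s false true)| then quarter s false true else
  if `|G s| <= 4 * `|G (quarter s true false)| then quarter s true false else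
  quarter s true true.

Let ok (s : rect) := [&& a0 <= s.1.1.1, s.1.1.1 <= s.1.1.2, s.1.1.2 <= b0,
  c0 <= s.1.2, s.1.2 <= s.2 & s.2 <= d0].

Lemma step_prop s : ok s -> exists i j, step s = quarter s i j /\ `|G s| <= 4 * `|G (quarter s i j)|.
Proof.
move=> oks; rewrite /step.
case: ifPn => h1; first by exists false, false.
case: ifPn => h2; first by exists false, true.
case: ifPn => h3; first by exists true, false.
exists true, true; split => //; rewrite leNgt; apply/negP => h4.
move: h1 h2 h3; rewrite -!ltNge => h1 h2 h3.
have : `|G s| <= `|G (quarter s false false)| + `|G (quarter s false true)| +
  `|G (quarter s true false)| + `|G (quarter s true true)|.
  case: s oks {h1 h2 h3 h4} => -[[a b] c] d /and5P[/= ? ? ? ? /andP[? ?]].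
  rewrite /G /quarter /= (splitx (m := (a + b) / 2)); [|lra..].
  rewrite (splity (a := a) (n := (c + d) / 2)); [|lra..].
  rewrite (splity (a := (a + b) / 2) (n := (c + d) / 2)); [|lra..].
  rewrite -!addrA (le_trans (ler_normD _ _))// lerD2l.
  by rewrite (le_trans (ler_normD _ _))// lerD2l ler_normD.
lra.
Qed.

Lemma step_ok s : ok s -> [/\ ok (step s), `|G s| <= 4 * `|G (step s)|,
  s.1.1.1 <= (step s).1.1.1 /\ (step s).1.1.2 <= s.1.1.2,
  s.1.2 <= (step s).1.2 /\ (step s).2 <= s.2 &
  (step s).1.1.2 - (step s).1.1.1 + ((step s).2 - (step s).1.2) =
    (s.1.1.2 - s.1.1.1 + (s.2 - s.1.2)) / 2].
Proof.
move=> oks; have [i [j [-> h]]] := step_prop oks.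
case: s oks h => -[[a b] c] d /and5P[/= ? ? ? ? /andP[? ?]] h.
rewrite h {h}; case: i; case: j; rewrite /ok /quarter /=; split; lra.
Qed.

(** Goursat's argument for an additive rectangle function: along nested quarters [|F|] loses at most
    the factor 4 per step, whereas [local_small] at their common point bounds it by an arbitrarily
    small multiple of the squared size, which also loses the factor 4. *)
Lemma bisection : a0 <= b0 -> c0 <= d0 -> F a0 b0 c0 d0 = 0.
Proof.
move=> ab cd; apply/eqP; rewrite -normr_eq0 eq_le normr_ge0 andbT leNgt.
apply/negP => F0.
pose s n := iter n step (a0, b0, c0, d0).
have oks n : ok (s n) by elim: n => [|n /step_ok[]//]; rewrite /ok /=; lra.
have sG n : `|F a0 b0 c0 d0| <= 4 ^+ n * `|G (s n)|.
  elim: n => [|n IH]; first by rewrite expr0 mul1r.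
  rewrite (le_trans IH)// exprSr -mulrA ler_wpM2l// ?exprn_ge0//.
  by have [] := step_ok (oks n).
pose A n := (s n).1.1.1; pose B n := (s n).1.1.2.
pose C n := (s n).1.2; pose D n := (s n).2.
have size n : B n - A n + (D n - C n) = (b0 - a0 + (d0 - c0)) / 2 ^+ n.
  elim: n => [|n IH]; first by rewrite expr0 divr1.
  have [_ _ _ _] := step_ok (oks n); rewrite -/(s n.+1) => ->.
  by rewrite [X in X / 2]IH exprSr invfM mulrA.
have mono n k : [/\ A n <= A (k + n)%N, B (k + n)%N <= B n,
    C n <= C (k + n)%N & D (k + n)%N <= D n].
  elim: k => [//|k [h1 h2 h3 h4]].
  have [_ _ [g1 g2] [g3 g4] _] := step_ok (oks (k + n)%N).
  by split; [exact: le_trans g1|exact: le_trans h2|exact: le_trans g3|exact: le_trans h4].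
have AB n m : A n <= B m.
  have [h1 _ _ _] := mono n m; have [_ h2 _ _] := mono m n.
  have /and5P[_ h3 _ _ _] := oks (m + n)%N.
  by rewrite (le_trans h1)// (le_trans h3)//; rewrite addnC in h2.
have CD n m : C n <= D m.
  have [_ _ h1 _] := mono n m; have [_ _ _ h2] := mono m n.
  have /and5P[_ _ _ _ /andP[h3 _]] := oks (m + n)%N.
  by rewrite (le_trans h1)// (le_trans h3)//; rewrite addnC in h2.
(* Every left end is below every right end, so the supremum of the left ends lies in all the
   intervals; this gives both coordinates of the common point. *)
have supr (f g : nat -> R) : (forall n m, f n <= g m) ->
    forall n, f n <= sup (range f) <= g n.
  move=> fg n; apply/andP; split.
    by apply: ub_le_sup; [exists (g n) => _ [k _ <-]|exists n].
  by apply: ge_sup; [exists (f n), n|move=> _ [k _ <-]].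
have hx := supr _ _ AB; have hy := supr _ _ CD.
move: (sup _) hx (sup _) hy => x hx y hy.
(* A rectangle of size 0 is itself subject to the smallness hypothesis, with bound 0. *)
have t0 : 0 < b0 - a0 + (d0 - c0).
  rewrite lt_def; apply/andP; split; last lra.
  apply/eqP => t0; have [eb ed] : b0 = a0 /\ d0 = c0 by split; lra.
  have xa : a0 <= x <= b0 by exact: (hx O).
  have yc : c0 <= y <= d0 by exact: (hy O).
  have [del d0' /(_ a0 b0 c0 d0 (lexx _) xa (lexx _) (lexx _) yc (lexx _))] :=
    local_small xa yc ltr01.
  rewrite t0 => /(_ (ltW d0')); rewrite expr0n /= mulr0; lra.
(* Multiplied by [4 ^+ n], the local bound at step [n] becomes exactly half of [|F a0 b0 c0 d0|]. *)
pose e := `|F a0 b0 c0 d0| / 2 / (b0 - a0 + (d0 - c0)) ^+ 2.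
have e0 : 0 < e by rewrite !divr_gt0// exprn_gt0.
have [del del0 H] := local_small (hx O) (hy O) e0.
have [n hn] : exists n, (b0 - a0 + (d0 - c0)) / 2 ^+ n <= del.
  have /cvgrPdist_le/(_ _ del0)[n _ /(_ n (leqnn n))/=] :
      (fun n => (b0 - a0 + (d0 - c0)) / 2 ^+ n) @ \oo --> (0 : R).
    by under eq_fun do rewrite -exprVn; apply: cvg_geometric; rewrite ger0_norm; lra.
  move=> h; exists n; move: h.
  by rewrite sub0r normrN ger0_norm ?divr_ge0 ?(ltW t0)// exprn_ge0.
have /and5P[k1 k2 k3 k4 /andP[k5 k6]] := oks n.
have := H (A n) (B n) (C n) (D n) k1 (hx n) k3 k4 (hy n) k6.
rewrite size => /(_ hn) {}H.
have := sG n; apply/negP; rewrite -ltNge.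
rewrite (@le_lt_trans _ _ (4 ^+ n * (e * ((b0 - a0 + (d0 - c0)) / 2 ^+ n) ^+ 2)))//.
  by rewrite ler_wpM2l ?exprn_ge0.
have -> : 4 ^+ n = (2 ^+ n) ^+ 2 :> R by rewrite -exprM mulnC exprM; congr (_ ^+ _); ring.
rewrite /e; set t := _ + _ in t0 *; set u := 2 ^+ n.
have u0 : u != 0 by rewrite expf_neq0.
have -> : u ^+ 2 * (`|F a0 b0 c0 d0| / 2 / t ^+ 2 * (t / u) ^+ 2) = `|F a0 b0 c0 d0| / 2.
  by field; rewrite u0 gt_eqF.
lra.
Qed.

End Bisection.

Section Goursat.
Variable R : realType.
Notation mu := (@lebesgue_measure R).

Lemma integrableB_EFin (f g : R -> R) (D : set (measurableTypeR R)) : measurable D ->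
  mu.-integrable D (EFin \o f) -> mu.-integrable D (EFin \o g) ->
  mu.-integrable D (EFin \o (fun x => f x - g x)).
Proof. by move=> mD fi gi; exact: (integrableB mD fi gi). Qed.

Lemma Rintegral_near_cst (f : R -> R) (a b k M : R) : a <= b ->
  mu.-integrable `[a, b] (EFin \o f) ->
  (forall x, a <= x <= b -> `|f x - k| <= M) ->
  `|\int[mu]_(x in `[a, b]) f x - k * (b - a)| <= M * (b - a).
Proof.
move=> ab fi fk.
have len : fine (mu `[a, b]%classic) = b - a.
  by rewrite lebesgue_measure_itv/= lte_fin; case: ltgtP ab => //= -> _; rewrite subrr.
have ci r : mu.-integrable `[a, b] (EFin \o cst r).
  apply: (@continuous_compact_integrable R) => //; first exact: segment_compact.
  by apply: continuous_subspaceT => x; exact: cst_continuous.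
have -> : k * (b - a) = \int[mu]_(x in `[a, b]) (cst k x) by rewrite Rintegral_cst// len.
rewrite -(RintegralB _ fi (ci k))//.
rewrite (le_trans (le_normr_Rintegral _ _))//.
  by apply: integrableB_EFin.
have -> : M * (b - a) = \int[mu]_(x in `[a, b]) (cst M x) by rewrite Rintegral_cst// len.
apply: le_Rintegral => //.
exact: (integrable_norm (integrableB_EFin _ fi (ci k))).
Qed.

Lemma Rintegral_le_cst (f : R -> R) (a b M : R) : a <= b ->
  mu.-integrable `[a, b] (EFin \o f) ->
  (forall x, a <= x <= b -> `|f x| <= M) ->
  `|\int[mu]_(x in `[a, b]) f x| <= M * (b - a).
Proof.
move=> ab fi fM; rewrite -[X in `|X|]subr0 -[X in _ - X](mul0r (b - a)).
by apply: Rintegral_near_cst => // x /fM; rewrite subr0.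
Qed.

Lemma Rintegral_split (f : R -> R) (a m b : R) : a <= m -> m <= b ->
  mu.-integrable `[a, b] (EFin \o f) ->
  \int[mu]_(x in `[a, b]) f x =
  \int[mu]_(x in `[a, m]) f x + \int[mu]_(x in `[m, b]) f x.
Proof.
move=> am mb fi; rewrite -(@Rintegral_itv_obnd_cbnd _ m); last first.
  by apply: integrableS fi => //; apply: subset_itvr; rewrite bnd_simp.
by rewrite -(@Rintegral_itvB _ _ (BLeft a) (BRight b) m)// ?bnd_simp// addrC subrK.
Qed.

Variables (P Q : R -> R -> R).

(** The integral of [P dx + Q dy] over the boundary, counterclockwise. Opposite sides share one
    integral, so that the constant parts of [P] and [Q] cancel pointwise. *)
Definition circulation (a b c d : R) : R :=
  \int[mu]_(x in `[a, b]) (P x c - P x d) + \int[mu]_(y in `[c, d]) (Q b y - Q a y).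

Variables (a0 b0 c0 d0 : R).
Hypothesis intP : forall y, c0 <= y <= d0 -> mu.-integrable `[a0, b0] (EFin \o P^~ y).
Hypothesis intQ : forall x, a0 <= x <= b0 -> mu.-integrable `[c0, d0] (EFin \o Q x).

Lemma circulation_intP a b c d : a0 <= a -> b <= b0 -> c0 <= c <= d0 -> c0 <= d <= d0 ->
  mu.-integrable `[a, b] (EFin \o (fun x => P x c - P x d)).
Proof.
move=> ha hb hc hd; have : mu.-integrable `[a0, b0] (EFin \o (fun x => P x c - P x d)).
  by apply: integrableB_EFin => //; exact: intP.
by apply: integrableS => //; apply: subset_itv; rewrite bnd_simp.
Qed.

Lemma circulation_intQ a b c d : c0 <= c -> d <= d0 -> a0 <= a <= b0 -> a0 <= b <= b0 ->
  mu.-integrable `[c, d] (EFin \o (fun y => Q b y - Q a y)).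
Proof.
move=> ha hb hc hd; have : mu.-integrable `[c0, d0] (EFin \o (fun y => Q b y - Q a y)).
  by apply: integrableB_EFin => //; exact: intQ.
by apply: integrableS => //; apply: subset_itv; rewrite bnd_simp.
Qed.

Lemma circulation_splitx a m b c d : a0 <= a -> a <= m -> m <= b -> b <= b0 ->
  c0 <= c -> c <= d -> d <= d0 ->
  circulation a b c d = circulation a m c d + circulation m b c d.
Proof.
move=> *; rewrite /circulation (@Rintegral_split _ a m b)//; last by apply: circulation_intP; lra.
rewrite -!addrA; congr (_ + _); rewrite [in RHS]addrCA; congr (_ + _).
rewrite -RintegralD//; [|by apply: circulation_intQ; lra..].
by apply: eq_Rintegral => y _; rewrite [RHS]addrC addrA subrK.
Qed.

Lemma circulation_splity a b c n d : a0 <= a -> a <= b -> b <= b0 ->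
  c0 <= c -> c <= n -> n <= d -> d <= d0 ->
  circulation a b c d = circulation a b c n + circulation a b n d.
Proof.
move=> *; rewrite /circulation (@Rintegral_split _ c n d)//; last by apply: circulation_intQ; lra.
rewrite [in RHS]addrACA; congr (_ + _).
rewrite -RintegralD//; [|by apply: circulation_intP; lra..].
by apply: eq_Rintegral => y _; rewrite addrA subrK.
Qed.

Hypothesis closed : forall x0 y0, a0 <= x0 <= b0 -> c0 <= y0 <= d0 ->
  exists A B D : R, forall e : R, 0 < e -> exists2 del : R, 0 < del & forall x y,
    `|x - x0| <= del -> `|y - y0| <= del ->
    `|P x y - P x0 y0 - A * (x - x0) - B * (y - y0)| <= e * (`|x - x0| + `|y - y0|) /\
    `|Q x y - Q x0 y0 - B * (x - x0) - D * (y - y0)| <= e * (`|x - x0| + `|y - y0|).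

(** The linear part of [P] contributes [B * (c - d) * (b - a)], that of [Q] contributes
    [B * (b - a) * (d - c)]; they cancel because [closed] puts the same [B] into both expansions.
    Only the first-order errors remain. *)
Lemma circulation_local x0 y0 : a0 <= x0 <= b0 -> c0 <= y0 <= d0 ->
  forall e : R, 0 < e -> exists2 del : R, 0 < del & forall a b c d,
    a0 <= a -> a <= x0 <= b -> b <= b0 -> c0 <= c -> c <= y0 <= d -> d <= d0 ->
    b - a + (d - c) <= del -> `|circulation a b c d| <= e * (b - a + (d - c)) ^+ 2.
Proof.
move=> hx hy e e0; have [A [B [D H]]] := closed hx hy.
have e40 : 0 < e / 2 by rewrite divr_gt0.
have [del del0 {}H] := H _ e40; exists del => // a b c d h1 /andP[h2 h3] h4 h5 /andP[h6 h7] h8 h9.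
have [ab cd] := (le_trans h2 h3, le_trans h6 h7).
set s := b - a + (d - c).
have near x y : a <= x <= b -> c <= y <= d -> `|x - x0| + `|y - y0| <= s.
  by move=> ? ?; rewrite /s lerD// ler_norml; lra.
have near1 x y : a <= x <= b -> c <= y <= d -> `|x - x0| <= del /\ `|y - y0| <= del.
  move=> ? ?; have := @near x y; have := normr_ge0 (x - x0); have := normr_ge0 (y - y0).
  by rewrite /s; split; lra.
have hP x : a <= x <= b -> `|P x c - P x d - B * (c - d)| <= e * s.
  move=> hx1; have hc : c <= c <= d by rewrite lexx.
  have hd : c <= d <= d by rewrite lexx cd.
  have [k1 k2] := near1 _ _ hx1 hc; have [k3 k4] := near1 _ _ hx1 hd.
  have [+ _] := H _ _ k1 k2; have [+ _] := H _ _ k3 k4.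
  have {k1 k2 k3 k4} n1 := near _ _ hx1 hc; have n2 := near _ _ hx1 hd => h1' h2'.
  have -> : P x c - P x d - B * (c - d) =
    (P x c - P x0 y0 - A * (x - x0) - B * (c - y0)) -
    (P x d - P x0 y0 - A * (x - x0) - B * (d - y0)) by ring.
  rewrite (le_trans (ler_normB _ _))// [X in X * s]splitr mulrDl lerD//.
    by rewrite (le_trans h2')// ler_pM2l.
  by rewrite (le_trans h1')// ler_pM2l.
have hQ y : c <= y <= d -> `|Q b y - Q a y - B * (b - a)| <= e * s.
  move=> hy1; have ha : a <= a <= b by rewrite lexx.
  have hb : a <= b <= b by rewrite lexx ab.
  have [k1 k2] := near1 _ _ ha hy1; have [k3 k4] := near1 _ _ hb hy1.
  have [_ +] := H _ _ k1 k2; have [_ +] := H _ _ k3 k4.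
  have {k1 k2 k3 k4} n1 := near _ _ ha hy1; have n2 := near _ _ hb hy1 => h1' h2'.
  have -> : Q b y - Q a y - B * (b - a) =
    (Q b y - Q x0 y0 - B * (b - x0) - D * (y - y0)) -
    (Q a y - Q x0 y0 - B * (a - x0) - D * (y - y0)) by ring.
  rewrite (le_trans (ler_normB _ _))// [X in X * s]splitr mulrDl lerD//.
    by rewrite (le_trans h1')// ler_pM2l.
  by rewrite (le_trans h2')// ler_pM2l.
have iP : mu.-integrable `[a, b] (EFin \o (fun x => P x c - P x d)).
  by apply: circulation_intP => //; apply/andP; split => //; [exact: le_trans h8|exact: le_trans cd].
have iQ : mu.-integrable `[c, d] (EFin \o (fun y => Q b y - Q a y)).
  by apply: circulation_intQ => //; apply/andP; split => //; [exact: le_trans h4|exact: le_trans ab].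
have := Rintegral_near_cst ab iP hP; have := Rintegral_near_cst cd iQ hQ.
rewrite /circulation; set I := Rintegral _ _ _; set J := Rintegral _ _ _ => h1' h2'.
have -> : J + I = (I - B * (b - a) * (d - c)) + (J - B * (c - d) * (b - a)) by ring.
by rewrite (le_trans (ler_normD _ _))// (le_trans (lerD h1' h2'))// -mulrDr [d - c + _]addrC -/s -mulrA -expr2 lexx.
Qed.

Lemma goursat : a0 <= b0 -> c0 <= d0 -> circulation a0 b0 c0 d0 = 0.
Proof.
apply: bisection; [exact: circulation_splitx|exact: circulation_splity|].
exact: circulation_local.
Qed.

End Goursat.

(** * Cauchy's theorem on rectangles *)

Section CauchyEstimate.
Variable R : realType.
Local Notation C := R[i].
Notation mu := (@lebesgue_measure R).
Local Notation Re := (@complex.Re R).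
Local Notation Im := (@complex.Im R).

Definition cderiv (g : C -> C) (z l : C) := forall e : R, 0 < e ->
  exists2 d : R, 0 < d & forall w, cabs (w - z) < d ->
    cabs (g w - g z - l * (w - z)) <= e * cabs (w - z).

Definition ccont (g : C -> C) (z : C) := forall e : R, 0 < e ->
  exists2 d : R, 0 < d & forall w, cabs (w - z) < d -> cabs (g w - g z) <= e.

Lemma cderiv_ccont g z l : cderiv g z l -> ccont g z.
Proof.
move=> H e e0; have [d d0 {}H] := H 1 ltr01.
have k0 : 0 < 1 + cabs l by rewrite ltr_pwDl// cabs_ge0.
exists (Num.min d (e / (1 + cabs l))); first by rewrite lt_min d0 divr_gt0.
move=> w; rewrite lt_min => /andP[/H h1 h2].
have -> : g w - g z = (g w - g z - l * (w - z)) + l * (w - z) by rewrite subrK.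
rewrite (le_trans (cabsD _ _))// cabsM (le_trans (lerD h1 (lexx _)))//.
by rewrite -mulrDl mulrC -ler_pdivlMr// ltW.
Qed.

Lemma cabs_le_coord (x y x0 y0 : R) :
  cabs (Complex x y - Complex x0 y0) <= `|x - x0| + `|y - y0|.
Proof. by rewrite (le_trans (cabs_le_ReIm _)). Qed.

Lemma cabs_horizontal (x x' y : R) : cabs (Complex x y - Complex x' y) = `|x - x'|.
Proof. by rewrite /cabs /= subrr expr0n /= addr0 sqrtr_sqr. Qed.

Lemma cabs_vertical (x y y' : R) : cabs (Complex x y - Complex x y') = `|y - y'|.
Proof. by rewrite /cabs /= subrr expr0n /= add0r sqrtr_sqr. Qed.

Lemma integrable_cont_itv (phi : R -> R) (a b : R) :
  (forall x, a <= x <= b -> forall e : R, 0 < e -> exists2 d : R, 0 < d &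
    forall x', `|x' - x| < d -> `|phi x' - phi x| <= e) ->
  mu.-integrable `[a, b] (EFin \o phi).
Proof.
move=> H; apply: (@continuous_compact_integrable R); first exact: segment_compact.
apply: continuous_in_subspaceT => x; rewrite inE/= in_itv/= => hx.
apply/cvgrPdist_le => e e0; have [d d0 {}H] := H x hx e e0.
exists d => //= x'; rewrite /ball_ /= distrC => /H.
by rewrite distrC.
Qed.

(** Stated for any 1-Lipschitz [T] and path [p], so that real part, imaginary part and modulus along
    horizontal and vertical segments are all covered. *)
Lemma ccont_integrable (g : C -> C) (T : C -> R) (p : R -> C) (a b : R) :
  (forall z w, `|T z - T w| <= cabs (z - w)) ->
  (forall x x', cabs (p x - p x') <= `|x - x'|) ->
  (forall x, a <= x <= b -> ccont g (p x)) ->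
  mu.-integrable `[a, b] (EFin \o (fun x => T (g (p x)))).
Proof.
move=> hT hp hg; apply: integrable_cont_itv => x hx e e0.
have [d d0 H] := hg x hx e e0; exists d => // x' xd.
by rewrite (le_trans (hT _ _))// H// (le_lt_trans (hp _ _)).
Qed.

Lemma Re_lip (z w : C) : `|Re z - Re w| <= cabs (z - w).
Proof. by rewrite -(raddfB Re) Re_le_cabs. Qed.

Lemma NIm_lip (z w : C) : `|- Im z - (- Im w)| <= cabs (z - w).
Proof. by rewrite opprK addrC -normrN opprB -(raddfB Im) Im_le_cabs. Qed.

Lemma cabs_lip (z w : C) : `|cabs z - cabs w| <= cabs (z - w).
Proof.
rewrite ler_norml cabs_lerB andbT lerNl opprB cabsBC; exact: cabs_lerB.
Qed.

Lemma horizontal_lip (y x x' : R) : cabs (Complex x y - Complex x' y) <= `|x - x'|.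
Proof. by rewrite cabs_horizontal. Qed.

Lemma vertical_lip (x y y' : R) : cabs (Complex x y - Complex x y') <= `|y - y'|.
Proof. by rewrite cabs_vertical. Qed.

(* The integrand of [Re (g dz)] is [P dx + Q dy] with [P = Re g], [Q = - Im g]. *)
Definition contour_re (g : C -> C) (a b c d : R) :=
  circulation (fun x y => Re (g (Complex x y))) (fun x y => - Im (g (Complex x y))) a b c d.

(** The Cauchy-Riemann equations make the form [Re (g dz)] closed to first order: for the derivative
    [l] the symmetric matrix has the entries [Re l], [- Im l], [- Re l]. *)
Lemma cauchy_goursat (g : C -> C) (a b c d : R) : a <= b -> c <= d ->
  (forall x y, a <= x <= b -> c <= y <= d -> exists l, cderiv g (Complex x y) l) ->
  contour_re g a b c d = 0.
Proof.
move=> ab cd gd.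
have gc x y : a <= x <= b -> c <= y <= d -> ccont g (Complex x y).
  by move=> hx hy; have [l] := gd x y hx hy; exact: cderiv_ccont.
apply: goursat => //.
- move=> y hy; apply: (ccont_integrable (T := Re) Re_lip (horizontal_lip y)).
  by move=> x hx; exact: gc.
- move=> x hx; apply: (ccont_integrable (T := fun z => - Im z) NIm_lip (vertical_lip x)).
  by move=> y hy; exact: gc.
move=> x0 y0 hx hy; have [l H] := gd x0 y0 hx hy.
exists (Re l), (- Im l), (- Re l) => e e0; have [del del0 {}H] := H e e0.
exists (del / 3) => [|x y xd yd]; first by rewrite divr_gt0.
have wd : cabs (Complex x y - Complex x0 y0) < del.
  by rewrite (le_lt_trans (cabs_le_coord _ _ _ _))//; lra.
have h := le_trans (H _ wd) (ler_wpM2l (ltW e0) (cabs_le_coord x y x0 y0)).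
split; rewrite (le_trans _ h)//.
- rewrite (le_trans _ (Re_le_cabs _))// le_eqVlt; apply/orP; left; apply/eqP; congr (`| _ |).
  move: (g _) (g _) {H h} => [r1 i1] [r2 i2]; case: l => lr li; simpc => /=; ring.
- rewrite -normrN (le_trans _ (Im_le_cabs _))// le_eqVlt; apply/orP; left; apply/eqP; congr (`| _ |).
  move: (g _) (g _) {H h} => [r1 i1] [r2 i2]; case: l => lr li; simpc => /=; ring.
Qed.

(* One exceptional point is harmless: by additivity the contour shrinks to it. *)
Lemma cauchy_goursat_pt (g : C -> C) (a b c d x0 y0 : R) :
  a < x0 < b -> c < y0 < d ->
  (forall x y, a <= x <= b -> c <= y <= d -> ccont g (Complex x y)) ->
  (forall x y, a <= x <= b -> c <= y <= d -> (x, y) != (x0, y0) ->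
    exists l, cderiv g (Complex x y) l) ->
  contour_re g a b c d = 0.
Proof.
move=> /andP[ax xb] /andP[cy yd] gc gd.
have iP a' b' y : a <= a' -> b' <= b -> c <= y <= d ->
    mu.-integrable `[a', b'] (EFin \o (fun x => Re (g (Complex x y)))).
  move=> aa bb hy; apply: (ccont_integrable (T := Re) Re_lip (horizontal_lip y)).
  by move=> x hx; apply: gc => //; lra.
have iQ c' d' x : c <= c' -> d' <= d -> a <= x <= b ->
    mu.-integrable `[c', d'] (EFin \o (fun y => - Im (g (Complex x y)))).
  move=> aa bb hy; apply: (ccont_integrable (T := fun z => - Im z) NIm_lip (vertical_lip x)).
  by move=> y hx; apply: gc => //; lra.
have iP0 y : c <= y <= d -> mu.-integrable `[a, b] (EFin \o (fun x => Re (g (Complex x y)))).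
  exact: iP.
have iQ0 x : a <= x <= b -> mu.-integrable `[c, d] (EFin \o (fun y => - Im (g (Complex x y)))).
  exact: iQ.
have shrink s : 0 < s -> a <= x0 - s -> x0 + s <= b -> c <= y0 - s -> y0 + s <= d ->
    contour_re g a b c d = contour_re g (x0 - s) (x0 + s) (y0 - s) (y0 + s).
  move=> s0 s1 s2 s3 s4; rewrite /contour_re.
  rewrite (circulation_splitx (m := x0 - s) iP0 iQ0); [|lra..].
  rewrite (circulation_splitx (a := x0 - s) (m := x0 + s) iP0 iQ0); [|lra..].
  rewrite (circulation_splity (a := x0 - s) (b := x0 + s) (n := y0 - s) iP0 iQ0); [|lra..].
  rewrite (circulation_splity (a := x0 - s) (b := x0 + s) (c := y0 - s) (n := y0 + s) iP0 iQ0); [|lra..].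
  (* The four pieces around the central square miss the exceptional point. *)
  have V a' b' c' d' : a <= a' -> a' <= b' -> b' <= b -> c <= c' -> c' <= d' -> d' <= d ->
      ~~ ((a' <= x0 <= b') && (c' <= y0 <= d')) -> contour_re g a' b' c' d' = 0.
    move=> ? ? ? ? ? ? nz; apply: cauchy_goursat => // x y hx hy; apply: gd; [lra|lra|].
    by apply: contra nz => /eqP[<- <-]; rewrite hx hy.
  rewrite -!/(contour_re g _ _ _ _) (V a) ?(V (x0 + s)) ?(V _ _ c) ?(V _ _ (y0 + s)); lra.
have [del del0 H] := gc x0 y0 (ltac:(lra)) (ltac:(lra)) 1 ltr01.
pose M := cabs (g (Complex x0 y0)) + 1.
apply/eqP; rewrite -normr_eq0 eq_le normr_ge0 andbT leNgt; apply/negP => F0.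
have M0 : 0 < M by rewrite /M ltr_pwDr// cabs_ge0.
(* The square of half-side [s] stays inside the rectangle, [cabs (g _) <= M] holds on it, and its
   contour bound [8 * M * s] is at most [8/9] of the value assumed nonzero. *)
pose s := Num.min (Num.min (Num.min (x0 - a) (b - x0)) (Num.min (y0 - c) (d - y0)))
  (Num.min (del / 3) (`|contour_re g a b c d| / M / 9)).
have s0 : 0 < s by rewrite /s !lt_min !subr_gt0 ax xb cy yd !divr_gt0.
have : s <= s by [].
rewrite {2}/s !le_min => /andP[/andP[/andP[s1 s2] /andP[s3 s4]] /andP[s5 s6]].
have E := shrink s s0 (ltac:(lra)) (ltac:(lra)) (ltac:(lra)) (ltac:(lra)).
have bd x y : x0 - s <= x <= x0 + s -> y0 - s <= y <= y0 + s ->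
    cabs (g (Complex x y)) <= M.
  move=> hx hy; rewrite -(subrK (g (Complex x0 y0)) (g (Complex x y))).
  rewrite (le_trans (cabsD _ _))// addrC lerD2l; apply: H.
  rewrite (le_lt_trans (cabs_le_coord _ _ _ _))//.
  have h1 : `|x - x0| <= s by rewrite ler_norml; lra.
  have h2 : `|y - y0| <= s by rewrite ler_norml; lra.
  by lra.
have lo : y0 - s <= y0 - s <= y0 + s by lra.
have hi : y0 - s <= y0 + s <= y0 + s by lra.
have lo' : x0 - s <= x0 - s <= x0 + s by lra.
have hi' : x0 - s <= x0 + s <= x0 + s by lra.
have : `|contour_re g (x0 - s) (x0 + s) (y0 - s) (y0 + s)| <= 8 * M * s.
  rewrite /contour_re /circulation (le_trans (ler_normD _ _))//.
  have -> : 8 * M * s = (2 * M) * (x0 + s - (x0 - s)) + (2 * M) * (y0 + s - (y0 - s)) by ring.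
  apply: lerD.
  - apply: Rintegral_le_cst; [lra| |].
      by apply: integrableB_EFin => //; apply: iP; lra.
    move=> x hx; rewrite (le_trans (ler_normB _ _))// mulr_natl mulr2n lerD//.
      by rewrite (le_trans (Re_le_cabs _))// bd.
    by rewrite (le_trans (Re_le_cabs _))// bd.
  - apply: Rintegral_le_cst; [lra| |].
      by apply: integrableB_EFin => //; apply: iQ; lra.
    move=> y hy; rewrite (le_trans (ler_normB _ _))// !normrN mulr_natl mulr2n lerD//.
      by rewrite (le_trans (Im_le_cabs _))// bd.
    by rewrite (le_trans (Im_le_cabs _))// bd.
rewrite -E => h.
have : M * s <= `|contour_re g a b c d| / 9.
  by rewrite mulrC -ler_pdivlMr// mulrAC.
lra.
Qed.

End CauchyEstimate.

(** * A rectangle form of Cauchy's estimate *)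

Section RectangleBound.
Variable R : realType.
Local Notation C := R[i].
Notation mu := (@lebesgue_measure R).
Local Notation Re := (@complex.Re R).
Local Notation Im := (@complex.Im R).

Lemma Rintegral_upper (phi g1 g2 : R -> R) (a b A B K k : R) :
  A <= a -> a <= b -> b <= B -> 0 <= K ->
  mu.-integrable `[a, b] (EFin \o phi) ->
  mu.-integrable `[A, B] (EFin \o g1) -> mu.-integrable `[A, B] (EFin \o g2) ->
  (forall x, 0 <= g1 x) -> (forall x, 0 <= g2 x) ->
  (forall x, a <= x <= b -> phi x <= K * (g1 x + g2 x) - k) ->
  \int[mu]_(x in `[a, b]) phi x <= K * (\int[mu]_(x in `[A, B]) g1 x +
     \int[mu]_(x in `[A, B]) g2 x) - k * (b - a).
Proof.
move=> Aa ab bB K0 ip i1 i2 g10 g20 H.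
have sub : `[a, b] `<=` `[A, B] by apply: subset_itv; rewrite bnd_simp.
have mab : measurable (`[a, b]%classic : set (measurableTypeR R)) by [].
have mAB : measurable (`[A, B]%classic : set (measurableTypeR R)) by [].
have j1 := integrableS mAB mab sub i1.
have j2 := integrableS mAB mab sub i2.
have ci : mu.-integrable `[a, b] (EFin \o cst k).
  apply: (@continuous_compact_integrable R) => //; first exact: segment_compact.
  by apply: continuous_subspaceT => x; exact: cst_continuous.
have j12 : mu.-integrable `[a, b] (EFin \o (fun x => g1 x + g2 x)).
  exact: (integrableD mab j1 j2).
have j3 : mu.-integrable `[a, b] (EFin \o (fun x => K * (g1 x + g2 x))).
  exact: (integrableZl mab _ j12).
have len : fine (mu `[a, b]%classic) = b - a.
  by rewrite lebesgue_measure_itv/= lte_fin; case: ltgtP ab => //= -> _; rewrite subrr.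
have mono g : (forall x, 0 <= g x) -> mu.-integrable `[A, B] (EFin \o g) ->
    \int[mu]_(x in `[a, b]) g x <= \int[mu]_(x in `[A, B]) g x.
  move=> g0 ig; have jg := integrableS mAB mab sub ig.
  rewrite /Rintegral fine_le//; try exact: integrable_fin_num.
  apply: ge0_subset_integral => //; first exact: (measurable_int mu).
  by move=> x _; rewrite lee_fin.
apply: (@le_trans _ _ (\int[mu]_(x in `[a, b]) (K * (g1 x + g2 x) - k))).
  apply: le_Rintegral => //; first exact: (integrableB_EFin mab j3 ci).
rewrite (RintegralB _ j3 ci)// RintegralZl// RintegralD// Rintegral_cst// len.
by rewrite lerD2r ler_wpM2l// lerD// mono.
Qed.

Lemma cderiv_quotient (f : C -> C) (k z0 z l : C) : z != z0 -> cderiv f z l ->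
  exists l', cderiv (fun w => k * (f w - f z0) / (w - z0)) z l'.
Proof.
move=> zz0 fl; apply/derivable_cabsP.
have df : derivable (f : C^o -> C^o) z 1 by apply/derivable_cabsP; exists l.
have d1 : derivable ((fun w => w - z0) : C^o -> C^o) z 1.
  by apply: derivableB; [exact: derivable_id|exact: derivable_cst].
have d2 : derivable ((fun w => k * (f w - f z0)) : C^o -> C^o) z 1.
  apply: (@derivableM C C^o (fun=> k) (fun w => f w - f z0 : C^o)).
    exact: derivable_cst.
  by apply: derivableB; [exact: df|exact: derivable_cst].
have nz : z - z0 != 0 by rewrite subr_eq0.
have d3 : derivable ((fun w => (w - z0)^-1) : C^o -> C^o) z 1.
  exact: (@derivableV C C^o (fun w => w - z0) z 1 nz d1).
exact: (@derivableM C C^o (fun w => k * (f w - f z0)) (fun w => (w - z0)^-1) z 1 d2 d3).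
Qed.

Lemma cderiv_local (g h : C -> C) (z l : C) (r : R) : 0 < r ->
  (forall w, cabs (w - z) < r -> g w = h w) -> cderiv g z l -> cderiv h z l.
Proof.
move=> r0 gh H e e0; have [d d0 {}H] := H e e0.
exists (Num.min d r) => [|w]; first by rewrite lt_min d0.
rewrite lt_min => /andP[wd wr]; rewrite -!gh//; first exact: H.
by rewrite subrr cabs0.
Qed.

(** Cauchy's formula with the winding integral replaced by a lower bound on each side. The integral
    of [Re (h dz)] vanishes for the rotated difference quotient [h] of [f] at [z0]; the part coming
    from [f z0] has one sign on all four sides, hence is bounded by the part coming from [f z]. The
    integrals run over the full width [2 * rho], so that the sides can later be chosen by
    averaging. *)
Lemma cauchy_rectangle (f : C -> C) (x0 y0 rho a b c d : R) : 0 < rho ->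
  (forall x y, `|x - x0| <= rho -> `|y - y0| <= rho ->
    exists l, cderiv f (Complex x y) l) ->
  x0 - rho <= a <= x0 - rho / 2 -> x0 + rho / 2 <= b <= x0 + rho ->
  y0 - rho <= c <= y0 - rho / 2 -> y0 + rho / 2 <= d <= y0 + rho ->
  cabs (f (Complex x0 y0)) <= 2 / rho *
   (\int[mu]_(x in `[x0 - rho, x0 + rho]) cabs (f (Complex x c)) +
    \int[mu]_(x in `[x0 - rho, x0 + rho]) cabs (f (Complex x d)) +
    (\int[mu]_(y in `[y0 - rho, y0 + rho]) cabs (f (Complex a y)) +
     \int[mu]_(y in `[y0 - rho, y0 + rho]) cabs (f (Complex b y)))).
Proof.
move=> rho0 fd /andP[a1 a2] /andP[b1 b2] /andP[c1 c2] /andP[d1 d2].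
pose z0 := Complex x0 y0; rewrite -/z0.
have half : 0 < rho / 2 by rewrite divr_gt0.
have half_le : rho / 2 <= rho by clear -rho0; lra.
have la : rho / 2 <= x0 - a by clear -a2; lra.
have lb : rho / 2 <= b - x0 by clear -b1; lra.
have lc : rho / 2 <= y0 - c by clear -c2; lra.
have ld : rho / 2 <= d - y0 by clear -d1; lra.
have ra : `|a - x0| <= rho by rewrite ler_norml; clear -a1 la half; lra.
have rb : `|b - x0| <= rho by rewrite ler_norml; clear -b2 lb half; lra.
have rc : `|c - y0| <= rho by rewrite ler_norml; clear -c1 lc half; lra.
have rd : `|d - y0| <= rho by rewrite ler_norml; clear -d2 ld half; lra.
have ab : a <= b by clear -la lb half; lra.
have cd : c <= d by clear -lc ld half; lra.
have lena : rho <= b - a by clear -la lb; lra.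
have lenc : rho <= d - c by clear -lc ld; lra.
have xab (x : R) : a <= x <= b -> x0 - rho <= x <= x0 + rho by clear -a1 b2; lra.
have ycd (y : R) : c <= y <= d -> y0 - rho <= y <= y0 + rho by clear -c1 d2; lra.
have xn (x : R) : x0 - rho <= x <= x0 + rho -> `|x - x0| <= rho by rewrite ler_norml; clear; lra.
have yn (y : R) : y0 - rho <= y <= y0 + rho -> `|y - y0| <= rho by rewrite ler_norml; clear; lra.
have aab : a <= a <= b by rewrite lexx.
have bab : a <= b <= b by rewrite lexx ab.
have ccd : c <= c <= d by rewrite lexx.
have dcd : c <= d <= d by rewrite lexx cd.
have [f0|f0] := eqVneq (f z0) 0.
  rewrite f0 cabs0 mulr_ge0 ?divr_ge0 ?(ltW rho0)//.
  by rewrite !addr_ge0// Rintegral_ge0// => *; rewrite cabs_ge0.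
have m0 : cabs (f z0) != 0 by rewrite cabs_eq0.
(* The rotation [k] turns the contribution of [f z0] to [h] into ['i * cabs (f z0) / (z - z0)]. Its
   form [Re (h dz)] is [- cabs (f z0)] times the form of the angle, of constant sign along the
   contour. *)
have [k ck kf] : exists2 k : C, cabs k = 1 & k * f z0 = - 'i%C * (cabs (f z0))%:C%C.
  exists (- 'i%C * (cabs (f z0))%:C%C / f z0); last by rewrite mulfVK.
  rewrite !cabsM cabsN cabsV cabs_real ger0_norm ?cabs_ge0// mulfK//.
  by rewrite /cabs /= expr0n /= add0r expr1n sqrtr1.
have [||l Hl] := fd x0 y0; [by rewrite subrr normr0 ltW..|].
pose q w := k * (f w - f z0) / (w - z0).
(* The singularity is removable: the value [k * l] makes [h] continuous at [z0]. *)
pose h w := if w == z0 then k * l else q w.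
have inr x y : a <= x <= b -> c <= y <= d -> `|x - x0| <= rho /\ `|y - y0| <= rho.
  by move=> /xab/xn ? /ycd/yn.
have hq z w : z != z0 -> cabs (w - z) < cabs (z - z0) -> q w = h w.
  rewrite /h => zz0; case: eqP => // ->; rewrite cabsBC ltxx //.
have hd (x y : R) : a <= x <= b -> c <= y <= d -> Complex x y != z0 ->
    exists l', cderiv h (Complex x y) l'.
  move=> hx hy nz; have [rx ry] := inr _ _ hx hy; have [lz H] := fd _ _ rx ry.
  have [l' H'] := cderiv_quotient k nz H; exists l'.
  apply: cderiv_local (hq _ ^~ nz) H'; rewrite cabs_gt0 subr_eq0 //.
have hc0 : ccont h z0.
  move=> e e0; have [del del0 H] := Hl e e0; exists del => // w wd.
  have [->|wz] := eqVneq w z0; first by rewrite subrr cabs0 ltW.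
  rewrite /h eqxx (negbTE wz).
  have wz0 : w - z0 != 0 by rewrite subr_eq0.
  have -> : q w - k * l = k * ((f w - f z0 - l * (w - z0)) / (w - z0)).
    by rewrite /q [in RHS]mulrBl mulfK// [in RHS]mulrBr [in RHS]mulrA.
  rewrite !cabsM ck mul1r cabsV ler_pdivrMr ?cabs_gt0//; exact: H.
have hc (x y : R) : a <= x <= b -> c <= y <= d -> ccont h (Complex x y).
  move=> hx hy; have [->//|nz] := eqVneq (Complex x y) z0.
  by have [l'] := hd x y hx hy nz; exact: cderiv_ccont.
have H0 : contour_re h a b c d = 0.
  have hx0 : a < x0 < b by clear -half la lb; lra.
  have hy0 : c < y0 < d by clear -half lc ld; lra.
  apply: (cauchy_goursat_pt hx0 hy0 hc) => x y hx hy nz; apply: hd => //.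
  by apply: contra nz => /eqP[-> ->].
have fc (x y : R) : `|x - x0| <= rho -> `|y - y0| <= rho -> ccont f (Complex x y).
  by move=> hx hy; have [l'] := fd _ _ hx hy; exact: cderiv_ccont.
(* [n] is [|z - z0| ^ 2]; the last two inequalities isolate the contribution of [f z0] to the two
   components of [h]. *)
have key (x y : R) : x0 - rho <= x <= x0 + rho -> y0 - rho <= y <= y0 + rho ->
    rho / 2 <= `|x - x0| \/ rho / 2 <= `|y - y0| ->
    exists n : R, [/\ 0 < n, rho ^+ 2 / 4 <= n, n <= 2 * rho ^+ 2,
      `|Re (h (Complex x y)) - cabs (f z0) * (y - y0) / n| <= 2 / rho * cabs (f (Complex x y)) &
      `|- Im (h (Complex x y)) + cabs (f z0) * (x - x0) / n| <= 2 / rho * cabs (f (Complex x y))].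
  move=> hx hy far; pose n := (x - x0) ^+ 2 + (y - y0) ^+ 2.
  have nlo : (rho / 2) ^+ 2 <= n.
    rewrite /n; case: far => h1.
    - rewrite -(real_normK (num_real (x - x0))) (@le_trans _ _ (`|x - x0| ^+ 2))//.
        by rewrite ler_pXn2r ?nnegrE// divr_ge0// ltW.
      by rewrite lerDl sqr_ge0.
    - rewrite -(real_normK (num_real (y - y0))) (@le_trans _ _ (`|y - y0| ^+ 2))//.
        by rewrite ler_pXn2r ?nnegrE// divr_ge0// ltW.
      by rewrite lerDr sqr_ge0.
  have n0 : 0 < n by rewrite (lt_le_trans _ nlo)// exprn_gt0// divr_gt0.
  have nhi : n <= 2 * rho ^+ 2.
    rewrite /n mulr_natl mulr2n lerD// -[X in X <= _]real_normK ?num_real// ler_pXn2r ?nnegrE ?(ltW rho0)//.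
      exact: xn.
    exact: yn.
  set z := Complex x y; have nz : z - z0 != 0.
    apply: contraTneq n0 => /eqP; rewrite /z /z0 eq_complex /= => /andP[/eqP e1 /eqP e2].
    by rewrite /n e1 e2 expr0n /= addr0 ltxx.
  have hz : h z = k * f z / (z - z0) + 'i%C * (cabs (f z0))%:C%C / (z - z0).
    rewrite /h -subr_eq0 (negbTE nz) /q mulrBr kf mulNr opprK mulrDl//.
  have small : cabs (k * f z / (z - z0)) <= 2 / rho * cabs (f z).
    rewrite !cabsM ck mul1r cabsV mulrC ler_wpM2r ?cabs_ge0//.
    rewrite -[2 / rho]invf_div lef_pV2 ?posrE ?divr_gt0 ?cabs_gt0//.
    rewrite -(@ler_pXn2r _ 2)// ?nnegrE ?cabs_ge0 ?divr_ge0 ?(ltW rho0)//.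
    by rewrite cabs_sqr.
  have inv : 'i%C * (cabs (f z0))%:C%C / (z - z0) =
      Complex (cabs (f z0) * (y - y0) / n) (cabs (f z0) * (x - x0) / n).
    apply: (mulIf nz); rewrite mulfVK// /z /z0 /n; simpc => /=.
    have nn : n != 0 by rewrite gt_eqF.
    move: nn; rewrite /n; move: (cabs _) (x - x0) (y - y0) => A X Y nn.
    by congr Complex; field.
  exists n; split => //; first by rewrite (_ : 4 = 2 ^+ 2)// -?expr_div_n// -natrX.
  - rewrite (le_trans _ small)// (le_trans _ (Re_le_cabs _))// hz inv.
    by rewrite (raddfD Re) /= addrK.
  - rewrite (le_trans _ small)// (le_trans _ (Im_le_cabs _))// hz inv.
    by rewrite (raddfD Im) /= opprD subrK normrN.
have ih (y : R) : c <= y <= d -> mu.-integrable `[a, b] (EFin \o (fun x => Re (h (Complex x y)))).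
  move=> hy; apply: (ccont_integrable (T := Re) (@Re_lip R) (horizontal_lip y)).
  by move=> x hx; exact: hc.
have iv (x : R) : a <= x <= b -> mu.-integrable `[c, d] (EFin \o (fun y => - Im (h (Complex x y)))).
  move=> hx; apply: (ccont_integrable (T := fun z => - Im z) (@NIm_lip R) (vertical_lip x)).
  by move=> y hy; exact: hc.
have jh (y : R) : `|y - y0| <= rho ->
    mu.-integrable `[x0 - rho, x0 + rho] (EFin \o (fun x => cabs (f (Complex x y)))).
  move=> hy; apply: (ccont_integrable (@cabs_lip R) (horizontal_lip y)).
  by move=> x /xn hx; exact: fc.
have jv (x : R) : `|x - x0| <= rho ->
    mu.-integrable `[y0 - rho, y0 + rho] (EFin \o (fun y => cabs (f (Complex x y)))).
  move=> hx; apply: (ccont_integrable (@cabs_lip R) (vertical_lip x)).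
  by move=> y /yn hy; exact: fc.
have rho20 : 0 <= 2 / rho by rewrite divr_ge0// ltW.
(* On a side the distance to the parallel line through the centre is at least [rho / 2], and
   [n <= 2 * rho ^+ 2]; this gives the density [m]. Over four sides of length at least [rho] it adds
   up to [cabs (f z0)]. *)
pose m := cabs (f z0) / rho / 4.
have m_ge0 : 0 <= cabs (f z0) by exact: cabs_ge0.
have frac (X n : R) : 0 < n -> n <= 2 * rho ^+ 2 -> rho / 2 <= X -> m <= cabs (f z0) * X / n.
  move=> n0 nhi hX; rewrite /m -!mulrA ler_wpM2l// ler_pdivlMr// mulrC.
  rewrite (le_trans (ler_wpM2r _ nhi))//; first by rewrite divr_ge0// invr_ge0 ltW.
  rewrite (_ : 2 * rho ^+ 2 * _ = rho / 2)//; field; by rewrite gt_eqF.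
have B1 : \int[mu]_(x in `[a, b]) (Re (h (Complex x c)) - Re (h (Complex x d))) <=
    2 / rho * (\int[mu]_(x in `[x0 - rho, x0 + rho]) cabs (f (Complex x c)) +
    \int[mu]_(x in `[x0 - rho, x0 + rho]) cabs (f (Complex x d))) - (2 * m) * (b - a).
  apply: Rintegral_upper => //.
  - by apply: integrableB_EFin => //; exact: ih.
  - exact: jh.
  - exact: jh.
  - by move=> x; exact: cabs_ge0.
  - by move=> x; exact: cabs_ge0.
  move=> x hx.
  have [|||n [n0 _ nhi + _]] := key x c; [exact: xab|exact: ycd|by right; rewrite ler_normr opprB lc orbT|].
  have [|||n' [n0' _ nhi' + _]] := key x d; [exact: xab|exact: ycd|by right; rewrite ler_normr ld|].
  have := frac (y0 - c) n n0 nhi lc; have := frac (d - y0) n' n0' nhi' ld.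
  have -> : cabs (f z0) * (c - y0) / n = - (cabs (f z0) * (y0 - c) / n)
    by rewrite -[in RHS]mulNr -[in RHS]mulrN opprB.
  rewrite !ler_norml; clear; lra.
have B2 : \int[mu]_(y in `[c, d]) (- Im (h (Complex b y)) - (- Im (h (Complex a y)))) <=
    2 / rho * (\int[mu]_(y in `[y0 - rho, y0 + rho]) cabs (f (Complex a y)) +
    \int[mu]_(y in `[y0 - rho, y0 + rho]) cabs (f (Complex b y))) - (2 * m) * (d - c).
  apply: Rintegral_upper => //.
  - by apply: integrableB_EFin => //; exact: iv.
  - exact: jv.
  - exact: jv.
  - by move=> x; exact: cabs_ge0.
  - by move=> x; exact: cabs_ge0.
  move=> y hy.
  have [|||n [n0 _ nhi _ +]] := key a y; [exact: xab|exact: ycd|by left; rewrite ler_normr opprB la orbT|].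
  have [|||n' [n0' _ nhi' _ +]] := key b y; [exact: xab|exact: ycd|by left; rewrite ler_normr lb|].
  have := frac (x0 - a) n n0 nhi la; have := frac (b - x0) n' n0' nhi' lb.
  have -> : cabs (f z0) * (a - x0) / n = - (cabs (f z0) * (x0 - a) / n)
    by rewrite -[in RHS]mulNr -[in RHS]mulrN opprB.
  rewrite !ler_norml; clear; lra.
have B3 : cabs (f z0) <= (2 * m) * (b - a) + (2 * m) * (d - c).
  have -> : cabs (f z0) = (2 * m) * rho + (2 * m) * rho by rewrite /m; field; rewrite gt_eqF.
  have mm : 0 <= 2 * m by rewrite mulr_ge0// !divr_ge0// ltW.
  by rewrite lerD// ler_wpM2l.
have := lerD B1 B2; rewrite -/(circulation _ _ a b c d) -/(contour_re h a b c d).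
move: H0; rewrite /contour_re /circulation => ->.
move=> h1; rewrite (le_trans B3)//; move: h1.
move: (Rintegral _ _ _) (Rintegral _ _ _) (Rintegral _ _ _) (Rintegral _ _ _) => I1 I2 I3 I4.
by move: (2 / rho) => K; clear; lra.
Qed.

End RectangleBound.

(** * Dyadic weights *)

Section Weights.
Variable R : realType.
Implicit Types (x y t kap : R).

Lemma powR_le1 x e : 0 <= x -> x <= 1 -> 0 <= e -> x `^ e <= 1.
Proof.
move=> x0 x1 e0; have one : 1 `^ e = 1 :> R by rewrite powR1.
by rewrite -[leRHS]one ge0_ler_powR ?nnegrE.
Qed.

Lemma powR_lt1 x e : 0 <= x -> x < 1 -> 0 < e -> x `^ e < 1.
Proof.
move=> x0 x1 e0; have one : 1 `^ e = 1 :> R by rewrite powR1.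
by rewrite -[ltRHS]one gt0_ltr_powR ?nnegrE.
Qed.

Lemma powR_gt1 x e : 1 < x -> 0 < e -> 1 < x `^ e.
Proof.
move=> x1 e0; have one : 1 `^ e = 1 :> R by rewrite powR1.
by rewrite -[ltLHS]one gt0_ltr_powR ?nnegrE// (le_trans ler01 (ltW x1)).
Qed.

(** A rational bump on the logarithmic scale, comparable to the smaller of [y] and [1 / y]. It
    stands in for the indicator of a dyadic shell. *)
Definition wt y := y / (1 + y) ^+ 2.

Lemma wt_ge0 y : 0 <= y -> 0 <= wt y.
Proof. by move=> y0; rewrite /wt divr_ge0// exprn_ge0// addr_ge0. Qed.

Lemma wt_le1 y : 0 <= y -> wt y <= 1.
Proof.
move=> y0; rewrite /wt ler_pdivrMr ?exprn_gt0 ?ltr_pwDl// mul1r.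
by rewrite sqrrD expr1n mul1r; have := sqr_ge0 y; lra.
Qed.

Lemma wt_inv y : 0 < y -> wt y^-1 = wt y.
Proof.
move=> y0; rewrite /wt; field.
by rewrite !gt_eqF ?ltr_pwDl ?addr_gt0 ?(ltW y0)// !gt_eqF.
Qed.

Lemma powR_onep_le y kap : 0 <= y -> 0 < kap -> (1 + y `^ kap) ^+ 2 <= 4 * ((1 + y) ^+ 2) `^ kap.
Proof.
move=> y0 k0.
have h : 1 <= 1 + y by lra.
have h1 : 1 <= (1 + y) `^ kap by have := ler_powR h (ltW k0); rewrite powRr0.
have h2 : y `^ kap <= (1 + y) `^ kap.
  by rewrite ge0_ler_powR ?nnegrE ?(ltW k0)//; lra.
have -> : ((1 + y) ^+ 2) `^ kap = ((1 + y) `^ kap) ^+ 2.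
  by rewrite -(powR_mulrn 2)// ?(le_trans _ h)// -powRrM mulrC powRrM powR_mulrn// powR_ge0.
have -> : 4 * (1 + y) `^ kap ^+ 2 = (2 * (1 + y) `^ kap) ^+ 2 by rewrite exprMn; ring.
rewrite ler_pXn2r ?nnegrE ?mulr_ge0 ?addr_ge0 ?powR_ge0//; lra.
Qed.

(** Powers send geometric progressions to geometric progressions; so, once a power of the weight is
    controlled by the weight at [y ^ kap], telescoping covers every exponent. *)
Lemma wt_powR y kap : 0 <= y -> 0 < kap -> (wt y) `^ kap <= 4 * wt (y `^ kap).
Proof.
move=> y0 k0; rewrite /wt powRM ?invr_ge0 ?exprn_ge0 ?addr_ge0//.
rewrite -powR_inv1 ?exprn_ge0 ?addr_ge0// powRAC powR_inv1 ?powR_ge0//.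
rewrite [leRHS]mulrC -mulrA ler_wpM2l ?powR_ge0//.
rewrite ler_pdivlMl ?exprn_gt0 ?ltr_pwDl ?powR_ge0//.
rewrite ler_pdivrMr ?powR_gt0 ?exprn_gt0 ?ltr_pwDl// powR_onep_le//.
Qed.

(** The factor 4 is that of [wt_powR], and [b / (b - 1)] is the telescoping bound. *)
Definition wt_bound (b : R) := 4 * b / (b - 1).

(* Telescoping: [y / (1 + y)] increases by a multiple of [wt y] between [y] and [b * y]. *)
Lemma sum_wt_geometric (b y : R) n : 1 < b -> 0 < y ->
  \sum_(0 <= k < n) wt (b ^+ k * y) <= b / (b - 1).
Proof.
move=> b1 y0; pose H x := x / (1 + x).
have step x : 0 < x -> wt x <= b / (b - 1) * (H (b * x) - H x).
  move=> x0; have bx : 0 < b * x by rewrite mulr_gt0//; lra.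
  have -> : b / (b - 1) * (H (b * x) - H x) = b * x / ((1 + b * x) * (1 + x)).
    by rewrite /H; field; rewrite !gt_eqF//; lra.
  rewrite /wt ler_pdivrMr ?exprn_gt0//; last lra.
  have -> : b * x / ((1 + b * x) * (1 + x)) * (1 + x) ^+ 2 = b * x * (1 + x) / (1 + b * x).
    by field; rewrite !gt_eqF//; lra.
  rewrite ler_pdivlMr; last lra.
  have : x <= b * x by rewrite ler_peMl//; lra.
  lra.
have pos k : 0 < b ^+ k * y by rewrite mulr_gt0// exprn_gt0//; lra.
have c0 : 0 < b / (b - 1) by rewrite divr_gt0//; lra.
apply: (@le_trans _ _ (b / (b - 1) * (H (b ^+ n * y) - H y))).
  elim: n => [|n IH]; first by rewrite big_geq// expr0 mul1r subrr mulr0.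
  rewrite big_nat_recr//= exprS -(mulrA b (b ^+ n)).
  rewrite (le_trans (lerD IH (step _ (pos n))))// -mulrDr ler_wpM2l ?(ltW c0)//.
  by move: (H _) (H _) (H _) => u v w; lra.
rewrite ger_pMr// lerBlDr /H.
have := pos n; move: (_ * y) => x x0.
have : x / (1 + x) <= 1 by rewrite ler_pdivrMr; lra.
have : 0 <= y / (1 + y) by rewrite divr_ge0; lra.
lra.
Qed.

Lemma sum_wt_powR (b t kap : R) n : 1 < b -> 0 < t -> 0 < kap ->
  \sum_(0 <= k < n) (wt (b ^+ k * t)) `^ kap <= wt_bound (b `^ kap).
Proof.
move=> b1 t0 k0.
have bk : 1 < b `^ kap.
  exact: powR_gt1.
apply: (@le_trans _ _ (4 * \sum_(0 <= k < n) wt ((b `^ kap) ^+ k * t `^ kap))).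
  rewrite mulr_sumr ler_sum// => k _.
  have b0 : 0 <= b by lra.
  rewrite (le_trans (wt_powR _ _))// ?mulr_ge0 ?exprn_ge0 ?(ltW t0)//.
  rewrite powRM ?exprn_ge0 ?(ltW t0)// -powR_mulrn// powRAC powR_mulrn ?powR_ge0//.
rewrite /wt_bound -mulrA ler_pM2l// sum_wt_geometric// powR_gt0//.
Qed.

Lemma wt_half x y : 0 < x -> x / 2 <= y -> y <= x -> wt y <= 4 * wt x.
Proof.
move=> x0 h1 h2; have y0 : 0 < y by lra.
rewrite /wt mulrA ler_pdivrMr ?exprn_gt0//; last lra.
rewrite mulrAC ler_pdivlMr ?exprn_gt0//; last lra.
apply: (@le_trans _ _ (x * (1 + x) ^+ 2)).
  by rewrite ler_wpM2r ?exprn_ge0//; lra.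
rewrite [4 * x]mulrC -mulrA ler_wpM2l ?(ltW x0)//.
have -> : 4 * (1 + y) ^+ 2 = (2 * (1 + y)) ^+ 2 by rewrite exprMn; ring.
by rewrite ler_pXn2r ?nnegrE//; lra.
Qed.

Lemma dyadic_exists (t : R) : 0 < t -> t <= 1 -> exists i : nat, (2^-1) ^+ i.+1 < t <= (2^-1) ^+ i.
Proof.
move=> t0 t1.
have ex : exists i, (2^-1) ^+ i.+1 < t.
  have : (fun i => (2^-1 : R) ^+ i) @ \oo --> (0 : R).
    by apply: cvg_expr; rewrite ger0_norm; lra.
  move=> /cvgrPdist_lt/(_ _ t0)[i _ /(_ i.+1 (leqnSn i))/=].
  by rewrite sub0r normrN ger0_norm ?exprn_ge0 ?invr_ge0//; exists i.
have := ex_minnP ex => -[i h m]; exists i; rewrite h/=.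
case: i h m => [_ _|i h m]; first by rewrite expr0.
by rewrite leNgt; apply/negP => /m; rewrite ltnn.
Qed.

(* For [lambda > 0]: [t <= lambda] or [t ^ u <= lambda ^ (u - q) * t ^ q]. *)
Lemma powR_split (u q lam t : R) : 0 < u -> u < q -> 0 < lam -> 0 <= t ->
  t `^ u <= lam `^ u + lam `^ (u - q) * t `^ q.
Proof.
move=> u0 uq lam0 t0; have [tl|lt] := leP t lam.
  rewrite ler_wpDr ?mulr_ge0 ?powR_ge0//.
  by rewrite ge0_ler_powR ?nnegrE ?(ltW u0)// ltW.
have tp : 0 < t by rewrite (lt_trans lam0).
rewrite ler_wpDl ?powR_ge0//.
have -> : t `^ u = t `^ (u - q) * t `^ q.
  by rewrite -powRD ?subrK//; rewrite (gt_eqF tp) implybT.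
rewrite ler_wpM2r ?powR_ge0//.
have -> : u - q = - (q - u) by rewrite opprB.
rewrite !powRN lef_pV2 ?posrE ?powR_gt0//.
by rewrite ge0_ler_powR ?nnegrE ?subr_ge0 ?ltW.
Qed.

(** The fractions [a / (a + b)] and [b / (a + b)] add up to 1 and do not decrease under the power
    [th <= 1]. *)
Lemma powRD_le (a b th : R) : 0 <= a -> 0 <= b -> 0 < th -> th <= 1 ->
  (a + b) `^ th <= a `^ th + b `^ th.
Proof.
move=> a0 b0 th0 th1.
have [ab|ab] := eqVneq (a + b) 0.
  by rewrite ab powR0 ?gt_eqF// addr_ge0// powR_ge0.
have s0 : 0 < a + b by rewrite lt_def ab addr_ge0.
have key (c : R) : 0 <= c -> c <= a + b -> c / (a + b) * (a + b) `^ th <= c `^ th.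
  rewrite le_eqVlt => /predU1P[<- _|c0 cs]; first by rewrite !mul0r powR_ge0.
  rewrite -[in leRHS](divfK ab c) powRM ?divr_ge0 ?(ltW c0) ?(ltW s0)// ler_wpM2r ?powR_ge0//.
  by rewrite ger1_powR// divr_gt0//= ler_pdivrMr// mul1r.
have := lerD (key a a0 (ltac:(by rewrite lerDl))) (key b b0 (ltac:(by rewrite lerDr))).
by rewrite -mulrDl -mulrDl divff// mul1r.
Qed.

Lemma powR_sum_le (I : Type) (s : seq I) (P : pred I) (F : I -> R) (th : R) :
  0 < th -> th <= 1 -> (forall i, 0 <= F i) ->
  (\sum_(i <- s | P i) F i) `^ th <= \sum_(i <- s | P i) (F i) `^ th.
Proof.
move=> th0 th1 F0; elim: s => [|i s IH]; first by rewrite !big_nil powR0// gt_eqF.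
rewrite !big_cons; case: ifP => // _.
by rewrite (le_trans (powRD_le _ _ _ _))// ?sumr_ge0// lerD2l.
Qed.

(* Valid for all [q > 0]: each term is at most the [q]-th root of the right-hand sum. *)
Lemma powR_weighted_sum (b w : nat -> R) (q K : R) n : 0 < q -> 0 <= K ->
  (forall k, 0 <= b k) -> (forall k, 0 <= w k) -> \sum_(0 <= k < n) w k <= K ->
  (\sum_(0 <= k < n) b k * w k ^+ 2) `^ q <= K `^ q * \sum_(0 <= k < n) (b k * w k) `^ q.
Proof.
move=> q0 K0 b0 w0 wK; set Y := \sum_(0 <= k < n) (b k * w k) `^ q.
have Y0 : 0 <= Y by apply: sumr_ge0 => k _; exact: powR_ge0.
have term k : (k < n)%N -> b k * w k <= Y `^ q^-1.
  move=> kn; rewrite -[leLHS](@powRr1 _ (b k * w k)) ?mulr_ge0//.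
  rewrite -(mulfV (lt0r_neq0 q0)) powRrM ge0_ler_powR ?invr_ge0 ?(ltW q0) ?nnegrE ?powR_ge0//.
  rewrite /Y big_mkord (bigD1 (Ordinal kn))//= lerDl.
  by apply: sumr_ge0 => i _; exact: powR_ge0.
have : \sum_(0 <= k < n) b k * w k ^+ 2 <= K * Y `^ q^-1.
  apply: (@le_trans _ _ (\sum_(0 <= k < n) w k * Y `^ q^-1)).
    rewrite !big_mkord ler_sum// => k _; rewrite expr2 mulrA mulrC ler_wpM2l//.
    exact: term.
  by rewrite -mulr_suml ler_wpM2r// powR_ge0.
move=> h; apply: (@le_trans _ _ ((K * Y `^ q^-1) `^ q)).
  rewrite ge0_ler_powR ?nnegrE ?(ltW q0)//; last by rewrite mulr_ge0// powR_ge0.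
  by apply: sumr_ge0 => k _; rewrite mulr_ge0// sqr_ge0.
by rewrite powRM ?powR_ge0// -powRrM mulVf ?gt_eqF// powRr1.
Qed.

(** The inequality [y <= exp y] at [y = (1 + x) / m], raised to the power [m]. *)
Lemma expRN_powR (m : R) : 0 < m -> exists2 K : R, 0 < K &
  forall x, 0 <= x -> expR (- x) <= K * (1 + x) `^ (- m).
Proof.
move=> m0; exists (expR 1 * m `^ m); first by rewrite mulr_gt0 ?expR_gt0// powR_gt0.
move=> x x0; have x1 : 0 < 1 + x by lra.
rewrite powRN expRN.
have : ((1 + x) / m) `^ m <= expR 1 * expR x.
  rewrite -expRD; have -> : expR (1 + x) = (expR ((1 + x) / m)) `^ m.
    by rewrite -expRM divfK// gt_eqF.
  rewrite ge0_ler_powR ?nnegrE ?(ltW m0) ?expR_ge0 ?divr_ge0//; try lra.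
  by rewrite (le_trans _ (expR_ge1Dx _))// lerDr.
rewrite powRM ?invr_ge0 ?(ltW m0) ?(ltW x1)// -powR_inv1 ?(ltW m0)// powRAC powR_inv1 ?powR_ge0//.
rewrite ler_pdivrMr ?powR_gt0// => h.
rewrite -[_^-1]mul1r ler_pdivrMr ?expR_gt0// mulrAC ler_pdivlMr ?powR_gt0// mul1r.
by rewrite mulrAC.
Qed.

End Weights.

(** * Integration over dyadic shells *)

Section IntegralTools.
Context d (T : measurableType d) (R : realType) (mu : {measure set T -> \bar R}).
Local Open Scope ereal_scope.

(* The integral of a nonnegative function is a supremum over simple functions below it. *)
Lemma ge0_le_integral_sub (A B : set T) (f g : T -> \bar R) :
  (forall x, A x -> B x /\ f x <= g x) -> (forall x, A x -> 0 <= f x) ->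
  (forall x, B x -> 0 <= g x) ->
  \int[mu]_(x in A) f x <= \int[mu]_(x in B) g x.
Proof.
move=> AB f0 g0; rewrite integral_mkcond [leRHS]integral_mkcond.
rewrite !ge0_integralTE; last 2 first.
- by move=> x; rewrite patchE; case: ifP => //; rewrite inE => /g0.
- by move=> x; rewrite patchE; case: ifP => //; rewrite inE => /f0.
apply: ereal_sup_le => _ [h /= hf <-]; exists h => //= x.
rewrite (le_trans (hf x))// !patchE; case: ifPn => [|_].
  by rewrite inE => /AB [Bx ?]; rewrite ifT// inE.
by case: ifP => //; rewrite inE => /g0.
Qed.

Lemma nneseries_le_bound (F : nat -> \bar R) (M : \bar R) :
  (forall k, 0 <= F k) -> (forall n, \sum_(0 <= k < n) F k <= M) ->
  \sum_(0 <= k <oo) F k <= M.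
Proof.
move=> F0 H; apply: lime_le; first by apply: is_cvg_nneseries => n _ _; exact: F0.
by apply: nearW => n; exact: H.
Qed.

Lemma nneseries_EFin_le (F : nat -> R) (M : R) :
  (forall k, (0 <= F k)%R) -> (forall n, (\sum_(0 <= k < n) F k <= M)%R) ->
  \sum_(0 <= k <oo) (F k)%:E <= M%:E.
Proof.
move=> F0 H; apply: nneseries_le_bound => [k|n]; first by rewrite lee_fin.
by rewrite sumEFin lee_fin.
Qed.

Lemma nneseries_term_le (F : nat -> \bar R) n :
  (forall k, 0 <= F k) -> F n <= \sum_(0 <= k <oo) F k.
Proof.
move=> F0; apply: le_trans (nneseries_lim_ge n.+1 (fun k _ _ => F0 k)).
by rewrite big_nat_recr//= leeDr// sume_ge0.
Qed.

(* Summed over the dyadic shells [2^-(i+1) < psi <= 2^-i], the weights [wt(B^k psi)^kap]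
   telescope, so that [psi^-m wt(B^k psi)^kap] has integral [O(1)] uniformly in [k]. *)
Lemma dyadic_integral (D : set T) (psi : T -> R) (box : nat -> set T) (K B kap : R)
    (m : nat) (beta : nat -> R) (G : T -> \bar R) :
  (0 <= K)%R -> (0 < B)%R -> (0 < kap)%R ->
  (forall i, measurable (box i)) ->
  (forall i, mu (box i) <= (K * (2^-1) ^+ (i * m))%R%:E) ->
  (forall x, D x -> (0 < psi x <= 1)%R) ->
  (forall i x, D x -> (psi x <= (2^-1) ^+ i)%R -> box i x) ->
  (forall k, (0 <= beta k)%R) ->
  (forall x, D x -> 0 <= G x <=
    \sum_(0 <= k <oo) (beta k * (psi x ^+ m)^-1 * (wt (B ^+ k * psi x)) `^ kap)%R%:E) ->
  \int[mu]_(x in D) G x <=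
    (2 ^+ m * 4 `^ kap * K * wt_bound (2 `^ kap))%R%:E * \sum_(0 <= k <oo) (beta k)%:E.
Proof.
move=> K0 B0 kap0 mbox mubox Hpsi Hbox beta0 HG.
(* On the shell of index [i], [psi ^ -m] is below [2 ^ ((i + 1) m)], and [wt_half] moves the
   argument of the weight to [B ^ k 2 ^ -i] at the cost of [4 ^ kap]. *)
pose c i : R := (2 ^+ (i.+1 * m) * 4 `^ kap)%R.
have c0 i : (0 <= c i)%R by rewrite mulr_ge0 ?exprn_ge0 ?powR_ge0.
pose e i k : R := (c i * (beta k * (wt (B ^+ k * (2^-1) ^+ i)) `^ kap))%R.
have e0 i k : (0 <= e i k)%R by rewrite mulr_ge0// mulr_ge0// powR_ge0.
pose E i := \sum_(0 <= k <oo) (e i k)%:E.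
have E0 i : 0 <= E i by apply: nneseries_ge0 => k _ _; rewrite lee_fin.
(* Each shell is enlarged to its box, so that the majorant is a series of indicators of measurable
   sets. *)
pose H x := \sum_(0 <= i <oo) (E i * (\1_(box i) x)%:E).
have H0 x : 0 <= H x by apply: nneseries_ge0 => i _ _; rewrite mule_ge0// lee_fin.
apply: (@le_trans _ _ (\int[mu]_x H x)).
  apply: ge0_le_integral_sub => // x Dx; last by case/andP: (HG x Dx).
  split => //; have /andP[_ /le_trans->//] := HG x Dx.
  have /andP[p0 p1] := Hpsi x Dx; have [i /andP[i1 i2]] := dyadic_exists p0 p1.
  apply: (@le_trans _ _ (E i)).
    apply: lee_nneseries => [k _ _|k _].
      by rewrite lee_fin !mulr_ge0 ?invr_ge0 ?exprn_ge0 ?powR_ge0 ?(ltW p0).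
    rewrite lee_fin /e mulrCA -mulrA ler_wpM2l// /c -mulrA ler_pM ?invr_ge0 ?exprn_ge0 ?powR_ge0 ?(ltW p0)//.
      rewrite exprM -[leRHS]invrK lef_pV2 ?posrE ?exprn_gt0 ?invr_gt0 ?exprn_gt0//.
      rewrite -exprVn lerXn2r ?nnegrE ?invr_ge0 ?exprn_ge0 ?(ltW p0)//.
      by rewrite -exprVn ltW.
    rewrite -powRM ?wt_ge0 ?mulr_ge0 ?exprn_ge0 ?invr_ge0 ?(ltW B0)//.
    have wB : (0 < B ^+ k * (2^-1) ^+ i)%R by rewrite mulr_gt0 ?exprn_gt0 ?invr_gt0.
    have pB : (0 < B ^+ k * psi x)%R by rewrite mulr_gt0 ?exprn_gt0.
    have w1 := wt_ge0 (ltW wB); have w2 := wt_ge0 (ltW pB).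
    apply: ge0_ler_powR; rewrite ?nnegrE ?(ltW kap0)//; first exact: mulr_ge0.
    apply: wt_half => //; last by rewrite ler_pM2l ?exprn_gt0.
    by rewrite -mulrA ler_pM2l ?exprn_gt0// -exprSr ltW.
  have -> : E i = E i * (\1_(box i) x)%:E by rewrite indicE mem_set ?mule1//; exact: Hbox.
  by apply: (nneseries_term_le (F := fun i => E i * (\1_(box i) x)%:E)) => j; rewrite mule_ge0// lee_fin.
rewrite /H integral_nneseries//; last 2 first.
- move=> i; apply: measurable_funeM; apply/measurable_EFinP.
  exact: measurable_indic.
- by move=> i x _; rewrite mule_ge0// lee_fin.
pose a i k := (e i k * (K * (2^-1) ^+ (i * m)))%R%:E.
have a0 i k : 0 <= a i k.
  rewrite lee_fin; apply: mulr_ge0; first exact: e0.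
  by rewrite mulr_ge0 ?exprn_ge0 ?invr_ge0.
apply: (@le_trans _ _ (\sum_(0 <= i <oo) \sum_(0 <= k <oo) a i k)).
  apply: lee_nneseries => [i _ _|i _].
    by apply: integral_ge0 => x _; rewrite mule_ge0// lee_fin.
  have mi : measurable_fun [set: T] (fun x => (\1_(box i) x)%:E : \bar R).
    by apply/measurable_EFinP; exact: measurable_indic.
  rewrite (ge0_integralZl mu measurableT mi _ (E0 i)); last by move=> x _; rewrite lee_fin.
  rewrite integral_indic// setIT.
  rewrite (le_trans (lee_wpmul2l _ (mubox i)))// muleC.
  rewrite -nneseriesZl//; last by move=> k _; rewrite lee_fin.
  apply: lee_nneseries => [k _ _|k _]; rewrite -EFinM.
    by rewrite mulrC; exact: a0.
  by rewrite /a mulrC.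
rewrite nneseries_interchange; last first.
  by move=> i k; exact: a0.
have w0 : (0 <= wt_bound (2 `^ kap))%R.
  apply: le_trans (sum_wt_powR (t := 1) 0 _ _ kap0); rewrite ?big_geq//; first by rewrite ltr1n.
rewrite -nneseriesZl//; last by move=> k _; rewrite lee_fin.
apply: lee_nneseries => [k _ _|k _].
  by apply: nneseries_ge0 => i _ _; exact: a0.
apply: nneseries_EFin_le => [i|n]; first by rewrite -lee_fin; exact: a0.
have Bk : (0 < B ^+ k)%R by rewrite exprn_gt0.
(* For fixed [k] the measure of the box cancels [2 ^ (i m)]. By the symmetry [wt (1 / y) = wt y] the
   remaining arguments [2 ^ i B ^ -k] form a progression of ratio 2 in [i], whatever [B] is. *)
apply: (@le_trans _ _ (\sum_(0 <= i < n) (2 ^+ m * 4 `^ kap * K * beta k) * (wt (2 ^+ i * (B ^+ k)^-1)) `^ kap)%R).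
  apply: ler_sum => i _.
  rewrite -(wt_inv (y := (2 ^+ i / B ^+ k)%R)) ?divr_gt0 ?exprn_gt0// invf_div -exprVn.
  rewrite /e /c mulSn exprD !exprVn le_eqVlt; apply/orP; left; apply/eqP.
  by field; rewrite expf_neq0.
rewrite -mulr_sumr -mulrA [(beta k * _)%R]mulrC mulrA ler_wpM2r// ler_wpM2l//.
  by rewrite !mulr_ge0 ?exprn_ge0 ?powR_ge0.
by apply: sum_wt_powR => //; rewrite ?ltr1n ?invr_gt0.
Qed.

End IntegralTools.

(** * Mean value inequality *)

Section AreaMeasure.
Variable R : realType.
Local Notation C := R[i].
Notation mu := (@lebesgue_measure R).
Local Notation RR := (measurableTypeR R * measurableTypeR R)%type.

(** The plane carries the product sigma-algebra, so openness is exploited through a countable union: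
    [F] enumerates the rational boxes and replaces those that leave [U] by the empty set. *)
Lemma measurable_open_box (U : set RR) :
  (forall p, U p -> exists2 e : R, 0 < e &
    forall q : RR, `|q.1 - p.1| < e -> `|q.2 - p.2| < e -> U q) -> measurable U.
Proof.
move=> HU.
pose box (c : rat * rat * nat) : set RR :=
  `]ratr c.1.1 - c.2.+1%:R^-1, ratr c.1.1 + c.2.+1%:R^-1[%classic `*`
  `]ratr c.1.2 - c.2.+1%:R^-1, ratr c.1.2 + c.2.+1%:R^-1[%classic.
pose F n := if pickle_inv n is Some c then
  if pselect (box c `<=` U) then box c else set0 else set0.
suff -> : U = \bigcup_n F n.
  apply: bigcupT_measurable => n; rewrite /F; case: (pickle_inv n) => // c.
  by case: pselect => [?|?] /=; [exact: measurableX|exact: measurable0].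
apply/seteqP; split => [p Up|p [n _]]; last first.
  by rewrite /F; case: (pickle_inv n) => // c; case: pselect => // h /h.
have [e e0 He] := HU p Up.
have [n hn] : exists n : nat, n.+1%:R^-1 < e / 2.
  have e20 : 0 < e / 2 by rewrite divr_gt0.
  have /cvgrPdist_lt/(_ _ e20)[n _ /(_ n (leqnn n))/=] := @cvg_harmonic R.
  by rewrite sub0r normrN ger0_norm ?invr_ge0//; exists n.
have r0 : 0 < n.+1%:R^-1 :> R by rewrite invr_gt0.
have dense (x r : R) : 0 < r -> exists a : rat, ratr a - r < x < ratr a + r.
  move=> rp; have [|a] := @rat_in_itvoo R (x - r) (x + r); first lra.
  by rewrite in_itv/= => /andP[? ?]; exists a; apply/andP; split; lra.
have [a ha] := dense p.1 _ r0; have [b hb] := dense p.2 _ r0.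
have sub : box (a, b, n) `<=` U.
  move: hn ha hb; rewrite /box /=; move: (n.+1%:R^-1) (ratr a) (ratr b) => r a' b' hr ha' hb'.
  move=> q [/=]; rewrite !in_itv/= => /andP[? ?] /andP[? ?].
  by apply: He; rewrite ltr_norml; lra.
have FE c : box c `<=` U -> F (pickle c) = box c.
  by move=> cU; rewrite /F pickleK_inv; case: pselect.
exists (pickle (a, b, n)); first exact: I.
by rewrite FE//; split; rewrite /= in_itv.
Qed.

Definition disk2 : set RR := [set w | unit_disk (Complex w.1 w.2)].

Lemma unit_disk_near (z : C) : unit_disk z ->
  exists2 e : R, 0 < e & forall w, cabs (w - z) < e -> unit_disk w.
Proof.
rewrite /unit_disk /= => z1; exists (1 - cabs z); first by rewrite subr_gt0.
move=> w wz; rewrite -(subrK z w) (le_lt_trans (cabsD _ _))//; lra.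
Qed.

Lemma measurable_open_cond (P : C -> Prop) :
  (forall z, P z -> exists2 e : R, 0 < e & forall w, cabs (w - z) < e -> P w) ->
  measurable ([set w | P (Complex w.1 w.2)] : set RR).
Proof.
move=> H; apply: measurable_open_box => -[x y] /H[e e0 He].
exists (e / 2) => [|[x' y'] /= h1 h2]; first by rewrite divr_gt0.
by apply: He; rewrite (le_lt_trans (cabs_le_coord _ _ _ _))//; lra.
Qed.

Lemma measurable_disk2 : measurable disk2.
Proof. exact: measurable_open_cond unit_disk_near. Qed.

Lemma analytic_cderiv (f : C -> C) z : analytic_on_disk f -> unit_disk z ->
  exists l, cderiv f z l.
Proof. by move=> fa /fa /derivable_cabsP[l]; exists l. Qed.

Lemma analytic_ccont (f : C -> C) z : analytic_on_disk f -> unit_disk z -> ccont f z.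
Proof. by move=> fa zD; have [l] := analytic_cderiv fa zD; exact: cderiv_ccont. Qed.

Lemma measurable_cabs_analytic (f : C -> C) : analytic_on_disk f ->
  measurable_fun disk2 (fun w : RR => cabs (f (Complex w.1 w.2))).
Proof.
move=> fa mD; apply: (measurability _ (RGenOInfty.measurableE R)) => //.
move=> _ [_ [a ->] <-].
rewrite (_ : _ `&` _ = [set w : RR | unit_disk (Complex w.1 w.2) /\
    a < cabs (f (Complex w.1 w.2))]); last first.
  by apply/seteqP; split => w /=; rewrite in_itv/= andbT.
apply: (measurable_open_cond (P := fun z => unit_disk z /\ a < cabs (f z))).
move=> z [zD az]; have [e1 e10 H1] := unit_disk_near zD.
have d0 : 0 < (cabs (f z) - a) / 2 by rewrite divr_gt0// subr_gt0.
have [e2 e20 H2] := analytic_ccont fa zD d0.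
exists (Num.min e1 e2) => [|w]; first by rewrite lt_min e10.
rewrite lt_min => /andP[/H1 wD /H2 h]; split => //.
have := le_trans (cabs_lip (f w) (f z)) h; rewrite ler_norml; lra.
Qed.

(** If [S] exceeded the average everywhere by the margin [eta], integrating a constant would give
    [I + eta <= I]. *)
Lemma exists_below_average (S : R -> R) (l r I eta : R) : l < r -> 0 < eta -> 0 <= I ->
  (\int[mu]_(x in `[l, r]) (S x)%:E <= I%:E)%E ->
  exists2 a, l <= a <= r & (r - l) * S a <= I + eta.
Proof.
move=> lr eta0 I0 HI; apply: contrapT => H.
have rl : 0 < r - l by rewrite subr_gt0.
have big x : l <= x <= r -> (I + eta) / (r - l) <= S x.
  move=> hx; rewrite ler_pdivrMr// mulrC leNgt; apply/negP => h.
  by apply: H; exists x => //; exact: ltW.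
have c0 : 0 <= (I + eta) / (r - l) by rewrite divr_ge0 ?(ltW rl)// addr_ge0// ltW.
have : (\int[mu]_(x in `[l, r]) ((I + eta) / (r - l))%:E <= I%:E)%E.
  apply: le_trans HI; apply: ge0_le_integral_sub => x /=; rewrite in_itv/= => hx.
  - by split => //; rewrite lee_fin big.
  - by rewrite lee_fin.
  - by rewrite lee_fin (le_trans c0)// big.
rewrite integral_cst//= lebesgue_measure_itv/= lte_fin lr -EFinD -EFinM lee_fin.
rewrite divfK ?gt_eqF//; lra.
Qed.

Definition square (x0 y0 rho : R) : set RR :=
  `[x0 - rho, x0 + rho]%classic `*` `[y0 - rho, y0 + rho]%classic.

Lemma measurable_square x0 y0 rho : measurable (square x0 y0 rho).
Proof. exact: measurableX. Qed.

Lemma squareP x0 y0 rho (w : RR) :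
  square x0 y0 rho w <-> `|w.1 - x0| <= rho /\ `|w.2 - y0| <= rho.
Proof.
rewrite /square /= !in_itv/= !ler_norml; split => -[/andP[? ?] /andP[? ?]]; split; lra.
Qed.

(** In each of the four strips of width [rho / 2] along the sides, Tonelli's theorem yields a
    segment on which the integral of [|f|] is at most [2 / rho] times the area integral, up to
    [eta]. With these segments carrying the sides in [cauchy_rectangle], the constant is
    [16 = 2 * 4 * 2]. *)
Lemma mean_value_square (f : C -> C) (x0 y0 rho : R) : analytic_on_disk f -> 0 < rho ->
  square x0 y0 rho `<=` disk2 ->
  ((cabs (f (Complex x0 y0)))%:E <= (16 / rho ^+ 2)%:E *
    \int[mu \x mu]_(w in square x0 y0 rho) (cabs (f (Complex w.1 w.2)))%:E)%E.
Proof.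
move=> fa rho0 sq.
set Int := (\int[_ \x _]_(_ in _) _)%E.
have Int0 : (0 <= Int)%E by apply: integral_ge0 => w _; rewrite lee_fin cabs_ge0.
case E : Int Int0 => [I| |]//; last first.
  move=> _; rewrite mulry gtr0_sg ?mul1e ?leey//.
  by rewrite divr_gt0// exprn_gt0.
rewrite lee_fin => I0; rewrite -EFinM lee_fin.
pose F : RR -> \bar R := (fun w : RR => (cabs (f (Complex w.1 w.2)))%:E) \_ (square x0 y0 rho).
have mF : measurable_fun [set: RR] F.
  apply/(measurable_restrictT _ (measurable_square _ _ _)).
  apply/measurable_EFinP; apply: measurable_funS (measurable_cabs_analytic fa) => //.
  exact: measurable_disk2.
have F0 w : (0 <= F w)%E by rewrite /F patchE; case: ifP => // _; rewrite lee_fin cabs_ge0.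
have IntF : (\int[mu \x mu]_w F w)%E = I%:E by rewrite -E /Int [RHS]integral_mkcond.
have fd (x y : R) : `|x - x0| <= rho -> `|y - y0| <= rho -> exists l, cderiv f (Complex x y) l.
  move=> hx hy; apply: analytic_cderiv => //.
  by apply: (sq (x, y)); apply/squareP.
have fc (x y : R) : x0 - rho <= x <= x0 + rho -> y0 - rho <= y <= y0 + rho -> ccont f (Complex x y).
  move=> hx hy; have [||l] := fd x y; [by rewrite ler_norml; lra..|].
  exact: cderiv_ccont.
pose Sv (x : R) : R := \int[mu]_(y in `[y0 - rho, y0 + rho]) cabs (f (Complex x y)).
pose Sh (y : R) : R := \int[mu]_(x in `[x0 - rho, x0 + rho]) cabs (f (Complex x y)).
have SvE (x : R) : x0 - rho <= x <= x0 + rho -> ((Sv x)%:E = \int[mu]_y F (x, y))%E.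
  move=> hx; rewrite /Sv /Rintegral fineK; last first.
    apply: integrable_fin_num => //.
    by apply: (ccont_integrable (@cabs_lip R) (vertical_lip x)) => y; exact: fc.
  rewrite integral_mkcond; apply: eq_integral => y _; rewrite /F !patchE.
  have -> : ((x, y) \in square x0 y0 rho) = (y \in `[(y0 - rho), (y0 + rho)]%classic).
    by apply/idP/idP; rewrite !inE /square /= !in_itv/= ?hx// => -[].
  by [].
have ShE (y : R) : y0 - rho <= y <= y0 + rho -> ((Sh y)%:E = \int[mu]_x F (x, y))%E.
  move=> hy; rewrite /Sh /Rintegral fineK; last first.
    apply: integrable_fin_num => //.
    by apply: (ccont_integrable (@cabs_lip R) (horizontal_lip y)) => x hx; exact: fc.
  rewrite integral_mkcond; apply: eq_integral => x _; rewrite /F !patchE.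
  have -> : ((x, y) \in square x0 y0 rho) = (x \in `[(x0 - rho), (x0 + rho)]%classic).
    by apply/idP/idP; rewrite !inE /square /= !in_itv/= ?hy// => -[].
  by [].
have Fv (l r : R) : x0 - rho <= l -> r <= x0 + rho ->
    (\int[mu]_(x in `[l, r]) (Sv x)%:E <= I%:E)%E.
  move=> hl hr; rewrite -IntF fubini_tonelli1//.
  apply: ge0_le_integral_sub => x; rewrite /= ?in_itv/=.
  - by move=> hx; split => //; rewrite SvE//; lra.
  - by move=> hx; rewrite SvE; [apply: integral_ge0 => y _; exact: F0|lra].
  - by move=> _; apply: integral_ge0 => y _; exact: F0.
have Fh (l r : R) : y0 - rho <= l -> r <= y0 + rho ->
    (\int[mu]_(y in `[l, r]) (Sh y)%:E <= I%:E)%E.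
  move=> hl hr; rewrite -IntF fubini_tonelli2//.
  apply: ge0_le_integral_sub => x; rewrite /= ?in_itv/=.
  - by move=> hx; split => //; rewrite ShE//; lra.
  - by move=> hx; rewrite ShE; [apply: integral_ge0 => y _; exact: F0|lra].
  - by move=> _; apply: integral_ge0 => y _; exact: F0.
apply/ler_addgt0Pr => eps eps0.
pose eta := eps * rho ^+ 2 / 16.
have eta0 : 0 < eta by rewrite divr_gt0// mulr_gt0// exprn_gt0.
have half1 (t : R) : t - rho / 2 - (t - rho) = rho / 2 by clear; lra.
have half2 (t : R) : t + rho - (t + rho / 2) = rho / 2 by clear; lra.
have lt1 (t : R) : t - rho < t - rho / 2 by clear -rho0; lra.
have lt2 (t : R) : t + rho / 2 < t + rho by clear -rho0; lra.
have le1 (t : R) : t - rho / 2 <= t + rho by clear -rho0; lra.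
have le2 (t : R) : t - rho <= t + rho / 2 by clear -rho0; lra.
have [a ha Sa] := exists_below_average (lt1 x0) eta0 I0 (Fv _ _ (lexx _) (le1 x0)).
have [b hb Sb] := exists_below_average (lt2 x0) eta0 I0 (Fv _ _ (le2 x0) (lexx _)).
have [c hc Sc] := exists_below_average (lt1 y0) eta0 I0 (Fh _ _ (lexx _) (le1 y0)).
have [e he Se] := exists_below_average (lt2 y0) eta0 I0 (Fh _ _ (le2 y0) (lexx _)).
have := cauchy_rectangle rho0 fd ha hb hc he; rewrite -/(Sv a) -/(Sv b) -/(Sh c) -/(Sh e).
move=> h; apply: (le_trans h).
rewrite half1 in Sa; rewrite half2 in Sb; rewrite half1 in Sc; rewrite half2 in Se.
have -> : 16 / rho ^+ 2 * I + eps = (4 / rho ^+ 2) * ((I + eta) + (I + eta) + (I + eta) + (I + eta)).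
  by rewrite /eta; field; rewrite gt_eqF.
have -> : 2 / rho * (Sh c + Sh e + (Sv a + Sv b)) = (4 / rho ^+ 2) *
    (rho / 2 * Sv a + rho / 2 * Sv b + rho / 2 * Sh c + rho / 2 * Sh e).
  by field; rewrite gt_eqF.
rewrite ler_wpM2l ?divr_ge0 ?exprn_ge0 ?(ltW rho0)//.
by rewrite !lerD.
Qed.

End AreaMeasure.

(** * The mean value inequality for powers of the modulus *)

Section PowerMeanValue.
Variable R : realType.
Local Notation C := R[i].
Notation mu := (@lebesgue_measure R).
Local Notation RR := (measurableTypeR R * measurableTypeR R)%type.
Implicit Types (f : C -> C).

Lemma analytic_bounded f (s : R) : analytic_on_disk f -> s < 1 ->
  exists2 M : R, 0 < M & forall z, cabs z <= s -> cabs (f z) <= M.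
Proof.
move=> fa s1; pose g (w : R * R) : R := cabs (f (Complex w.1 w.2)).
pose A : set (R * R) := [set w | cabs (Complex w.1 w.2) <= s].
have lipc (w : R * R) (e : R) : 0 < e -> \forall w' \near w,
    cabs (Complex w'.1 w'.2 - Complex w.1 w.2) < e.
  move=> e0; have e2 : 0 < e / 2 by rewrite divr_gt0.
  exists (ball w.1 (e / 2), ball w.2 (e / 2)) => /=.
    by split; exact: nbhsx_ballx.
  move=> [x y] [/= hx hy]; rewrite (le_lt_trans (cabs_le_coord _ _ _ _))//.
  by move: hx hy; rewrite /ball /= distrC => hx; rewrite distrC => hy; lra.
have cA : closed A.
  apply: (@preimage_closed _ _ (fun w : R * R => cabs (Complex w.1 w.2)) [set x | x <= s]).
    move=> w _; apply/cvgrPdist_le => e e0; near=> w'.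
    rewrite distrC (le_trans (cabs_lip _ _))// ltW//.
    by near: w'; exact: lipc.
  exact: closed_le.
have compA : compact A.
  apply: (subclosed_compact cA (compact_setX (@segment_compact R (-1) 1) (@segment_compact R (-1) 1))).
  move=> [x y]; rewrite /A /= !in_itv/= -!ler_norml => h.
  split.
    by rewrite (le_trans (Re_le_cabs (Complex x y)))// (le_trans h)// ltW.
  by rewrite (le_trans (Im_le_cabs (Complex x y)))// (le_trans h)// ltW.
have gc : {within A, continuous g}.
  apply: continuous_in_subspaceT => w; rewrite inE /A /= => hw.
  apply/cvgrPdist_le => e e0.
  have wD : unit_disk (Complex w.1 w.2) by rewrite /unit_disk /= (le_lt_trans hw).
  have [del del0 H] := analytic_ccont fa wD e0.
  near=> w'; rewrite distrC (le_trans (cabs_lip _ _))// H//.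
  by near: w'; exact: lipc.
have := compact_bounded (continuous_compact gc compA).
move=> [M0 [_ HM]]; exists (Num.max 1 (M0 + 1)); first by rewrite lt_max ltr01.
case=> x y zs; have := HM (Num.max 1 (M0 + 1)).
rewrite lt_max ltrDl ltr01 orbT => /(_ isT (g (x, y))).
by rewrite /g /= ger0_norm ?cabs_ge0//; apply; exists (x, y).
Unshelve. all: by end_near. Qed.

Lemma measurable_powR_analytic f q : analytic_on_disk f ->
  measurable_fun (@disk2 R) (fun w : RR => cabs (f (Complex w.1 w.2)) `^ q).
Proof.
move=> fa; apply: (measurableT_comp (measurable_powR q)).
exact: measurable_cabs_analytic.
Qed.

Lemma lebesgue_square x0 y0 rho : 0 < rho ->
  (mu \x mu)%E (square x0 y0 rho) = (4 * rho ^+ 2)%:E.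
Proof.
move=> rho0; pose A : set (measurableTypeR R) := `[x0 - rho, x0 + rho]%classic.
pose B : set (measurableTypeR R) := `[y0 - rho, y0 + rho]%classic.
transitivity (mu A * mu B)%E; first by apply: product_measure1E.
rewrite /A /B !lebesgue_measure_itv/= !lte_fin.
have h (x : R) : x - rho < x + rho by clear -rho0; lra.
by rewrite !h -!EFinD -EFinM; congr (_%:E); ring.
Qed.

(** Splitting at a level, [t <= lam + lam ^ (1 - q) t ^ q], plays the part of Jensen's inequality.
    When [lam ^ q] is the normalized integral [J], both terms are of size [lam], and
    [80 = 64 + 16]. *)
Lemma mean_value_ge1 f (q x0 y0 rho : R) : 1 <= q -> analytic_on_disk f ->
  0 < rho -> square x0 y0 rho `<=` @disk2 R ->
  ((cabs (f (Complex x0 y0)) `^ q)%:E <= (80 `^ q / rho ^+ 2)%:E *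
    \int[mu \x mu]_(w in square x0 y0 rho) (cabs (f (Complex w.1 w.2)) `^ q)%:E)%E.
Proof.
move=> q1 fa rho0 sq; have q0 : 0 < q by rewrite (lt_le_trans ltr01).
set Int := (\int[_ \x _]_(_ in _) _)%E.
have Int0 : (0 <= Int)%E by apply: integral_ge0 => w _; rewrite lee_fin powR_ge0.
case E : Int Int0 => [I| |]//; last first.
  move=> _; rewrite mulry gtr0_sg ?mul1e ?leey//.
  by rewrite divr_gt0 ?powR_gt0// exprn_gt0.
rewrite lee_fin => I0; rewrite -EFinM lee_fin.
set F0 := cabs (f _).
have r2 : 0 < rho ^+ 2 by rewrite exprn_gt0.
pose J := I / rho ^+ 2.
have J0 : 0 <= J by rewrite divr_ge0// ltW.
rewrite mulrAC -mulrA -/J.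
have mf : measurable_fun (square x0 y0 rho) (fun w : RR => (cabs (f (Complex w.1 w.2)) `^ q)%:E).
  apply/measurable_EFinP; apply: measurable_funS (measurable_powR_analytic q fa) => //.
  exact: measurable_disk2.
have key lam : 0 < lam -> F0 <= 64 * lam + 16 * (lam `^ (1 - q) * J).
  move=> lam0.
  have pt (t : R) : 0 <= t -> t <= lam + lam `^ (1 - q) * t `^ q.
    move=> t0; move: q1; rewrite le_eqVlt => /predU1P[<-|q1].
      by rewrite subrr powRr0 mul1r powRr1// lerDr ltW.
    have := powR_split ltr01 q1 lam0 t0; rewrite !powRr1// ltW//.
  have B : (\int[mu \x mu]_(w in square x0 y0 rho) (cabs (f (Complex w.1 w.2)))%:E <=
     (lam * (4 * rho ^+ 2) + lam `^ (1 - q) * I)%:E)%E.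
    apply: (@le_trans _ _ (\int[mu \x mu]_(w in square x0 y0 rho)
        (lam%:E + (lam `^ (1 - q))%:E * (cabs (f (Complex w.1 w.2)) `^ q)%:E))%E).
      apply: ge0_le_integral_sub => w hw.
      - by split => //; rewrite -EFinM -EFinD lee_fin; apply: pt; exact: cabs_ge0.
      - by rewrite lee_fin cabs_ge0.
      - by rewrite -EFinM -EFinD lee_fin addr_ge0 ?mulr_ge0 ?powR_ge0// ltW.
    have mS : measurable (square x0 y0 rho) by exact: measurable_square.
    have f0 (w : RR) : square x0 y0 rho w -> (0 <= (cabs (f (Complex w.1 w.2)) `^ q)%:E)%E.
      by rewrite lee_fin powR_ge0.
    have c0 : (0 <= (lam `^ (1 - q))%:E)%E by rewrite lee_fin powR_ge0.
    rewrite (@ge0_integralD _ _ _ (mu \x mu)%E _ mS (fun=> lam%:E)); last 4 first.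
    - by move=> w _; rewrite lee_fin ltW.
    - exact: measurable_cst.
    - by move=> w /f0 h; rewrite mule_ge0.
    - exact: measurable_funeM.
    rewrite integral_cst// (ge0_integralZl _ mS mf f0 c0).
    rewrite [X in (lam%:E * X + _)%E](_ : _ = (4 * rho ^+ 2)%:E); last exact: lebesgue_square.
    by rewrite -/Int E -!EFinM -EFinD.
  have := le_trans (mean_value_square fa rho0 sq) (lee_wpmul2l _ B).
  rewrite lee_fin divr_ge0 ?exprn_ge0 ?(ltW rho0)// => /(_ isT).
  rewrite -EFinM lee_fin => /le_trans; apply; rewrite /J le_eqVlt; apply/orP; left; apply/eqP.
  by field; rewrite gt_eqF.
apply/ler_addgt0Pr => e e0.
(* The increment [c] keeps [lam] positive when [J = 0], and costs [80 ^ q * c = e]. *)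
pose c := e / 80 `^ q.
have c0 : 0 < c by rewrite divr_gt0// powR_gt0.
have Jc : 0 < J + c by rewrite ltr_wpDl.
pose lam := (J + c) `^ q^-1.
have lam0 : 0 < lam by rewrite powR_gt0.
have lamq : lam `^ q = J + c.
  by rewrite /lam -powRrM mulVf ?gt_eqF// powRr1// ltW.
have F80 : F0 <= 80 * lam.
  apply: (le_trans (key lam lam0)).
  have : lam `^ (1 - q) * J <= lam.
    have -> : lam `^ (1 - q) = lam / (J + c).
      by rewrite powRB ?powRr1 ?(ltW lam0)// ?lamq// (gt_eqF lam0) implybT.
    rewrite mulrAC ler_pdivrMr// ler_wpM2l ?(ltW lam0)// lerDl ltW//.
  lra.
have -> : 80 `^ q * J + e = (80 * lam) `^ q.
  by rewrite powRM ?(ltW lam0)// lamq mulrDr /c [X in _ = _ + X]mulrC divfK// gt_eqF// powR_gt0.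
by rewrite ge0_ler_powR ?nnegrE ?(ltW q0) ?cabs_ge0// mulr_ge0// ltW.
Qed.

(* The weighted supremum absorbs [|f|^(1-q)], whence a mean value property for [q < 1]. *)
Lemma mean_value_lt1 f (q x0 y0 rho s : R) : 0 < q -> q < 1 -> analytic_on_disk f ->
  0 < rho -> s < 1 -> (forall w, square x0 y0 rho w -> cabs (Complex w.1 w.2) <= s) ->
  ((cabs (f (Complex x0 y0)) `^ q)%:E <=
    (64 * 2 `^ (2 * (1 - q) / q) / rho ^+ 2)%:E *
    \int[mu \x mu]_(w in square x0 y0 rho) (cabs (f (Complex w.1 w.2)) `^ q)%:E)%E.
Proof.
move=> q0 q1 fa rho0 s1 sq.
set Int := (\int[_ \x _]_(_ in _) _)%E; set K := 64 * _.
have K0 : 0 < K by rewrite mulr_gt0// powR_gt0.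
have Int0 : (0 <= Int)%E by apply: integral_ge0 => w _; rewrite lee_fin powR_ge0.
case E : Int Int0 => [I| |]//; last first.
  move=> _; rewrite mulry gtr0_sg ?mul1e ?leey//.
  by rewrite divr_gt0 ?powR_gt0// exprn_gt0.
rewrite lee_fin => I0; rewrite -EFinM lee_fin.
have [M M0 HM] := analytic_bounded fa s1.
(* On the square this is the distance to its boundary in the maximum norm. *)
pose dist (w : RR) := rho - Num.max `|w.1 - x0| `|w.2 - y0|.
pose A := [set cabs (f (Complex w.1 w.2)) * dist w `^ (2 / q) | w in square x0 y0 rho].
have in_sq (w : RR) : square x0 y0 rho w <-> 0 <= dist w.
  by rewrite squareP /dist subr_ge0 ge_max; split => [[-> ->]|/andP].
have dist_le (w : RR) : dist w <= rho by rewrite /dist gerBl le_max normr_ge0.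
have qp : 0 < 2 / q by rewrite divr_gt0.
(* The supremum is finite because the square lies in the smaller disk of radius [s]; this is what
   allows a power of [N] to be divided out at the end. *)
have Aub : has_ubound A.
  exists (M * rho `^ (2 / q)) => _ [w wS <-]; have dw := (in_sq w).1 wS.
  rewrite ler_pM ?cabs_ge0 ?powR_ge0//; first exact/HM/sq.
  by rewrite ge0_ler_powR ?nnegrE ?(ltW qp)// ltW.
pose N := sup A.
have leN (w : RR) : square x0 y0 rho w -> cabs (f (Complex w.1 w.2)) * dist w `^ (2 / q) <= N.
  by move=> wS; apply: ub_le_sup => //; exists w.
have d0 : dist (x0, y0) = rho by rewrite /dist /= !subrr normr0 maxxx subr0.
have c0 : square x0 y0 rho (x0, y0) by apply/in_sq; rewrite d0 ltW.
have N0 : 0 <= N by rewrite (le_trans _ (leN _ c0))// mulr_ge0 ?cabs_ge0 ?powR_ge0.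
have main (w : RR) : square x0 y0 rho w ->
    cabs (f (Complex w.1 w.2)) * dist w `^ (2 / q) <= K * N `^ (1 - q) * I.
  move=> wS; have := (in_sq w).1 wS; rewrite le_eqVlt => /predU1P[<-|dw].
    by rewrite powR0 ?gt_eqF// mulr0 !mulr_ge0 ?powR_ge0// ltW.
  set d := dist w in dw *.
  have d2 : 0 < d / 2 by rewrite divr_gt0.
  have sub (w' : RR) : square w.1 w.2 (d / 2) w' -> d / 2 <= dist w'.
    move=> /squareP[h1 h2]; rewrite /dist lerBrDr -lerBrDl ge_max.
    have hx : `|w'.1 - x0| <= `|w'.1 - w.1| + `|w.1 - x0| by exact: ler_distD.
    have hy : `|w'.2 - y0| <= `|w'.2 - w.2| + `|w.2 - y0| by exact: ler_distD.
    have : d <= rho - `|w.1 - x0| by rewrite /d /dist lerB// le_max lexx.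
    have : d <= rho - `|w.2 - y0| by rewrite /d /dist lerB// le_max lexx orbT.
    by move=> g1 g2; apply/andP; split; lra.
  have sub1 (w' : RR) : square w.1 w.2 (d / 2) w' -> square x0 y0 rho w'.
    by move=> /sub h; apply/in_sq; rewrite (le_trans _ h)// ltW.
  have sqD : square w.1 w.2 (d / 2) `<=` @disk2 R.
    by move=> w' /sub1/sq h; rewrite /disk2 /= /unit_disk /= (le_lt_trans h).
  pose L := (N * (d / 2) `^ (- (2 / q))) `^ (1 - q).
  have B : (\int[mu \x mu]_(w' in square w.1 w.2 (d / 2)) (cabs (f (Complex w'.1 w'.2)))%:E <=
      (L * I)%:E)%E.
    rewrite EFinM -E -ge0_integralZl//; last 4 first.
    - exact: measurable_square.
    - apply/measurable_EFinP; apply: measurable_funS (measurable_powR_analytic q fa).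
        exact: measurable_disk2.
      by move=> w' /sq h; rewrite /disk2 /= /unit_disk /= (le_lt_trans h).
    - by move=> w' _; rewrite lee_fin powR_ge0.
    - by rewrite lee_fin powR_ge0.
    apply: ge0_le_integral_sub => w' hw'.
    - split; first exact: sub1.
      rewrite -EFinM lee_fin; set t := cabs _.
      have t0 : 0 <= t by exact: cabs_ge0.
      have tN : t <= N * (d / 2) `^ (- (2 / q)).
        rewrite powRN ler_pdivlMr ?powR_gt0// (le_trans _ (leN _ (sub1 _ hw')))//.
        rewrite ler_wpM2l// ge0_ler_powR ?nnegrE ?(ltW qp) ?(ltW d2)//; last exact: sub.
        by rewrite (le_trans _ (sub _ hw'))// ltW.
      move: t0; rewrite le_eqVlt => /predU1P[<-|t0]; first by rewrite mulr_ge0 ?powR_ge0.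
      rewrite [leLHS](_ : t = t `^ (1 - q) * t `^ q); last first.
        by rewrite -powRD ?subrK ?powRr1// ?(ltW t0)// (gt_eqF t0) implybT.
      rewrite ler_wpM2r ?powR_ge0// ge0_ler_powR ?nnegrE ?subr_ge0 ?(ltW q1) ?(ltW t0)//.
      by rewrite (le_trans (ltW t0)).
    - by rewrite lee_fin cabs_ge0.
    - by rewrite mule_ge0// lee_fin powR_ge0.
  have := le_trans (mean_value_square fa d2 sqD) (lee_wpmul2l _ B).
  rewrite lee_fin divr_ge0 ?exprn_ge0 ?(ltW d2)// => /(_ isT).
  rewrite -EFinM lee_fin => h.
  apply: (le_trans (ler_wpM2r (powR_ge0 _ _) h)).
  rewrite /L (powRM _ N0 (powR_ge0 _ _)) -powRrM.
  (* [2 / q = 2 + (2 / q) (1 - q)]: two powers of the distance cancel the area of the inner square,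
     the others the power hidden in [L]. *)
  have e1 : d `^ (2 / q) = d ^+ 2 * d `^ (2 / q * (1 - q)).
    rewrite -(powR_mulrn 2 (ltW dw)) -powRD; last by rewrite (gt_eqF dw) implybT.
    by congr (_ `^ _); field; rewrite gt_eqF.
  have e2 : (d / 2) `^ (- (2 / q) * (1 - q)) = 2 `^ (2 * (1 - q) / q) / d `^ (2 / q * (1 - q)).
    rewrite mulNr powRN (_ : 2 * (1 - q) / q = 2 / q * (1 - q)); last by field; rewrite gt_eqF.
    rewrite -[X in _ / X `^ _](divfK (lt0r_neq0 (ltr0n R 2)) d) [in RHS](powRM _ (ltW d2))//.
    by field; rewrite !gt_eqF ?powR_gt0.
  rewrite e1 e2 /K le_eqVlt; apply/orP; left; apply/eqP.
  by field; rewrite ?gt_eqF ?powR_gt0.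
have NK : N <= K * N `^ (1 - q) * I.
  by apply: ge_sup; [exists (cabs (f (Complex x0 y0)) * rho `^ (2 / q)), (x0, y0); rewrite ?d0
    |move=> _ [w wS <-]; exact: main].
have NqK : N `^ q <= K * I.
  move: N0; rewrite le_eqVlt => /predU1P[<-|N0].
    by rewrite powR0 ?gt_eqF// mulr_ge0// ltW.
  have e : N = N `^ (1 - q) * N `^ q.
    by rewrite -powRD ?subrK ?powRr1// ?(ltW N0)// (gt_eqF N0) implybT.
  have : N `^ (1 - q) * N `^ q <= N `^ (1 - q) * (K * I) by rewrite -e mulrA [N `^ _ * K]mulrC.
  by rewrite ler_pM2l// powR_gt0.
rewrite mulrAC ler_pdivlMr ?exprn_gt0// (le_trans _ NqK)//.
have -> : cabs (f (Complex x0 y0)) `^ q * rho ^+ 2 = (cabs (f (Complex x0 y0)) * rho `^ (2 / q)) `^ q.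
  rewrite powRM ?cabs_ge0 ?powR_ge0// -powRrM divfK ?gt_eqF//.
  by rewrite (powR_mulrn 2 (ltW rho0)).
have := leN _ c0; rewrite d0 => h.
by rewrite ge0_ler_powR ?nnegrE ?(ltW q0)// mulr_ge0 ?cabs_ge0 ?powR_ge0.
Qed.

Lemma mean_value_pow (q : R) : 0 < q -> exists2 K : R, 0 < K &
  forall f (x0 y0 rho s : R), analytic_on_disk f -> 0 < rho -> s < 1 ->
  (forall w, square x0 y0 rho w -> cabs (Complex w.1 w.2) <= s) ->
  ((cabs (f (Complex x0 y0)) `^ q)%:E <= (K / rho ^+ 2)%:E *
    \int[mu \x mu]_(w in square x0 y0 rho) (cabs (f (Complex w.1 w.2)) `^ q)%:E)%E.
Proof.
move=> q0; have [q1|q1] := ltP q 1.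
  exists (64 * 2 `^ (2 * (1 - q) / q)); first by rewrite mulr_gt0// powR_gt0.
  by move=> f x0 y0 rho s fa rho0 s1 sq; apply: mean_value_lt1 sq.
exists (80 `^ q); first by rewrite powR_gt0.
move=> f x0 y0 rho s fa rho0 s1 sq; apply: mean_value_ge1 => // w /sq h.
by rewrite /disk2 /= /unit_disk /= (le_lt_trans h).
Qed.

End PowerMeanValue.

(** * Cone integrals and the local estimate *)

Section ConeIntegrals.
Variable R : realType.
Local Notation C := R[i].
Notation mu := (@lebesgue_measure R).
Local Notation RR := (measurableTypeR R * measurableTypeR R)%type.
Implicit Types (f : C -> C).

(** The polynomial form in [w.1], [w.2], [cos t] and [sin t] exhibits joint measurability in [t] and
    [w]. *)
Lemma Gamma_expiE (t : R) (w : RR) : Gamma (expi t) (Complex w.1 w.2) <->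
  w.1 ^+ 2 + w.2 ^+ 2 < 1 /\
  (1 - (w.1 * cos t + w.2 * sin t)) ^+ 2 + (w.2 * cos t - w.1 * sin t) ^+ 2 <
    (1 - (w.1 ^+ 2 + w.2 ^+ 2)) ^+ 2.
Proof.
case: w => x y; change (cabs (Complex x y) < 1 /\
    cabs (1 - Complex x y * (expi t)^* ) < 1 - cabs (Complex x y) ^+ 2 <->
  x ^+ 2 + y ^+ 2 < 1 /\
  (1 - (x * cos t + y * sin t)) ^+ 2 + (y * cos t - x * sin t) ^+ 2 <
    (1 - (x ^+ 2 + y ^+ 2)) ^+ 2).
have -> : 1 - Complex x y * (expi t)^* =
    Complex (1 - (x * cos t + y * sin t)) (- (y * cos t - x * sin t)).
  by rewrite conj_expi /expi cosN sinN; simpc; congr Complex; ring.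
rewrite -[cabs _ < 1](@ltr_pXn2r _ 2)// ?nnegrE ?cabs_ge0// expr1n !cabs_sqr.
have -> : (1 - (x * cos t + y * sin t)) ^+ 2 + (y * cos t - x * sin t) ^+ 2 =
    cabs (Complex (1 - (x * cos t + y * sin t)) (- (y * cos t - x * sin t))) ^+ 2.
  by rewrite cabs_sqr sqrrN.
by split => -[h1 h2]; split => //; move: h2; rewrite ltr_pXn2r// ?nnegrE ?cabs_ge0 ?subr_ge0 ?(ltW h1).
Qed.

Lemma measurable_Gamma_graph :
  measurable ([set x | Gamma (expi x.1) (Complex x.2.1 x.2.2)] : set (measurableTypeR R * RR)).
Proof.
pose X := measurableTypeR R.
have mt : measurable_fun [set: X * RR] (fun x : X * RR => x.1) by exact: measurable_fst.
have mx : measurable_fun [set: X * RR] (fun x : X * RR => x.2.1).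
  by apply: measurableT_comp; [exact: measurable_fst|exact: measurable_snd].
have my : measurable_fun [set: X * RR] (fun x : X * RR => x.2.2).
  by apply: measurableT_comp; [exact: measurable_snd|exact: measurable_snd].
have mc : measurable_fun [set: X * RR] (fun x : X * RR => cos x.1).
  by apply: measurableT_comp => //; apply: continuous_measurable_fun; exact: continuous_cos.
have ms : measurable_fun [set: X * RR] (fun x : X * RR => sin x.1).
  by apply: measurableT_comp => //; apply: continuous_measurable_fun; exact: continuous_sin.
pose n2 (x : X * RR) : R := x.2.1 ^+ 2 + x.2.2 ^+ 2.
have mn : measurable_fun [set: X * RR] n2.
  by apply: measurable_funD; exact: measurable_funX.
pose d2 (x : X * RR) : R := (1 - (x.2.1 * cos x.1 + x.2.2 * sin x.1)) ^+ 2 +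
  (x.2.2 * cos x.1 - x.2.1 * sin x.1) ^+ 2.
have md : measurable_fun [set: X * RR] d2.
  apply: measurable_funD; apply: measurable_funX; apply: measurable_funB => //.
  - by apply: measurable_funD; exact: measurable_funM.
  - exact: measurable_funM.
  - exact: measurable_funM.
have mr : measurable_fun [set: X * RR] (fun x => (1 - n2 x) ^+ 2).
  by apply: measurable_funX; exact: measurable_funB.
rewrite (_ : [set x | _] = (fun x => n2 x < 1) @^-1` [set true] `&`
    (fun x => d2 x < (1 - n2 x) ^+ 2) @^-1` [set true]); last first.
  by apply/seteqP; split => x /=; rewrite Gamma_expiE.
apply: measurableI; rewrite -[X in measurable X]setTI.
- by apply: (measurable_fun_ltr mn (measurable_cst _)).
- by apply: (measurable_fun_ltr md mr).
Qed.

(** The integrand is patched on the graph of the cones and the two real coordinates are integrated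
    out one after the other, so that the measurability of partial integrals applies twice. *)
Lemma measurable_area (h : C -> R) : (forall z, 0 <= h z) ->
  measurable_fun (@disk2 R) (fun w : RR => h (Complex w.1 w.2)) ->
  measurable_fun [set: measurableTypeR R]
    (fun t => area_integral (Gamma (expi t)) (fun z => (h z)%:E)).
Proof.
move=> h0 mh.
pose Phi : measurableTypeR R * RR -> \bar R :=
  (fun x : measurableTypeR R * RR => (h (Complex x.2.1 x.2.2))%:E) \_
  [set x | Gamma (expi x.1) (Complex x.2.1 x.2.2)].
have mPhi : measurable_fun [set: measurableTypeR R * RR] Phi.
  apply/(measurable_restrictT _ measurable_Gamma_graph).
  apply/measurable_EFinP.
  apply: (measurable_comp (@measurable_disk2 R) _ mh); last exact: measurable_funTS measurable_snd.
  by move=> _ [x [xD _] <-].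
have Phi0 x : (0 <= Phi x)%E by rewrite /Phi patchE; case: ifP => // _; rewrite lee_fin.
pose Phi' (x : (measurableTypeR R * measurableTypeR R) * measurableTypeR R) : \bar R :=
  Phi (x.1.1, (x.1.2, x.2)).
have mPhi' : measurable_fun setT Phi'.
  apply: (measurableT_comp mPhi); apply: measurable_fun_pair.
    by apply: measurableT_comp; [exact: measurable_fst|exact: measurable_fst].
  apply: measurable_fun_pair; last exact: measurable_snd.
  by apply: measurableT_comp; [exact: measurable_snd|exact: measurable_fst].
have m1 : measurable_fun [set: RR] (fubini_F mu Phi').
  apply: (@measurable_fun_fubini_tonelli_F _ _ RR (measurableTypeR R) R mu Phi' mPhi').
  by move=> x; exact: Phi0.
have m2 : measurable_fun [set: measurableTypeR R] (fubini_F mu (fubini_F mu Phi')).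
  apply: (@measurable_fun_fubini_tonelli_F _ _ (measurableTypeR R) (measurableTypeR R) R mu _ m1).
  by move=> x; apply: integral_ge0 => y _; exact: Phi0.
have : measurable_fun [set: measurableTypeR R] (fun t => \int[mu \x mu]_w Phi (t, w))%E.
  apply: eq_measurable_fun m2 => t _; rewrite fubini_tonelli1//.
  by apply: (measurableT_comp mPhi); exact: pair1_measurable.
apply: eq_measurable_fun => t _.
rewrite /area_integral [RHS]integral_mkcond; apply: eq_integral => w _.
by rewrite /Phi !patchE; congr (if _ then _ else _); apply/idP/idP; rewrite !inE.
Qed.

Lemma measurable_cabs : measurable_fun [set: RR] (fun w : RR => cabs (Complex w.1 w.2)).
Proof.
have -> : (fun w : RR => cabs (Complex w.1 w.2)) = (fun w : RR => (w.1 ^+ 2 + w.2 ^+ 2) `^ (2^-1)).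
  by apply/funext => w; rewrite /cabs /= powR12_sqrt// addr_ge0 ?sqr_ge0.
apply: (measurableT_comp (measurable_powR _)).
by apply: measurable_funD; apply: measurable_funX; [exact: measurable_fst|exact: measurable_snd].
Qed.

Definition density f (q alpha : R) (z : C) : R :=
  cabs (f z) `^ q * (1 - cabs z ^+ 2) `^ alpha.

Definition cone_area f q alpha (t : R) : \bar R :=
  area_integral (Gamma (expi t)) (fun z => (density f q alpha z)%:E).

(** This is [tau_k] at [xi = expi t]. *)
Definition cone_shell f q alpha (k : nat) (t : R) : \bar R :=
  area_integral (Gamma (expi t)) (fun z =>
    (density f q alpha z * wt (2 ^+ k * (1 - cabs z)))%:E).

Lemma density_ge0 f q alpha z : 0 <= density f q alpha z.
Proof. by rewrite mulr_ge0 ?powR_ge0. Qed.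

Lemma measurable_density f q alpha : analytic_on_disk f ->
  measurable_fun (@disk2 R) (fun w : RR => density f q alpha (Complex w.1 w.2)).
Proof.
move=> fa; apply: measurable_funM; first exact: measurable_powR_analytic.
apply: (measurableT_comp (measurable_powR alpha)).
apply: measurable_funTS; apply: measurable_funB => //.
by apply: measurable_funX; exact: measurable_cabs.
Qed.

Lemma measurable_wt : measurable_fun [set: R] (@wt R).
Proof.
apply: measurable_funM => //.
have -> : (fun x : R => ((1 + x) ^+ 2)^-1) = (fun x => ((1 + x) ^+ 2) `^ (-1)).
  by apply/funext => x; rewrite powR_inv1// sqr_ge0.
apply: (measurableT_comp (measurable_powR _)).
by apply: measurable_funX; exact: measurable_funD.
Qed.

Lemma measurable_shell f q alpha k : analytic_on_disk f ->
  measurable_fun (@disk2 R) (fun w : RR => density f q alpha (Complex w.1 w.2) *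
    wt (2 ^+ k * (1 - cabs (Complex w.1 w.2)))).
Proof.
move=> fa; apply: measurable_funM; first exact: measurable_density.
apply: measurable_funTS; apply: (measurableT_comp measurable_wt).
by apply: measurable_funM => //; apply: measurable_funB => //; exact: measurable_cabs.
Qed.

(* Outside of the disk [wt] may be negative, hence the detour through a patched function. *)
Lemma cone_shell_patch f q alpha k t : cone_shell f q alpha k t =
  area_integral (Gamma (expi t)) (fun z =>
    (if cabs z < 1 then density f q alpha z * wt (2 ^+ k * (1 - cabs z)) else 0)%:E).
Proof.
rewrite /cone_shell /area_integral; apply: eq_integral => w; rewrite inE => -[/= h _].
by move: h; rewrite /unit_disk /= => ->.
Qed.

Lemma shell_ge0 f q alpha k z : cabs z < 1 ->
  0 <= density f q alpha z * wt (2 ^+ k * (1 - cabs z)).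
Proof.
move=> z1; rewrite mulr_ge0 ?density_ge0// wt_ge0// mulr_ge0 ?exprn_ge0// subr_ge0 ltW//.
Qed.

Lemma measurable_cone_shell f q alpha k : analytic_on_disk f ->
  measurable_fun [set: measurableTypeR R] (cone_shell f q alpha k).
Proof.
move=> fa; have -> : cone_shell f q alpha k = (fun t => area_integral (Gamma (expi t)) (fun z =>
    (if cabs z < 1 then density f q alpha z * wt (2 ^+ k * (1 - cabs z)) else 0)%:E)).
  by apply/funext => t; exact: cone_shell_patch.
apply: measurable_area.
  by move=> z; case: ifPn => // z1; exact: shell_ge0.
apply: eq_measurable_fun (measurable_shell q alpha k fa) => w; rewrite inE /disk2 /= => h.
by move: h; rewrite /unit_disk /= => ->.
Qed.

Lemma measurable_cone_area f q alpha : analytic_on_disk f ->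
  measurable_fun [set: measurableTypeR R] (cone_area f q alpha).
Proof.
move=> fa; apply: measurable_area => [z|]; first exact: density_ge0.
exact: measurable_density.
Qed.

Lemma cone_area_ge0 f q alpha t : (0 <= cone_area f q alpha t)%E.
Proof. by apply: integral_ge0 => w _; rewrite lee_fin density_ge0. Qed.

Lemma cone_shell_ge0 f q alpha k t : (0 <= cone_shell f q alpha k t)%E.
Proof. by apply: integral_ge0 => w [h _]; rewrite lee_fin shell_ge0. Qed.

Lemma cone_shell_le_area f q alpha k t :
  (cone_shell f q alpha k t <= cone_area f q alpha t)%E.
Proof.
apply: ge0_le_integral_sub => w.
- move=> hw; split => //; have [z1 _] := hw; rewrite lee_fin ler_piMr ?density_ge0//.
  by apply: wt_le1; rewrite mulr_ge0 ?exprn_ge0// subr_ge0 ltW.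
- by move=> [z1 _]; rewrite lee_fin shell_ge0.
- by move=> _; rewrite lee_fin density_ge0.
Qed.

Lemma measurable_Gamma (t : R) :
  measurable ([set w | Gamma (expi t) (Complex w.1 w.2)] : set RR).
Proof.
have := @measurable_xsection _ _ _ _ _ (t : measurableTypeR R) measurable_Gamma_graph.
by congr (measurable _); apply/seteqP; split => w; rewrite /xsection /= ?inE.
Qed.

(** The 2 is the telescoping bound [b / (b - 1)] for [b = 2], applied under the integral. *)
Lemma sum_cone_shell f q alpha n t : analytic_on_disk f ->
  (\sum_(0 <= k < n) cone_shell f q alpha k t <= 2%:E * cone_area f q alpha t)%E.
Proof.
move=> fa; have sub : [set w : RR | Gamma (expi t) (Complex w.1 w.2)] `<=` @disk2 R by move=> w [].
have mG := measurable_Gamma t.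
have mh k : measurable_fun [set w : RR | Gamma (expi t) (Complex w.1 w.2)]
    (fun w : RR => (density f q alpha (Complex w.1 w.2) *
       wt (2 ^+ k * (1 - cabs (Complex w.1 w.2))))%:E).
  apply/measurable_EFinP; apply: measurable_funS sub (measurable_shell q alpha k fa).
  exact: measurable_disk2.
have md : measurable_fun [set w : RR | Gamma (expi t) (Complex w.1 w.2)]
    (fun w : RR => (density f q alpha (Complex w.1 w.2))%:E).
  apply/measurable_EFinP; apply: measurable_funS sub (measurable_density q alpha fa).
  exact: measurable_disk2.
have h0 k (w : RR) : Gamma (expi t) (Complex w.1 w.2) ->
    (0 <= (density f q alpha (Complex w.1 w.2) *
       wt (2 ^+ k * (1 - cabs (Complex w.1 w.2))))%:E)%E.
  by move=> [z1 _]; rewrite lee_fin shell_ge0.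
have d0 (w : RR) : Gamma (expi t) (Complex w.1 w.2) ->
    (0 <= (density f q alpha (Complex w.1 w.2))%:E)%E.
  by move=> _; rewrite lee_fin density_ge0.
rewrite /cone_shell /area_integral -(ge0_integral_sum (mu \x mu)%E mG mh h0).
rewrite /cone_area /area_integral -(ge0_integralZl (mu \x mu)%E mG md d0)//.
apply: ge0_le_integral_sub => w.
- move=> hw; split => //; have [z1 _] := hw; rewrite sumEFin -EFinM lee_fin.
  rewrite -mulr_sumr mulrC ler_wpM2r ?density_ge0//.
  have del0 : 0 < 1 - cabs (Complex w.1 w.2) by rewrite subr_gt0.
  have b1 : 1 < 2 :> R by rewrite ltr1n.
  apply: le_trans (sum_wt_geometric n b1 del0) _.
  by rewrite ler_pdivrMr; lra.
- by move=> [z1 _]; apply: sume_ge0 => k _; rewrite lee_fin shell_ge0.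
- by move=> _; rewrite -EFinM lee_fin mulr_ge0 ?density_ge0.
Qed.

End ConeIntegrals.

(** * The pointwise bound by a shell of the cone, and the discretized mixed norm *)

Section ConeEstimate.
Variable R : realType.
Local Notation C := R[i].
Notation mu := (@lebesgue_measure R).
Local Notation RR := (measurableTypeR R * measurableTypeR R)%type.
Implicit Types (f : C -> C).

(** The power is least at one of the ends of [[1/4, 4]], according to the sign of [a]. *)
Lemma powR_window (y a : R) : 4^-1 <= y -> y <= 4 -> 4 `^ (- `|a|) <= y `^ a.
Proof.
move=> y1 y2; have y0 : 0 < y by lra.
have [a0|a0] := leP 0 a.
  rewrite ger0_norm// powRN -powR_inv1// powRAC powR_inv1// ?powR_ge0//.
  by rewrite ge0_ler_powR ?nnegrE//; lra.
have [b b0 ->] : exists2 b, 0 < b & a = - b by exists (- a); rewrite ?oppr_gt0 ?opprK.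
rewrite normrN (gtr0_norm b0) !powRN lef_pV2 ?posrE ?powR_gt0//.
by rewrite ge0_ler_powR ?nnegrE ?(ltW b0)//; lra.
Qed.

Lemma wt_window (y : R) : 4^-1 <= y -> y <= 4 -> 100^-1 <= wt y.
Proof.
move=> y1 y2; rewrite /wt ler_pdivlMr ?exprn_gt0//; last lra.
have : (1 + y) ^+ 2 <= 5 ^+ 2 by rewrite ler_pXn2r ?nnegrE//; lra.
lra.
Qed.

Lemma polarE (r t : R) : r%:C%C * expi t = Complex (r * cos t) (r * sin t).
Proof. by rewrite /expi; simpc. Qed.

Lemma cabs_polar (r t : R) : 0 <= r -> cabs (r%:C%C * expi t) = r.
Proof. by move=> r0; rewrite cabsM cabs_real cabs_expi mulr1 ger0_norm. Qed.

Lemma cabs_1Bconj (z : C) (t : R) : cabs (1 - z * (expi t)^* ) = cabs (expi t - z).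
Proof.
rewrite -[RHS]mulr1 -[X in _ = _ * X](cabs_expi (- t)) -cabsM.
by rewrite mulrBl conj_expi expiN.
Qed.

(** With [eta = 1 - r], the square of half-side [eta / 16] about [r expi t] lies in the cone at
    [expi t']: its points [w] have distance at most [eta / 16 + eta + eta / 8] from the vertex,
    which is less than [1 - |w| ^ 2] since [eta <= 1/2]. On the square the weight and
    [(2 ^ k (1 - |w| ^ 2)) ^ alpha] are bounded below, so the mean value inequality turns into a
    bound by the shell integral. *)
Lemma cone_estimate (q alpha : R) : 0 < q -> exists2 K : R, 0 < K &
  forall f k (r t t' : R), analytic_on_disk f -> 2^-1 <= r ->
  (2^-1) ^+ k.+1 < 1 - r -> 1 - r <= (2^-1) ^+ k -> `|t - t'| <= (1 - r) / 16 ->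
  ((cabs (f (r%:C%C * expi t)) `^ q)%:E <=
    (K * (2 ^+ k) `^ (alpha + 2))%:E * cone_shell f q alpha k t')%E.
Proof.
move=> q0; have [K K0 HK] := mean_value_pow q0.
exists (K * 32 ^+ 2 * (100 * 4 `^ `|alpha|)).
  by apply: mulr_gt0; apply: mulr_gt0; rewrite ?exprn_gt0 ?powR_gt0 ?ltr0n.
move=> f k r t t' fa r1 hk1 hk2 htt.
set T : R := 2 ^+ k; have T0 : 0 < T by rewrite exprn_gt0.
have TT : T * (2^-1) ^+ k = 1 by rewrite /T -exprMn mulfV// expr1n.
set eta := 1 - r in hk1 hk2 htt *.
have rE : r = 1 - eta by rewrite /eta; lra.
have eta1 : eta <= 2^-1 by rewrite /eta; lra.
have Te1 : 2^-1 < T * eta.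
  by have := hk1; rewrite -(ltr_pM2l T0) exprS mulrCA TT mulr1.
have Te2 : T * eta <= 1 by rewrite -TT ler_pM2l.
have eta0 : 0 < eta by rewrite -(pmulr_rgt0 _ T0); lra.
pose rho := eta / 16.
have rho0 : 0 < rho by rewrite divr_gt0.
set z0 := r%:C%C * expi t.
have cz0 : cabs z0 = r by rewrite cabs_polar//; lra.
have near (w : RR) : square (r * cos t) (r * sin t) rho w ->
    cabs (Complex w.1 w.2 - z0) <= eta / 8.
  move=> /squareP[h1 h2]; rewrite /z0 polarE (le_trans (cabs_le_coord _ _ _ _))//.
  by rewrite /rho in h1 h2; lra.
have bounds (w : RR) : square (r * cos t) (r * sin t) rho w ->
    1 - cabs (Complex w.1 w.2) <= 9 / 8 * eta /\ 7 / 8 * eta <= 1 - cabs (Complex w.1 w.2).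
  move=> /near h; have := le_trans (cabs_lip (Complex w.1 w.2) z0) h.
  by rewrite cz0 ler_norml rE => /andP[h1 h2]; split; clear -h1 h2; lra.
have inG (w : RR) : square (r * cos t) (r * sin t) rho w -> Gamma (expi t') (Complex w.1 w.2).
  move=> hw; have [b1 b2] := bounds w hw; split; first by change (cabs (Complex w.1 w.2) < 1); clear -b2 eta0; lra.
  rewrite cabs_1Bconj.
  have h1 : cabs (expi t' - expi t) <= eta / 16.
    by rewrite (le_trans (cabs_expiB _ _))// distrC.
  have h2 : cabs (expi t - z0) = eta.
    have -> : expi t - z0 = eta%:C%C * expi t.
      rewrite /z0 -[X in X - _]mul1r -mulrBl; congr (_ * _).
      by rewrite /eta (rmorphB (real_complex R)) rmorph1.
    by rewrite cabsM cabs_real cabs_expi mulr1 ger0_norm// ltW.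
  have h3 : cabs (z0 - Complex w.1 w.2) <= eta / 8 by rewrite cabsBC near.
  have h4 := le_trans (cabs_dist (expi t') (expi t) _) (lerD h1 (cabs_dist (expi t) z0 (Complex w.1 w.2))).
  rewrite h2 in h4.
  apply: (@le_lt_trans _ _ (19 / 16 * eta)); first by clear -h4 h3; lra.
  have c0 := cabs_ge0 (Complex w.1 w.2).
  move: (cabs (Complex w.1 w.2)) c0 b1 b2 => m m0 b1 b2.
  have : m ^+ 2 <= (1 - 7 / 8 * eta) ^+ 2.
    by rewrite ler_pXn2r ?nnegrE//; clear -m0 b1 b2; lra.
  have : (1 - 7 / 8 * eta) ^+ 2 = 1 - 7 / 4 * eta + 49 / 64 * (eta * eta) by field.
  have : eta * eta <= 2^-1 * eta by rewrite ler_pM2r.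
  clear -eta0; lra.
have sq (w : RR) : square (r * cos t) (r * sin t) rho w -> cabs (Complex w.1 w.2) <= 1 - 7 / 8 * eta.
  by move=> /bounds[_ h]; clear -h; lra.
have s1 : 1 - 7 / 8 * eta < 1 by clear -eta0; lra.
have := HK f _ _ rho _ fa rho0 s1 sq; rewrite -polarE -/z0 => /le_trans; apply.
have c1 : 0 <= 100 * 4 `^ `|alpha| * T `^ alpha by apply: mulr_ge0; rewrite ?mulr_ge0 ?powR_ge0.
have B : (\int[mu \x mu]_(w in square (r * cos t) (r * sin t) rho) (cabs (f (Complex w.1 w.2)) `^ q)%:E <=
    (100 * 4 `^ `|alpha| * T `^ alpha)%:E * cone_shell f q alpha k t')%E.
  have sub : [set w : RR | Gamma (expi t') (Complex w.1 w.2)] `<=` @disk2 R by move=> w [].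
  have mh : measurable_fun [set w : RR | Gamma (expi t') (Complex w.1 w.2)]
      (fun w : RR => (density f q alpha (Complex w.1 w.2) *
       wt (2 ^+ k * (1 - cabs (Complex w.1 w.2))))%:E).
    apply/measurable_EFinP; apply: measurable_funS sub (measurable_shell q alpha k fa).
    exact: measurable_disk2.
  have h0 (w : RR) : Gamma (expi t') (Complex w.1 w.2) ->
      (0 <= (density f q alpha (Complex w.1 w.2) *
       wt (2 ^+ k * (1 - cabs (Complex w.1 w.2))))%:E)%E.
    by move=> [z1 _]; rewrite lee_fin shell_ge0.
  rewrite /cone_shell /area_integral -(ge0_integralZl (mu \x mu)%E (measurable_Gamma t') mh h0)//.
  apply: ge0_le_integral_sub => w hw; last 2 first.
  - by rewrite lee_fin powR_ge0.
  - by rewrite mule_ge0//; exact: h0.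
  split; first exact: inG.
  rewrite -EFinM lee_fin /density; have [b1 b2] := bounds w hw.
  set m := cabs (Complex w.1 w.2) in b1 b2 *; have m0 : 0 <= m by exact: cabs_ge0.
  set F := cabs (f _) `^ q; have F0 : 0 <= F by exact: powR_ge0.
  have m1 : m <= 1 by clear -b2 eta0; lra.
  have d1 : 1 - m <= 1 - m ^+ 2.
    by rewrite lerD2l lerN2 expr2 ler_piMl.
  have d2 : 1 - m ^+ 2 <= 2 * (1 - m).
    have : 0 <= (1 - m) ^+ 2 by exact: sqr_ge0.
    have -> : (1 - m) ^+ 2 = 1 - m *+ 2 + m ^+ 2 by rewrite sqrrB expr1n mul1r.
    rewrite -mulr_natl; clear; lra.
  have g1 : T * (7 / 8 * eta) <= T * (1 - m) by rewrite ler_pM2l.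
  have g2 : T * (1 - m) <= T * (9 / 8 * eta) by rewrite ler_pM2l.
  have g3 : T * (1 - m) <= T * (1 - m ^+ 2) by rewrite ler_pM2l.
  have g4 : T * (1 - m ^+ 2) <= T * (2 * (1 - m)) by rewrite ler_pM2l.
  have w1 : 100^-1 <= wt (T * (1 - m)).
    by apply: wt_window; clear -g1 g2 Te1 Te2; lra.
  have p1 : 4 `^ (- `|alpha|) <= (T * (1 - m ^+ 2)) `^ alpha.
    by apply: powR_window; clear -g1 g2 g3 g4 Te1 Te2; lra.
  rewrite powRM ?(ltW T0)// in p1; last by clear -d1 m1; lra.
  set P := (1 - m ^+ 2) `^ alpha in p1 *.
  have P0 : 0 <= P by exact: powR_ge0.
  have A0 : 0 < 4 `^ `|alpha| :> R by rewrite powR_gt0.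
  have : 1 <= 4 `^ `|alpha| * (T `^ alpha * P).
    by rewrite -ler_pdivrMl// mulr1 -powRN.
  move=> h1; have h2 : 1 <= 100 * wt (T * (1 - m)) by rewrite -ler_pdivrMl ?mulr1.
  have h3 := ler_pM ler01 ler01 h1 h2.
  rewrite mulr1 in h3.
  have -> : 100 * 4 `^ `|alpha| * T `^ alpha * (F * P * wt (T * (1 - m))) =
     F * (4 `^ `|alpha| * (T `^ alpha * P) * (100 * wt (T * (1 - m)))) by ring.
  by rewrite ler_peMr.
apply: (@le_trans _ _ ((K / rho ^+ 2)%:E * ((100 * 4 `^ `|alpha| * T `^ alpha)%:E * cone_shell f q alpha k t'))%E).
  by rewrite lee_wpmul2l// lee_fin divr_ge0 ?exprn_ge0 ?(ltW K0) ?(ltW rho0).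
rewrite muleA -EFinM; apply: lee_wpmul2r; first exact: cone_shell_ge0.
rewrite lee_fin.
(* [rho = eta / 16] and [2 ^ k eta > 1 / 2] give [1 / rho <= 32 * 2 ^ k]. *)
have -> : K * 32 ^+ 2 * (100 * 4 `^ `|alpha|) * T `^ (alpha + 2) =
    K * (32 * T) ^+ 2 * (100 * 4 `^ `|alpha| * T `^ alpha).
  by rewrite powRD ?(gt_eqF T0) ?implybT// (powR_mulrn 2 (ltW T0)); ring.
rewrite ler_wpM2r// ler_wpM2l ?(ltW K0)//.
rewrite /rho -[leRHS]invrK lef_pV2 ?posrE ?invr_gt0 ?exprn_gt0 ?divr_gt0 ?mulr_gt0 ?exprn_gt0//.
rewrite -exprVn.
rewrite ler_pXn2r ?nnegrE ?invr_ge0 ?mulr_ge0 ?divr_ge0 ?(ltW T0) ?(ltW eta0)//.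
rewrite -div1r ler_pdivrMr ?mulr_gt0//.
by clear -Te1; lra.
Qed.

(** The radial integral is discretized: where [1 - r] is about [2 ^ -k] the integrand is at most a
    constant times [y k ^ (v / u) / (1 - r)], and [dr / (1 - r)] has bounded mass on each shell. *)
Lemma mixed_norm_finite f (u v beta K : R) (y : nat -> R) :
  0 < u -> 0 < v -> 0 < beta -> analytic_on_disk f -> (forall k, 0 <= y k) ->
  (forall k r, (0 < k)%N -> (2^-1) ^+ k.+1 < 1 - r -> 1 - r <= (2^-1) ^+ k ->
    (circle_integral (fun xi => (cabs (f (r%:C%C * xi)) `^ u)%:E) <=
      ((2 ^+ k) `^ (beta * u) * y k)%:E)%E) ->
  (forall n, \sum_(0 <= k < n) y k `^ (v / u) <= K) ->
  (mixed_norm u v beta f < +oo)%E.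
Proof.
move=> u0 v0 beta0 fa y0 Hy HK.
have vu0 : 0 < v / u by rewrite divr_gt0.
have [M M0 HM] := @analytic_bounded R f (2^-1) fa (ltac:(lra)).
pose c : R := (2 * pi)^-1.
have c0 : 0 < c by rewrite invr_gt0 mulr_gt0// pi_gt0.
(* The hypothesis starts at [k = 1]. For [k = 0], where [r < 1 / 2], [f] is bounded by [M], and
   [c^-1 = 2 * pi] is the length of the circle. *)
pose y' k := if k is 0%N then c^-1 * M `^ u else y k.
have y'0 k : 0 <= y' k.
  by rewrite /y'; case: k => [|k]; [rewrite mulr_ge0 ?powR_ge0// invr_ge0 ltW|exact: y0].
have Hy' k r : 0 < r -> (2^-1) ^+ k.+1 < 1 - r -> 1 - r <= (2^-1) ^+ k ->
    (circle_integral (fun xi => (cabs (f (r%:C%C * xi)) `^ u)%:E) <=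
      ((2 ^+ k) `^ (beta * u) * y' k)%:E)%E.
  case: k => [|k] r0 h1 h2; last exact: Hy.
  rewrite expr0 powR1 mul1r /circle_integral.
  apply: (@le_trans _ _ (\int[mu]_(t in `[0%R, (2 * pi)%R]) (M `^ u)%:E)%E).
    apply: ge0_le_integral_sub => t ht; rewrite ?lee_fin ?powR_ge0//; split => //.
    rewrite ge0_ler_powR ?nnegrE ?(ltW u0) ?cabs_ge0 ?(ltW M0)//.
    by apply: HM; rewrite cabs_polar ?(ltW r0)//; rewrite expr1 in h1; lra.
  rewrite integral_cst//= lebesgue_measure_itv/= lte_fin mulr_gt0 ?pi_gt0//.
  by rewrite -EFinD -EFinM lee_fin /y' /c invrK subr0 mulrC.
(* On []1/2, 1]] the weight is at least [1 / 18], which the factor [9 * 2] compensates. *)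
pose e k := 9 * (c `^ (v / u) * 2 * y' k `^ (v / u)).
have e0 k : 0 <= e k by rewrite !mulr_ge0 ?powR_ge0.
rewrite /mixed_norm; apply: poweR_lty.
have D : (\int[mu]_(r in `]0%R, 1%R[) (integral_mean u r f `^ v * ((1 - r) `^ (beta * v - 1))%R%:E) <=
   (2 ^+ 1 * 4 `^ 1 * 1 * wt_bound (2 `^ 1))%R%:E * \sum_(0 <= k <oo) (e k)%:E)%E.
  apply: (@dyadic_integral _ (measurableTypeR R) R mu `]0%R, 1%R[%classic (fun r => 1 - r)
    (fun i => `[1 - (2^-1) ^+ i, 1]%classic) 1 2 1 1%N e) => //.
  - move=> i; have <- : lebesgue_measure (`[1 - (2^-1) ^+ i, 1]%classic : set R) =
        (1 * (2^-1) ^+ (i * 1))%:E :> \bar R.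
      rewrite lebesgue_measure_itv/= lte_fin muln1 mul1r.
      by rewrite gtrBl exprn_gt0 ?invr_gt0// -EFinD opprB addrCA subrr addr0.
    exact: lexx.
  - by move=> r /=; rewrite in_itv/= => /andP[? ?]; apply/andP; split; lra.
  - by move=> i r /=; rewrite !in_itv/= => /andP[? ?] ?; apply/andP; split; lra.
  move=> r /=; rewrite in_itv/= => /andP[r0 r1].
  rewrite mule_ge0 ?poweR_ge0//=; last by rewrite lee_fin powR_ge0.
  have d0 : 0 < 1 - r by lra.
  have d1 : 1 - r <= 1 by lra.
  have [k /andP[k1 k2]] := dyadic_exists d0 d1.
  apply: le_trans (nneseries_term_le
    (F := fun k => (e k / (1 - r) ^+ 1 * wt (2 ^+ k * (1 - r)) `^ 1)%:E) k _); last first.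
    move=> j; rewrite lee_fin mulr_ge0 ?powR_ge0// mulr_ge0 ?invr_ge0//.
    by rewrite expr1 ltW.
  have T0 : 0 < 2 ^+ k :> R by rewrite exprn_gt0.
  have TT : 2 ^+ k * (2^-1) ^+ k = 1 :> R by rewrite -exprMn mulfV// expr1n.
  have Te1 : 2^-1 < 2 ^+ k * (1 - r).
    by have := k1; rewrite -(ltr_pM2l T0) exprS mulrCA TT mulr1.
  have Te2 : 2 ^+ k * (1 - r) <= 1 by rewrite -[leRHS]TT ler_pM2l.
  apply: (@le_trans _ _ (((c * ((2 ^+ k) `^ (beta * u) * y' k)) `^ (v / u) *
      (1 - r) `^ (beta * v - 1))%:E)).
    rewrite EFinM; apply: lee_wpmul2r; first by rewrite lee_fin powR_ge0.
    rewrite /integral_mean -poweRrM [u^-1 * v]mulrC -poweR_EFin.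
    apply: gt0_ler_poweR; rewrite ?(ltW vu0) ?in_itv/= ?leey ?andbT//.
    - by rewrite mule_ge0 ?lee_fin ?(ltW c0)// integral_ge0// => t _; rewrite lee_fin powR_ge0.
    - by rewrite lee_fin !mulr_ge0 ?powR_ge0 ?(ltW c0).
    by rewrite EFinM lee_wpmul2l ?lee_fin ?(ltW c0)//; exact: Hy'.
  rewrite lee_fin powRM ?mulr_ge0 ?powR_ge0 ?(ltW c0)// powRM ?powR_ge0//.
  rewrite -powRrM powRr1 ?expr1; last by rewrite wt_ge0// mulr_ge0 ?(ltW T0) ?(ltW d0).
  have -> : beta * u * (v / u) = beta * v by field; rewrite gt_eqF.
  have -> : (1 - r) `^ (beta * v - 1) = (1 - r) `^ (beta * v) / (1 - r).
    by rewrite powRB ?powRr1 ?(ltW d0)// (gt_eqF d0) implybT.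
  set Y := y' k `^ _; have Y0 : 0 <= Y by exact: powR_ge0.
  have P1 : (2 ^+ k) `^ (beta * v) * (1 - r) `^ (beta * v) <= 1.
    rewrite -powRM ?(ltW T0) ?(ltW d0)//.
    rewrite powR_le1//; first by rewrite mulr_ge0 ?(ltW T0) ?(ltW d0).
    by rewrite mulr_ge0 ?(ltW beta0) ?(ltW v0).
  have W1 : 9^-1 / 2 <= wt (2 ^+ k * (1 - r)).
    rewrite /wt ler_pdivlMr ?exprn_gt0//; last by clear -Te1; lra.
    have : (1 + 2 ^+ k * (1 - r)) ^+ 2 <= 2 ^+ 2 by rewrite ler_pXn2r ?nnegrE//; clear -Te1 Te2; lra.
    by clear -Te1; lra.
  rewrite /e -/Y.
  have -> : c `^ (v / u) * ((2 ^+ k) `^ (beta * v) * Y) * ((1 - r) `^ (beta * v) / (1 - r)) =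
    (c `^ (v / u) * Y / (1 - r)) * ((2 ^+ k) `^ (beta * v) * (1 - r) `^ (beta * v)) by ring.
  have -> : 9 * (c `^ (v / u) * 2 * Y) / (1 - r) * wt (2 ^+ k * (1 - r)) =
    (c `^ (v / u) * Y / (1 - r)) * (18 * wt (2 ^+ k * (1 - r))) by ring.
  rewrite ler_wpM2l ?divr_ge0 ?mulr_ge0 ?powR_ge0 ?(ltW d0)//.
  by rewrite (le_trans P1)//; clear -W1; lra.
apply: (le_lt_trans D).
have S : (\sum_(0 <= k <oo) (e k)%:E <= (9 * (c `^ (v / u) * 2) * (y' 0%N `^ (v / u) + K))%:E)%E.
  apply: nneseries_EFin_le => // n.
  have -> : \sum_(0 <= k < n) e k = 9 * (c `^ (v / u) * 2) * \sum_(0 <= k < n) y' k `^ (v / u).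
    by rewrite mulr_sumr; apply: eq_bigr => k _; rewrite /e mulrA.
  rewrite ler_wpM2l ?mulr_ge0 ?powR_ge0//.
  case: n => [|n].
    by rewrite big_geq// addr_ge0 ?powR_ge0//; have := HK 0%N; rewrite big_geq.
  rewrite big_nat_recl//= lerD2l (le_trans _ (HK n.+1))// big_nat_recl//= lerDr powR_ge0//.
apply: (@le_lt_trans _ _ ((2 ^+ 1 * 4 `^ 1 * 1 * wt_bound (2 `^ 1))%R%:E *
  (9 * (c `^ (v / u) * 2) * (y' 0%N `^ (v / u) + K))%:E)%E).
  have w0 : 0 <= wt_bound (2 `^ 1) :> R.
    rewrite /wt_bound powRr1// divr_ge0//; lra.
  apply: lee_wpmul2l => //; rewrite lee_fin; apply: mulr_ge0 => //.
by rewrite -EFinM ltry.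
Qed.

End ConeEstimate.

(** * Sufficiency for u <= p *)

Section ShellSums.
Variable R : realType.

(** Each term satisfies [t ^ sig <= t a ^ (sig - 1)]. *)
Lemma powR_superadditive (sig a : R) (t : nat -> R) n : 1 <= sig -> 0 <= a ->
  (forall k, 0 <= t k <= a) -> \sum_(0 <= k < n) t k <= 2 * a ->
  \sum_(0 <= k < n) t k `^ sig <= 2 * a `^ sig.
Proof.
move=> s1 a0 ta S; have s0 : 0 < sig by rewrite (lt_le_trans ltr01).
apply: (@le_trans _ _ (\sum_(0 <= k < n) t k * a `^ (sig - 1))).
  apply: ler_sum => k _; have /andP[t0 t1] := ta k.
  by rewrite -mulr_powRB1// ler_wpM2l// ge0_ler_powR ?nnegrE ?subr_ge0.
by rewrite -mulr_suml -(mulr_powRB1 a0 s0) mulrA ler_wpM2r// powR_ge0.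
Qed.

(** This is [powR_split] for the ratio [t / a], multiplied by [a ^ sig]; the second term is linear
    in [t] and can be summed over the shells. *)
Lemma powR_split_le (sig lam t a : R) : 0 < sig -> sig < 1 -> 0 < lam -> 0 <= t -> t <= a ->
  t `^ sig <= lam `^ sig * a `^ sig + lam `^ (sig - 1) * (t * a `^ (sig - 1)).
Proof.
move=> s0 s1 lam0 t0 ta; have [a0|a0] := leP a 0.
  have -> : t = 0 by apply/le_anti; rewrite t0 andbT (le_trans ta).
  by rewrite powR0 ?gt_eqF// addr_ge0 ?mulr_ge0 ?powR_ge0.
have ta0 : 0 <= t / a by rewrite divr_ge0// ltW.
have := ler_wpM2r (powR_ge0 a sig) (powR_split s0 s1 lam0 ta0).
have -> : (t / a) `^ sig * a `^ sig = t `^ sig.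
  by rewrite -powRM ?(ltW a0)// divfK ?gt_eqF.
rewrite powRr1// mulrDl -!mulrA.
by rewrite -{2}(mulr_powRB1 (ltW a0) s0) mulKf ?gt_eqF.
Qed.

Lemma sum_expr_le (rho : R) n : 0 <= rho -> rho < 1 ->
  \sum_(0 <= k < n) rho ^+ k <= (1 - rho)^-1.
Proof.
move=> r0 r1; have h : 0 < 1 - rho by rewrite subr_gt0.
rewrite -div1r ler_pdivlMr// big_mkord mulrC -opprB mulNr -subrX1 opprB.
by rewrite gerBl exprn_ge0.
Qed.

Lemma powR_exprn (a e : R) k : 0 <= a -> (a `^ e) ^+ k = (a ^+ k) `^ e.
Proof. by move=> a0; rewrite -[LHS]powR_mulrn ?powR_ge0// powRAC powR_mulrn. Qed.

Lemma powR2_lt1 (x : R) : x < 0 -> 2 `^ x < 1.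
Proof.
move=> x0; rewrite -(opprK x) powRN invf_lt1 ?powR_gt0//.
by rewrite powR_gt1 ?oppr_gt0// ltr1n.
Qed.

Lemma poweR_le1D (x : \bar R) (s t : R) : 0 < s -> s <= t -> (0 <= x)%E ->
  (x `^ s <= 1 + x `^ t)%E.
Proof.
move=> s0 st; have t0 : 0 < t by rewrite (lt_le_trans s0).
case: x => [x| |]//.
  rewrite lee_fin !poweR_EFin -EFinD lee_fin => x0; have [x1|x1] := leP x 1.
    rewrite ler_wpDr ?powR_ge0//.
    by rewrite powR_le1 ?(ltW s0).
  by rewrite ler_wpDl// ler_powR// ltW.
by move=> _; rewrite !poweRyr ?gt_eqF// addey// leey.
Qed.

(** The supremum takes the exponent [w - th], the bound [b] the exponent [th]. *)
Lemma sum_powR_interpolate (N w th : R) (x b : nat -> R) n : 0 <= N -> 0 < th -> th <= w ->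
  (forall k, 0 <= x k <= N) -> (forall k, x k `^ th <= b k) ->
  \sum_(0 <= k < n) x k `^ w <= N `^ (w - th) * \sum_(0 <= k < n) b k.
Proof.
move=> N0 th0 thw xN xb; rewrite mulr_sumr; apply: ler_sum => k _.
have /andP[x0 x1] := xN k.
apply: (@le_trans _ _ (N `^ (w - th) * x k `^ th)); last by rewrite ler_wpM2l ?powR_ge0.
have [->|xn] := eqVneq (x k) 0.
  by rewrite powR0 ?mulr_ge0 ?powR_ge0// gt_eqF// (lt_le_trans th0).
have -> : x k `^ w = x k `^ (w - th) * x k `^ th.
  by rewrite -powRD ?subrK// (negbTE xn) implybT.
rewrite ler_wpM2r ?powR_ge0//.
by rewrite ge0_ler_powR ?nnegrE ?subr_ge0.
Qed.

(** For [sig = u / q] and [w = v / u] the two lower bounds say [v >= u] and [v >= q]. If [sig >= 1],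
    the integrals themselves are summable. If [sig < 1], they are bounded, as in Hölder's
    inequality, by the power [sig] of a summable sequence built from [X k], the integrals of
    [tau_k A ^ (sig - 1)]; so their powers [1 / sig <= w] are summable. *)
Lemma sum_shell_integrals d (T : measurableType d) (nu : {measure set T -> \bar R})
    (D : set T) (A : T -> \bar R) (tau : nat -> T -> \bar R) (sig w : R) :
  0 < sig -> 1 <= w -> 1 <= sig * w -> measurable D -> measurable_fun D A ->
  (forall k, measurable_fun D (tau k)) ->
  (forall k x, D x -> (0 <= tau k x <= A x)%E) ->
  (forall n x, D x -> (\sum_(0 <= k < n) tau k x <= 2%:E * A x)%E) ->
  (\int[nu]_(x in D) (A x `^ sig) < +oo)%E ->
  exists K : R, forall n,
    \sum_(0 <= k < n) fine (\int[nu]_(x in D) (tau k x `^ sig))%E `^ w <= K.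
Proof.
move=> s0 w1 sw mD mA mtau Htau Hsum.
have A0 x : D x -> (0 <= A x)%E.
  by move=> /(Htau 0%N)/andP[]; exact: le_trans.
have tau0 k x : D x -> (0 <= tau k x)%E by move=> /(Htau k)/andP[].
have P0 (g : T -> \bar R) : (0 <= \int[nu]_(x in D) (g x `^ sig))%E.
  by apply: integral_ge0 => x _; exact: poweR_ge0.
have mP g : measurable_fun D g -> measurable_fun D (fun x => g x `^ sig)%E.
  by move=> mg; apply: (measurableT_comp (measurable_poweR sig) mg).
have := P0 A; case NE : (\int[nu]_(x in D) (A x `^ sig))%E => [N| |]//.
rewrite lee_fin => N0 _.
pose I k := (\int[nu]_(x in D) (tau k x `^ sig))%E.
have IN k : (I k <= N%:E)%E.
  rewrite -NE; apply: ge0_le_integral_sub => x Dx; rewrite ?poweR_ge0//; split => //.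
  have /andP[h1 h2] := Htau k x Dx.
  by rewrite gt0_ler_poweR ?(ltW s0)// in_itv/= ?h1 ?A0// leey.
have Ifin k : I k \is a fin_num by rewrite ge0_fin_numE ?P0// (le_lt_trans (IN k)) ?ltry.
have IB k : 0 <= fine (I k) <= N by rewrite fine_ge0 ?P0//= -lee_fin fineK.
have [s1|s1] := leP 1 sig.
  have SI n : \sum_(0 <= k < n) fine (I k) <= 2 * N.
    rewrite -lee_fin -sumEFin (eq_bigr I); last by move=> k _; rewrite fineK.
    rewrite /I -(ge0_integral_sum nu mD (fun k => mP _ (mtau k))); last by move=> k x _; exact: poweR_ge0.
    rewrite EFinM -NE -(ge0_integralZl nu mD (mP _ mA) (fun x _ => poweR_ge0 _ _))//.
    apply: ge0_le_integral_sub => x Dx; last 2 first.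
    - by apply: sume_ge0 => k _; exact: poweR_ge0.
    - by rewrite mule_ge0// poweR_ge0.
    split => //.
    case: (A x) (A0 _ Dx) (fun k => Htau k x Dx) (Hsum n x Dx) => [a| |]//; last first.
      by move=> _ _ _; rewrite poweRyr ?gt_eqF// gt0_muley ?leey// lte_fin.
    rewrite lee_fin => a0 h1 h2.
    have tE k : tau k x = (fine (tau k x))%:E.
      have /andP[h3 h4] := h1 k; rewrite fineK// ge0_fin_numE//.
      by rewrite (le_lt_trans h4) ?ltry.
    rewrite poweR_EFin -EFinM (eq_bigr (fun k => (fine (tau k x) `^ sig)%:E)); last first.
      by move=> k _; rewrite tE poweR_EFin.
    rewrite sumEFin lee_fin; apply: powR_superadditive => // [k|].
      by have := h1 k; rewrite tE !lee_fin.
    by move: h2; rewrite (eq_bigr _ (fun k _ => tE k)) sumEFin -EFinM lee_fin.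
  exists (N `^ (w - 1) * (2 * N)) => n.
  apply: le_trans (sum_powR_interpolate (b := fun k => fine (I k)) n N0 ltr01 w1 IB _) _.
    by move=> k; rewrite powRr1//; have /andP[] := IB k.
  by rewrite ler_wpM2l ?powR_ge0.
(* Where [A x = +oo], [fine] makes [g] vanish; the bounds below hold there because [A x ^ sig] is
   infinite. *)
pose g k x : R := fine (tau k x) * fine (A x) `^ (sig - 1).
have g0 k x : D x -> 0 <= g k x.
  by move=> Dx; rewrite mulr_ge0 ?powR_ge0// fine_ge0// tau0.
have mg k : measurable_fun D (fun x => (g k x)%:E).
  apply/measurable_EFinP; apply: measurable_funM.
    exact: (measurableT_comp (fine_measurable measurableT) (mtau k)).
  apply: (measurableT_comp (measurable_powR _)).
  exact: (measurableT_comp (fine_measurable measurableT) mA).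
pose X k := (\int[nu]_(x in D) (g k x)%:E)%E.
have X0 k : (0 <= X k)%E by apply: integral_ge0 => x Dx; rewrite lee_fin g0.
have XN n : (\sum_(0 <= k < n) X k <= (2 * N)%:E)%E.
  rewrite /X -(ge0_integral_sum nu mD mg); last by move=> k x Dx; rewrite lee_fin g0.
  rewrite EFinM -NE -(ge0_integralZl nu mD (mP _ mA) (fun x _ => poweR_ge0 _ _))//.
  apply: ge0_le_integral_sub => x Dx; last 2 first.
  - by apply: sume_ge0 => k _; rewrite lee_fin g0.
  - by rewrite mule_ge0// poweR_ge0.
  split => //; rewrite /g.
  case: (A x) (A0 _ Dx) (fun k => Htau k x Dx) (Hsum n x Dx) => [a| |]//; last first.
    by move=> _ _ _; rewrite poweRyr ?gt_eqF// gt0_muley ?leey// lte_fin.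
  rewrite lee_fin => a0 h1 h2.
  have tE k : tau k x = (fine (tau k x))%:E.
    have /andP[h3 h4] := h1 k; rewrite fineK// ge0_fin_numE//.
    by rewrite (le_lt_trans h4) ?ltry.
  rewrite poweR_EFin sumEFin -EFinM lee_fin -mulr_suml -(mulr_powRB1 a0 s0) mulrA.
  rewrite ler_wpM2r ?powR_ge0//=.
  by move: h2; rewrite (eq_bigr _ (fun k _ => tE k)) sumEFin -EFinM lee_fin.
have Xfin k : X k \is a fin_num.
  rewrite ge0_fin_numE// (@le_lt_trans _ _ (2 * N)%:E) ?ltry//.
  by rewrite (le_trans _ (XN k.+1))// big_nat_recr//= leeDr// sume_ge0.
(* Essentially the optimal splitting level for the index [k]; the term [2 ^ -k] keeps it positive
   without spoiling summability. *)
pose lam k : R := (fine (X k) + (2^-1) ^+ k) / (N + 1).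
have lam0 k : 0 < lam k.
  by rewrite divr_gt0 ?ltr_wpDl ?fine_ge0 ?exprn_gt0 ?invr_gt0//; lra.
have N1 : 0 < N + 1 by lra.
have Ilam k : fine (I k) <= 2 * (N + 1) * lam k `^ sig.
  have h : (I k <= (lam k `^ sig)%:E * N%:E + (lam k `^ (sig - 1))%:E * X k)%E.
    rewrite -NE /X -(ge0_integralZl nu mD (mP _ mA) (fun x _ => poweR_ge0 _ _)) ?lee_fin ?powR_ge0//.
    rewrite -(ge0_integralZl nu mD (mg k)) ?lee_fin ?powR_ge0//; last by move=> x Dx; rewrite lee_fin g0.
    rewrite -ge0_integralD//; last 4 first.
    - by move=> x Dx; rewrite mule_ge0 ?lee_fin ?powR_ge0 ?poweR_ge0.
    - by apply: measurable_funeM; exact: mP.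
    - by move=> x Dx; rewrite mule_ge0 ?lee_fin ?powR_ge0 ?g0.
    - by apply: measurable_funeM; exact: mg.
    apply: ge0_le_integral_sub => x Dx; last 2 first.
    - exact: poweR_ge0.
    - by rewrite adde_ge0// mule_ge0 ?lee_fin ?powR_ge0 ?g0 ?poweR_ge0.
    split => //; rewrite /g.
    case: (A x) (A0 _ Dx) (Htau k x Dx) => [a| |]//; last first.
      by move=> _ _; rewrite poweRyr ?gt_eqF// gt0_muley ?lte_fin ?powR_gt0// addye ?leey.
    rewrite lee_fin => a0 /andP[h1 h2].
    have tE : tau k x = (fine (tau k x))%:E.
      by rewrite fineK// ge0_fin_numE// (le_lt_trans h2) ?ltry.
    rewrite tE !poweR_EFin -!EFinM -EFinD lee_fin /=; rewrite tE !lee_fin in h1 h2.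
    exact: powR_split_le.
  have {}h : fine (I k) <= lam k `^ sig * N + lam k `^ (sig - 1) * fine (X k).
    by rewrite -lee_fin EFinD !EFinM !fineK.
  apply: (le_trans h).
  have -> : 2 * (N + 1) * lam k `^ sig = lam k `^ sig * (N + 1) + lam k `^ (sig - 1) * (lam k * (N + 1)).
    by rewrite mulrA [lam k `^ (sig - 1) * _]mulrC mulr_powRB1 ?(ltW (lam0 k))//; ring.
  rewrite lerD// ler_wpM2l ?powR_ge0//; first lra.
  rewrite /lam divfK ?gt_eqF// lerDl exprn_ge0// invr_ge0//.
have th0 : 0 < sig^-1 by rewrite invr_gt0.
have thw : sig^-1 <= w by rewrite -[leLHS]mulr1 ler_pdivrMl.
exists (N `^ (w - sig^-1) * ((2 * (N + 1)) `^ sig^-1 * 2 * 2)) => n.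
apply: le_trans (sum_powR_interpolate (b := fun k => (2 * (N + 1)) `^ sig^-1 * lam k) n N0 th0 thw IB _) _.
  move=> k; have /andP[i0 _] := IB k.
  have -> : lam k = (lam k `^ sig) `^ sig^-1.
    by rewrite -powRrM mulfV ?gt_eqF// powRr1 ?(ltW (lam0 k)).
  rewrite -powRM ?powR_ge0 ?mulr_ge0 ?(ltW N1)//.
  by rewrite ge0_ler_powR ?nnegrE ?(ltW th0)// mulr_ge0 ?powR_ge0// mulr_ge0 ?(ltW N1).
rewrite ler_wpM2l ?powR_ge0// -mulr_sumr -mulrA ler_wpM2l ?powR_ge0//.
rewrite /lam -mulr_suml ler_pdivrMr// big_split/=.
have S1 : \sum_(0 <= k < n) fine (X k) <= 2 * N.
  rewrite -lee_fin -sumEFin (eq_bigr X) ?XN//.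
  by move=> k _; rewrite fineK.
have := @sum_expr_le 2^-1 n; have -> : (1 - 2^-1)^-1 = 2 :> R by field.
move=> /(_ (ltac:(lra)) (ltac:(lra))) S2; lra.
Qed.

End ShellSums.

(** * The embedding for [u <= p] *)

Section EmbeddingDiagonal.
Variable R : realType.
Local Notation C := R[i].
Notation mu := (@lebesgue_measure R).

Lemma AT_normpE (p q alpha : R) (f : C -> C) : AT_normp p q alpha f =
  (\int[mu]_(t in `[0%R, (2 * pi)%R]) (cone_area f q alpha t `^ (p / q)))%E.
Proof. by []. Qed.

Lemma sum_powR_scale (c s : R) (x : nat -> R) n : 0 <= c -> (forall k, 0 <= x k) ->
  \sum_(0 <= k < n) (c * x k) `^ s = c `^ s * \sum_(0 <= k < n) x k `^ s.
Proof. by move=> c0 x0; rewrite mulr_sumr; apply: eq_bigr => k _; rewrite powRM. Qed.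

(** The local estimate at [xi = xi'] bounds the circle integral at height [2 ^ -k] by a multiple of
    [I k], the integral of [tau_k ^ (u / q)]. In the critical case [sum_shell_integrals] applies;
    otherwise [rho < 1], and boundedness of [I k] suffices. *)
Lemma embedding_le (p q u v alpha beta : R) (f : C -> C) :
  0 < q -> 0 < u -> 0 < v -> 0 < beta -> u <= p ->
  Num.max u q <= v /\ (alpha + 2) / q = beta \/ (alpha + 2) / q < beta ->
  AT p q alpha f -> mixed_norm_space u v beta f.
Proof.
move=> q0 u0 v0 b0 up cond [fa fAT]; split => //.
have p0 : 0 < p by rewrite (lt_le_trans u0).
have s0 : 0 < u / q by rewrite divr_gt0.
pose D : set (measurableTypeR R) := `[0%R, (2 * pi)%R]%classic.
have mD : measurable D by exact: measurable_itv.
have mA : measurable_fun D (cone_area f q alpha).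
  by apply: measurable_funTS; exact: measurable_cone_area.
have mtau k : measurable_fun D (cone_shell f q alpha k).
  by apply: measurable_funTS; exact: measurable_cone_shell.
have mP (g : R -> \bar R) s : measurable_fun D g -> measurable_fun D (fun x => g x `^ s)%E.
  by move=> mg; apply: (measurableT_comp (measurable_poweR s) mg).
have Afin : (\int[mu]_(t in D) (cone_area f q alpha t `^ (u / q)) < +oo)%E.
  (* The circle has finite measure, so the exponent [p / q] can be lowered to [u / q]. *)
  apply: (@le_lt_trans _ _ (\int[mu]_(t in D) (1 + cone_area f q alpha t `^ (p / q)))%E).
    apply: ge0_le_integral_sub => t Dt; rewrite ?adde_ge0 ?poweR_ge0//; split => //.
    by apply: poweR_le1D; rewrite ?ler_wpM2r ?invr_ge0 ?(ltW q0) ?cone_area_ge0.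
  rewrite (ge0_integralD mu mD)//; last 2 first.
  - by move=> t _; exact: poweR_ge0.
  - exact: mP.
  rewrite lte_add_pinfty//.
  by rewrite integral_cst//= mul1e lebesgue_measure_itv/=; case: ifP => _; rewrite ?ltry.
have Htau k t : D t -> (0 <= cone_shell f q alpha k t <= cone_area f q alpha t)%E.
  by move=> _; rewrite cone_shell_ge0 cone_shell_le_area.
have [I IE] : exists I : nat -> \bar R, forall k,
    I k = (\int[mu]_(t in D) (cone_shell f q alpha k t `^ (u / q)))%E by eexists.
have I0 k : (0 <= I k)%E by rewrite IE; apply: integral_ge0 => x _; exact: poweR_ge0.
have [N NE] : exists N : R, (\int[mu]_(t in D) (cone_area f q alpha t `^ (u / q)))%E = N%:E.
  exists (fine (\int[mu]_(t in D) (cone_area f q alpha t `^ (u / q)))%E).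
  by rewrite fineK// ge0_fin_numE// integral_ge0// => t _; exact: poweR_ge0.
have IN k : (I k <= N%:E)%E.
  rewrite -NE IE; apply: ge0_le_integral_sub => x Dx; rewrite ?poweR_ge0//; split => //.
  have /andP[h1 h2] := Htau k x Dx.
  by rewrite gt0_ler_poweR ?(ltW s0)// in_itv/= ?h1 ?cone_area_ge0// leey.
have Ifin k : I k \is a fin_num by rewrite ge0_fin_numE// (le_lt_trans (IN k)) ?ltry.
have IB k : 0 <= fine (I k) <= N by rewrite fine_ge0//= -lee_fin fineK.
have N0 : 0 <= N by have /andP[h1 h2] := IB 0%N; rewrite (le_trans h1).
have [K K0 HK] := cone_estimate alpha q0.
(* [rho] measures the distance from the critical exponent: it is 1 exactly if
   [(alpha + 2) / q = beta]. *)
pose rho : R := 2 `^ (((alpha + 2) / q - beta) * u).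
pose y k := K `^ (u / q) * (rho ^+ k * fine (I k)).
have rho0 : 0 <= rho by exact: powR_ge0.
have z0 k : 0 <= rho ^+ k * fine (I k).
  by rewrite mulr_ge0 ?exprn_ge0//; have /andP[] := IB k.
have y0 k : 0 <= y k by rewrite mulr_ge0 ?powR_ge0.
have Hy k (r : R) : (0 < k)%N -> (2^-1) ^+ k.+1 < 1 - r -> 1 - r <= (2^-1) ^+ k ->
    (circle_integral (fun xi => (cabs (f (r%:C%C * xi)) `^ u)%:E) <=
      ((2 ^+ k) `^ (beta * u) * y k)%:E)%E.
  move=> k0 h1 h2.
  have r2 : 2^-1 <= r.
    have : (2^-1) ^+ k <= 2^-1 ^+ 1 :> R by rewrite ler_wiXn2l// ?invr_ge0//; lra.
    by rewrite expr1; lra.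
  have T0 : 0 < 2 ^+ k :> R by rewrite exprn_gt0.
  pose c := (K * (2 ^+ k) `^ (alpha + 2)) `^ (u / q).
  have cE : (2 ^+ k) `^ (beta * u) * y k = c * fine (I k).
    rewrite /c /y powRM ?powR_ge0 ?(ltW K0)// mulrCA -!mulrA; congr (_ * _); rewrite mulrA; congr (_ * _).
    have -> : rho ^+ k = (2 ^+ k) `^ (((alpha + 2) / q - beta) * u).
      by rewrite powR_exprn.
    rewrite -powRD; last by rewrite (gt_eqF T0) implybT.
    rewrite -powRrM; congr (_ `^ _); field; lra.
  have c0 : 0 <= c by exact: powR_ge0.
  rewrite cE EFinM fineK// IE -(ge0_integralZl mu mD (mP _ _ (mtau k)) (fun x _ => poweR_ge0 _ _))//.
  apply: ge0_le_integral_sub => t Dt; last 2 first.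
  - by rewrite lee_fin powR_ge0.
  - by rewrite mule_ge0// poweR_ge0.
  split => //.
  have tt : `|t - t| <= (1 - r) / 16.
    by rewrite subrr normr0 divr_ge0// (le_trans _ (ltW h1))// exprn_ge0.
  have := HK f k r t t fa r2 h1 h2 tt.
  move=> /(gt0_ler_poweR (ltW s0)); rewrite poweRM ?cone_shell_ge0//; last first.
    by rewrite lee_fin mulr_ge0 ?powR_ge0 ?(ltW K0).
  rewrite !poweR_EFin -powRrM (_ : q * (u / q) = u); last by field; lra.
  apply; rewrite in_itv/= leey andbT; first by rewrite lee_fin powR_ge0.
  by rewrite mule_ge0 ?cone_shell_ge0// lee_fin mulr_ge0 ?powR_ge0 ?(ltW K0).
have vu0 : 0 < v / u by rewrite divr_gt0.
suff [M HM] : exists M : R, forall n, \sum_(0 <= k < n) (rho ^+ k * fine (I k)) `^ (v / u) <= M.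
  apply: (mixed_norm_finite u0 v0 b0 fa y0 Hy (K := (K `^ (u / q)) `^ (v / u) * M)) => n.
  by rewrite sum_powR_scale ?powR_ge0// ler_wpM2l ?powR_ge0.
case: cond => [[]|sb].
  rewrite ge_max => /andP[uv qv] sb.
  have [M HM] := sum_shell_integrals (nu := mu) (D := D) (A := cone_area f q alpha)
    (tau := cone_shell f q alpha) (sig := u / q) (w := v / u) s0
    (ltac:(by rewrite ler_pdivlMr ?mul1r))
    (ltac:(by rewrite mulrC mulrA divfK ?gt_eqF// ler_pdivlMr ?mul1r)) mD mA mtau Htau
    (fun n t _ => sum_cone_shell q alpha n t fa) Afin.
  exists M => n; rewrite (le_trans _ (HM n))// le_eqVlt; apply/orP; left; apply/eqP.
  by apply: eq_bigr => k _; rewrite /rho -IE sb subrr mul0r powRr0 expr1n mul1r.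
have rho1 : rho `^ (v / u) < 1.
  by rewrite /rho -powRrM powR2_lt1// pmulr_llt0// pmulr_llt0// subr_lt0.
exists ((1 - rho `^ (v / u))^-1 * N `^ (v / u)) => n.
apply: (@le_trans _ _ (\sum_(0 <= k < n) (rho `^ (v / u)) ^+ k * N `^ (v / u))).
  apply: ler_sum => k _; have /andP[i0 i1] := IB k.
  rewrite powRM ?exprn_ge0// -powR_mulrn// powRAC powR_mulrn ?powR_ge0//.
  by rewrite ler_wpM2l ?exprn_ge0 ?powR_ge0// ge0_ler_powR ?nnegrE// ltW.
by rewrite -mulr_suml ler_wpM2r ?powR_ge0// sum_expr_le// powR_ge0.
Qed.

End EmbeddingDiagonal.

(** * Sufficiency for p < u *)

Section LevelSums.
Variable R : realType.

(** A geometric sum over any set of indices is dominated by its largest term. The induction carries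
    a second bound, which settles the step where [n] itself belongs to [P]. *)
Lemma sum_expr_above (rho X : R) (P : pred nat) n : 1 < rho -> 0 <= X ->
  (forall j, P j -> rho ^+ j <= X) ->
  \sum_(0 <= j < n | P j) rho ^+ j <= rho / (rho - 1) * X.
Proof.
move=> r1 X0 HX; have r0 : 0 < rho - 1 by lra.
suff : \sum_(0 <= j < n | P j) rho ^+ j <= rho / (rho - 1) * X /\
       \sum_(0 <= j < n | P j) rho ^+ j <= rho ^+ n / (rho - 1) by case.
elim: n => [|n [IH1 IH2]].
  by rewrite big_geq// expr0 !mulr_ge0 ?invr_ge0 ?(ltW r0)//; lra.
have E : rho ^+ n.+1 / (rho - 1) = rho ^+ n / (rho - 1) + rho ^+ n.
  by rewrite exprS; field; lra.
rewrite big_mkcond big_nat_recr//= -big_mkcond; case: ifPn => [Pn|_].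
  have S : \sum_(0 <= j < n | P j) rho ^+ j + rho ^+ n <= rho ^+ n.+1 / (rho - 1).
    by rewrite E lerD2r.
  split => //; apply: (le_trans S); rewrite exprSr -mulrA mulrC ler_wpM2l ?HX//.
  by rewrite divr_ge0 ?(ltW r0)//; lra.
by rewrite addr0; split => //; rewrite (le_trans IH2)// E lerDl exprn_ge0//; lra.
Qed.

(** Here the first term dominates. The induction shifts the indices by one and divides [X] by [rho];
    when 0 belongs to [P], [X >= 1] and the full geometric series will do. *)
Lemma sum_expr_below (rho X : R) (P : pred nat) n : 0 <= rho -> rho < 1 -> 0 <= X ->
  (forall j, P j -> rho ^+ j <= X) ->
  \sum_(0 <= j < n | P j) rho ^+ j <= X / (1 - rho).
Proof.
move=> r0 r1 X0; elim: n P X X0 => [|n IH] P X X0 HX.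
  by rewrite big_geq// divr_ge0// subr_ge0 ltW.
have d0 : 0 < 1 - rho by lra.
rewrite big_mkcond big_nat_recl//= -big_mkcond /=.
have step : \sum_(0 <= i < n | P i.+1) rho ^+ i.+1 = rho * \sum_(0 <= i < n | P i.+1) rho ^+ i.
  by rewrite mulr_sumr; apply: eq_bigr => i _; rewrite exprS.
case: ifPn => [/HX|_].
  rewrite expr0 => X1.
  have S : \sum_(0 <= i < n | P i.+1) rho ^+ i <= (1 - rho)^-1.
    apply: le_trans (sum_expr_le n r0 r1).
    by rewrite big_mkcond ler_sum// => i _; case: ifP => // _; rewrite exprn_ge0.
  rewrite step; apply: (@le_trans _ _ (1 + rho * (1 - rho)^-1)); first by rewrite lerD2l ler_wpM2l.
  have -> : 1 + rho / (1 - rho) = 1 / (1 - rho) by field; lra.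
  by rewrite ler_wpM2r// invr_ge0 ltW.
rewrite add0r step; have [->|rn] := eqVneq rho 0.
  by rewrite mul0r divr_ge0// subr0.
have rp : 0 < rho by rewrite lt_def rn.
have := IH (fun i => P i.+1) (X / rho) (divr_ge0 X0 r0).
have H j : P j.+1 -> rho ^+ j <= X / rho by move=> /HX; rewrite exprSr ler_pdivlMr.
move=> /(_ H) /(ler_wpM2l r0) /le_trans; apply.
by rewrite !mulrA [rho * X]mulrC mulfK.
Qed.

(** A bound for the integral of [|f|^u] at height [2 ^ -k], in the units of the local estimate, with
    [m j] for [|E_j|]. Only levels with [|E_j| >= 2 ^ -k / 32] occur at that height; [c0], later
    [2 * pi], accounts for the points below the lowest level. *)
Definition level_sum (u c0 : R) (m : nat -> R) (J : nat) (k : nat) : R :=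
  c0 + \sum_(0 <= j < J | (2^-1) ^+ k <= 32 * m j) (2 ^+ j.+1) `^ u * m j.

Lemma level_sum_ge0 u c0 m J k : 0 <= c0 -> (forall j, 0 <= m j) -> 0 <= level_sum u c0 m J k.
Proof.
by move=> c00 m0; rewrite addr_ge0// sumr_ge0// => j _; rewrite mulr_ge0 ?powR_ge0.
Qed.

Section LevelBounds.
Variables (p u c0 M : R) (m : nat -> R).
Hypotheses (p0 : 0 < p) (pu : p < u) (c00 : 0 <= c0) (m0 : forall j, 0 <= m j).
Hypothesis HM : forall n, \sum_(0 <= j < n) (2 ^+ j) `^ p * m j <= M.

Let u0 : 0 < u. Proof. exact: lt_trans pu. Qed.

Lemma level_term_le j : (2 ^+ j) `^ p * m j <= M.
Proof.
apply: le_trans (HM j.+1); rewrite big_nat_recr//= lerDr sumr_ge0// => i _.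
by rewrite mulr_ge0 ?powR_ge0.
Qed.

(** From [2 ^ -k <= 32 * m j] and [2 ^ (j p) m j <= M] follows [2 ^ (j p) <= 32 M 2 ^ k], which
    bounds the surplus [2 ^ (j (u - p))] by a power of [2 ^ k]. *)
Lemma level_sum_le J k : level_sum u c0 m J k <=
  (c0 + 2 `^ u * (M `^ (u / p - 1) * 32 `^ (u / p - 1)) * M) * (2 ^+ k) `^ (u / p - 1).
Proof.
have e0 : 0 < u / p - 1 by rewrite subr_gt0 ltr_pdivlMr ?mul1r.
have M0 : 0 <= M by apply: le_trans (HM 0); rewrite big_geq.
have T1 : 1 <= 2 ^+ k :> R by rewrite exprn_ege1// ler1n.
have T0 : 0 < 2 ^+ k :> R by rewrite exprn_gt0.
have TT : (2^-1) ^+ k = (2 ^+ k)^-1 :> R by rewrite exprVn.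
have P1 : 1 <= (2 ^+ k) `^ (u / p - 1) by have := ler_powR T1 (ltW e0); rewrite powRr0.
rewrite mulrDl lerD//; first by rewrite ler_peMr.
have term j : (2^-1) ^+ k <= 32 * m j -> (2 ^+ j.+1) `^ u * m j <=
    2 `^ u * (M `^ (u / p - 1) * 32 `^ (u / p - 1)) * (2 ^+ k) `^ (u / p - 1) * ((2 ^+ j) `^ p * m j).
  move=> hj; have Q0 : 0 < 2 ^+ j :> R by rewrite exprn_gt0.
  have h1 : (2 ^+ j) `^ p <= M * 32 * 2 ^+ k.
    have : (2 ^+ k)^-1 * (2 ^+ j) `^ p <= 32 * m j * (2 ^+ j) `^ p.
      by rewrite ler_wpM2r ?powR_ge0// -TT.
    rewrite ler_pdivrMl// => /le_trans; apply.
    rewrite [leRHS]mulrC ler_wpM2l ?(ltW T0)//.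
    by rewrite -mulrA [m j * _]mulrC [leRHS]mulrC ler_wpM2l// level_term_le.
  rewrite exprS powRM ?(ltW Q0)// -!mulrA ler_wpM2l ?powR_ge0// !mulrA ler_wpM2r//.
  rewrite -powRM ?ler0n// -powRM ?mulr_ge0 ?(ltW T0)//.
  have -> : (2 ^+ j) `^ u = ((2 ^+ j) `^ p) `^ (u / p - 1) * (2 ^+ j) `^ p.
    rewrite -powRrM -powRD ?(gt_eqF Q0) ?implybT//; congr (_ `^ _).
    by field; rewrite gt_eqF.
  rewrite ler_wpM2r ?powR_ge0// ge0_ler_powR ?nnegrE ?(ltW e0) ?powR_ge0//.
  by rewrite !mulr_ge0 ?(ltW T0).
apply: le_trans (ler_sum _ (fun j => @term j)) _.
rewrite -mulr_sumr [leRHS]mulrAC ler_wpM2l//; first by rewrite !mulr_ge0 ?powR_ge0.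
apply: le_trans (HM J); rewrite big_mkcond ler_sum// => j _; case: ifP => // _.
by rewrite mulr_ge0 ?powR_ge0.
Qed.

(** The power [p / u < 1] is subadditive and passes to the single levels. After exchanging the sums,
    the heights at which the level [j] is visible form a geometric sum of size [m j ^ (1 - p / u)],
    which completes [m j ^ (p / u)] to [m j]. *)
Lemma sum_level_sum (J : nat -> nat) : exists C : R, forall n,
  \sum_(0 <= k < n) (((2^-1) ^+ k) `^ (1 - p / u) * level_sum u c0 m (J k) k `^ (p / u)) <= C.
Proof.
have th0 : 0 < 1 - p / u by rewrite subr_gt0 ltr_pdivrMr// mul1r.
have pu0 : 0 < p / u by rewrite divr_gt0.
have pu1 : p / u <= 1 by lra.
set th := 1 - p / u in th0 *.
pose r : R := (2^-1) `^ th.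
have r0 : 0 <= r by exact: powR_ge0.
have r1 : r < 1.
  by rewrite powR_lt1//; lra.
have d0 : 0 < (1 - r)^-1 by rewrite invr_gt0 subr_gt0.
have rE k : ((2^-1) ^+ k) `^ th = r ^+ k by rewrite -powR_exprn.
exists (c0 `^ (p / u) * (1 - r)^-1 + 2 `^ p * 32 `^ th * (1 - r)^-1 * M) => n.
(* A common cutoff, so that the sums over [j] and [k] can be exchanged. *)
pose Jm := (\max_(k < n) J k)%N.
have JJ k : (k < n)%N -> (J k <= Jm)%N.
  by move=> kn; exact: (leq_bigmax (Ordinal kn)).
pose G j := (2 ^+ j.+1) `^ p * m j `^ (p / u).
have G0 j : 0 <= G j by rewrite mulr_ge0 ?powR_ge0.
apply: (@le_trans _ _ (\sum_(0 <= k < n) (r ^+ k * c0 `^ (p / u) +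
    r ^+ k * \sum_(0 <= j < Jm | (2^-1) ^+ k <= 32 * m j) G j))).
  rewrite !big_nat; apply: ler_sum => k /andP[_ kn].
  rewrite rE -mulrDr ler_wpM2l ?exprn_ge0//.
  have S0 : 0 <= \sum_(0 <= j < J k | (2^-1) ^+ k <= 32 * m j) (2 ^+ j.+1) `^ u * m j.
    by rewrite sumr_ge0// => j _; rewrite mulr_ge0 ?powR_ge0.
  rewrite (le_trans (powRD_le c00 S0 pu0 pu1))// lerD2l.
  apply: le_trans (powR_sum_le _ _ pu0 pu1 _) _.
    by move=> j; rewrite mulr_ge0 ?powR_ge0.
  rewrite (@big_cat_nat _ _ _ (J k) 0%N Jm)//= ?JJ// -[leLHS]addr0 lerD//; last first.
    by rewrite sumr_ge0.
  apply: ler_sum => j _; rewrite powRM ?powR_ge0// -powRrM.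
  by rewrite mulrC [u * _]mulrC divfK ?gt_eqF// mulrC.
rewrite big_split/= lerD//.
  by rewrite -mulr_suml mulrC ler_wpM2l ?powR_ge0// sum_expr_le.
rewrite (eq_bigr (fun k => \sum_(0 <= j < Jm) (if (2^-1) ^+ k <= 32 * m j then r ^+ k * G j else 0))); last first.
  by move=> k _; rewrite mulr_sumr big_mkcond.
rewrite exchange_big/=.
apply: (@le_trans _ _ (\sum_(0 <= j < Jm) 2 `^ p * 32 `^ th * (1 - r)^-1 * ((2 ^+ j) `^ p * m j))); last first.
  by rewrite -mulr_sumr ler_wpM2l// !mulr_ge0 ?powR_ge0 ?(ltW d0).
apply: ler_sum => j _; rewrite -big_mkcond/= -mulr_suml.
have X0 : 0 <= (32 * m j) `^ th by exact: powR_ge0.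
have H k : (2^-1) ^+ k <= 32 * m j -> r ^+ k <= (32 * m j) `^ th.
  by move=> h; rewrite -rE ge0_ler_powR ?nnegrE ?(ltW th0) ?exprn_ge0 ?invr_ge0 ?mulr_ge0.
have := sum_expr_below n r0 r1 X0 H => /(ler_wpM2r (G0 j)) /le_trans; apply.
rewrite /G exprS !powRM ?exprn_ge0// le_eqVlt; apply/orP; left; apply/eqP.
have [mj|mj] := eqVneq (m j) 0.
  by rewrite mj (powR0 (lt0r_neq0 th0)) !mulr0 !mul0r.
have E : m j `^ th * m j `^ (p / u) = m j.
  by rewrite -powRD ?(negbTE mj) ?implybT// /th subrK powRr1.
rewrite -[in RHS]E.
by move: (m j `^ th) (m j `^ (p / u)) => x y; ring.
Qed.

End LevelBounds.

Lemma measurable_level (D : set (measurableTypeR R)) (A : R -> \bar R) (c : \bar R) :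
  measurable D -> measurable_fun D A -> measurable (D `&` [set t | (c < A t)%E]).
Proof. by move=> mD mA; exact: emeasurable_fun_o_infty. Qed.

(** Layer-cake estimate: at each point the sum of [2 ^ (j p)] over the levels below [A ^ (1 / q)] is
    geometric, hence comparable to its largest term. *)
Lemma level_measures (nu : {measure set (measurableTypeR R) -> \bar R}) (D : set (measurableTypeR R))
    (A : R -> \bar R) (p q : R) : 0 < p -> 0 < q -> measurable D -> (nu D < +oo)%E ->
  measurable_fun D A -> (forall t, (0 <= A t)%E) ->
  (\int[nu]_(t in D) (A t `^ (p / q)) < +oo)%E ->
  exists m : nat -> R, exists M : R, [/\ forall j, 0 <= m j,
    forall j, nu (D `&` [set t | (((2 ^+ j) `^ q)%:E < A t)%E]) = (m j)%:E &
    forall n, \sum_(0 <= j < n) (2 ^+ j) `^ p * m j <= M].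
Proof.
move=> p0 q0 mD Dfin mA A0 Afin.
pose E j := D `&` [set t | (((2 ^+ j) `^ q)%:E < A t)%E].
have mE j : measurable (E j) by exact: measurable_level.
have Efin j : nu (E j) \is a fin_num.
  by rewrite ge0_fin_numE// (le_lt_trans _ Dfin)// le_measure ?inE//; exact: subIsetl.
have mP s : measurable_fun D (fun x => A x `^ s)%E.
  by apply: (measurableT_comp (measurable_poweR s) mA).
have [N NE] : exists N : R, (\int[nu]_(t in D) (A t `^ (p / q)))%E = N%:E.
  exists (fine (\int[nu]_(t in D) (A t `^ (p / q)))%E).
  by rewrite fineK// ge0_fin_numE// integral_ge0// => t _; exact: poweR_ge0.
pose rho : R := 2 `^ p.
have rho1 : 1 < rho.
  by rewrite powR_gt1// ltr1n.
have pq0 : 0 < p / q by rewrite divr_gt0.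
exists (fun j => fine (nu (E j))), (rho / (rho - 1) * N); split.
- by move=> j; rewrite fine_ge0.
- by move=> j; rewrite fineK.
move=> n.
pose h j t : R := (2 ^+ j) `^ p * \1_(E j) t.
have mh j : measurable_fun D (fun t => (h j t)%:E).
  apply/measurable_EFinP; exact: measurable_funM.
have h0 j t : D t -> (0 <= (h j t)%:E)%E by move=> _; rewrite lee_fin mulr_ge0 ?powR_ge0.
have intE j : (\int[nu]_(t in D) (h j t)%:E)%E = ((2 ^+ j) `^ p * fine (nu (E j)))%:E.
  have mi : measurable_fun D (fun t => (\1_(E j) t : R)%:E).
    by apply/measurable_EFinP; exact: measurable_indic.
  under eq_integral do rewrite EFinM.
  have i0 t : D t -> (0 <= (\1_(E j) t : R)%:E)%E by rewrite lee_fin.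
  rewrite (ge0_integralZl nu mD mi i0)//.
  rewrite integral_indic// EFinM fineK//; congr (_ * nu _)%E.
  by rewrite /E setIAC setIid.
rewrite -lee_fin -sumEFin -(eq_bigr _ (fun j _ => intE j)) -(ge0_integral_sum nu mD mh h0).
have c0 : 0 <= rho / (rho - 1) by rewrite divr_ge0 ?subr_ge0 ?(ltW rho1)//; lra.
rewrite EFinM -NE -(ge0_integralZl nu mD (mP _) (fun x _ => poweR_ge0 _ _))//.
apply: ge0_le_integral_sub => t Dt; last 2 first.
- by apply: sume_ge0 => j _; exact: h0.
- by rewrite mule_ge0 ?poweR_ge0.
split => //; have [At|Afint] := eqVneq (A t) +oo%E.
  rewrite At poweRyr ?gt_eqF// gt0_muley ?leey// lte_fin divr_gt0//; lra.
have [a aE] : exists a, A t = a%:E.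
  exists (fine (A t)); rewrite fineK// ge0_fin_numE// lt_neqAle Afint leey//.
have a0 : 0 <= a by rewrite -lee_fin -aE.
rewrite sumEFin aE poweR_EFin -EFinM lee_fin.
rewrite (eq_bigr (fun j => if (2 ^+ j) `^ q < a then rho ^+ j else 0)); last first.
  move=> j _; rewrite /h indicE /E in_setI mem_set//= powR_exprn//.
  have -> : (t \in [set t | (((2 ^+ j) `^ q)%:E < A t)%E]) = ((2 ^+ j) `^ q < a).
    by apply/idP/idP; rewrite inE /= aE lte_fin.
  by case: ifP => _; rewrite ?mulr1 ?mulr0.
rewrite -big_mkcond; apply: sum_expr_above => //; first exact: powR_ge0.
move=> j ja; rewrite powR_exprn//.
have -> : (2 ^+ j) `^ p = ((2 ^+ j) `^ q) `^ (p / q) by rewrite -powRrM mulrC divfK ?gt_eqF.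
by rewrite ge0_ler_powR ?nnegrE ?powR_ge0 ?(ltW pq0)// ltW.
Qed.

End LevelSums.

(** * The embedding for [p < u] *)

Section EmbeddingLt.
Variable R : realType.
Local Notation C := R[i].
Notation mu := (@lebesgue_measure R).

Lemma exists_pow2_powR_gt (X p : R) : 0 < p -> exists J, X < (2 ^+ J) `^ p.
Proof.
move=> p0; have [X0|X0] := leP X 0; first by exists 0%N; rewrite (le_lt_trans X0)// powR_gt0.
pose t := (1 + X `^ p^-1)^-1.
have Y0 : 0 <= X `^ p^-1 by exact: powR_ge0.
have t0 : 0 < t by rewrite invr_gt0; lra.
have t1 : t <= 1 by rewrite invf_le1; lra.
have [i /andP[h _]] := dyadic_exists t0 t1; exists i.+1.
have {}h : X `^ p^-1 < 2 ^+ i.+1.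
  rewrite exprVn ltf_pV2 ?posrE ?exprn_gt0// in h; last by lra.
  by apply: lt_trans h; lra.
have -> : X = (X `^ p^-1) `^ p by rewrite -powRrM mulVf ?gt_eqF// powRr1// ltW.
by rewrite gt0_ltr_powR ?nnegrE ?exprn_ge0.
Qed.

(** Where [|f|] exceeds [L 2 ^ j] at height [1 - r], the local estimate puts an arc of length
    [(1 - r) / 16] into [E_j], so that the level [j] is visible at that height. The cutoff [J]
    depends on [k] and makes the sum over levels finite. *)
Lemma circle_level_bound (p q u alpha M : R) (f : C -> C) (m : nat -> R) (K : R) k :
  0 < p -> 0 < q -> 0 < u -> 0 < K -> analytic_on_disk f ->
  (forall f k (r t t' : R), analytic_on_disk f -> 2^-1 <= r ->
    (2^-1) ^+ k.+1 < 1 - r -> 1 - r <= (2^-1) ^+ k -> `|t - t'| <= (1 - r) / 16 ->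
    ((cabs (f (r%:C%C * expi t)) `^ q)%:E <=
      (K * (2 ^+ k) `^ (alpha + 2))%:E * cone_shell f q alpha k t')%E) ->
  (forall j, 0 <= m j) ->
  (forall j, mu (`[0%R, 2 * pi]%classic `&`
     [set t | (((2 ^+ j) `^ q)%:E < cone_area f q alpha t)%E]) = (m j)%:E) ->
  (forall j, (2 ^+ j) `^ p * m j <= M) -> (0 < k)%N ->
  exists J : nat, forall r : R, (2^-1) ^+ k.+1 < 1 - r -> 1 - r <= (2^-1) ^+ k ->
    (circle_integral (fun xi => (cabs (f (r%:C%C * xi)) `^ u)%:E) <=
      ((K * (2 ^+ k) `^ (alpha + 2)) `^ (u / q) * level_sum u (2 * pi) m J k)%:E)%E.
Proof.
move=> p0 q0 u0 K0 fa HK m0 muE HM k0.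
pose D : set (measurableTypeR R) := `[0%R, (2 * pi)%R]%classic.
have mD : measurable D by exact: measurable_itv.
have mA : measurable_fun D (cone_area f q alpha).
  by apply: measurable_funTS; exact: measurable_cone_area.
pose E j := D `&` [set t | (((2 ^+ j) `^ q)%:E < cone_area f q alpha t)%E].
have mE j : measurable (E j) by exact: measurable_level.
have T0 : 0 < 2 ^+ k :> R by rewrite exprn_gt0.
have TT : (2^-1) ^+ k = (2 ^+ k)^-1 :> R by rewrite exprVn.
pose c := K * (2 ^+ k) `^ (alpha + 2).
have c0 : 0 < c by rewrite mulr_gt0 ?powR_gt0.
(* Normalized so that [L * 2 ^ j < |f|] forces [A > 2 ^ (j q)] nearby. *)
pose L := c `^ q^-1.
have L0 : 0 < L by rewrite powR_gt0.
have Lq : L `^ q = c by rewrite /L -powRrM mulVf ?gt_eqF// powRr1 ?(ltW c0).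
have M0 : 0 <= M by rewrite (le_trans _ (HM 0%N))// mulr_ge0 ?powR_ge0.
(* At the level [J] the bound [2 ^ (j p) m j <= M] makes [m j] too small to be visible at height
   [2 ^ -k]. *)
have [J HJ] := exists_pow2_powR_gt (32 * M * 2 ^+ k) p0.
exists J => r h1 h2.
have hk : (2^-1) ^+ k <= 2^-1 :> R.
  by rewrite -[leRHS]expr1 ler_wiXn2l// ?invr_ge0//; lra.
have r2 : 2^-1 <= r by clear -hk h2; lra.
set eta := 1 - r in h1 h2.
have eta1 : eta <= 2^-1 by rewrite /eta; clear -r2; lra.
have eta0 : 0 < eta by rewrite (le_lt_trans _ h1)// exprn_ge0 ?invr_ge0.
pose F t := cabs (f (r%:C%C * expi t)).
have F0 t : 0 <= F t by exact: cabs_ge0.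
have loc j t : D t -> L * 2 ^+ j < F t -> E j t /\ (2^-1) ^+ k <= 32 * m j.
  move=> Dt LF.
  have near t' : `|t - t'| <= eta / 16 -> (((2 ^+ j) `^ q)%:E < cone_area f q alpha t')%E.
    move=> tt; have := HK f k r t t' fa r2 h1 h2 tt.
    move=> /le_trans/(_ (lee_wpmul2l _ (cone_shell_le_area f q alpha k t'))).
    rewrite lee_fin (ltW c0) => /(_ isT) H.
    rewrite -(@lte_pmul2l _ c%:E)// ?lte_fin//.
    apply: lt_le_trans H; rewrite -EFinM lte_fin -Lq -powRM ?exprn_ge0 ?(ltW L0)//.
    by rewrite gt0_ltr_powR ?nnegrE ?F0// mulr_ge0 ?exprn_ge0 ?(ltW L0).
  have nt : `|t - t| <= eta / 16 by rewrite subrr normr0 divr_ge0 ?(ltW eta0).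
  split; first by split => //; exact: near.
  have pi2 : 2 <= pi :> R by exact: pi_ge2.
  move: Dt; rewrite /D /= in_itv/= => /andP[t1 t2].
  (* Angles are confined to [[0, 2 * pi]], so only the half of the arc that points towards [pi] is
     used. *)
  have [a [b [ab sub]]] : exists a b, b - a = eta / 16 /\ `[a, b]%classic `<=` E j.
    have [tp|tp] := leP t pi.
      exists t, (t + eta / 16); split; first by rewrite addrAC subrr add0r.
      move=> t' /=; rewrite in_itv/= => /andP[l1 l2]; split.
        by rewrite /D /= in_itv/=; apply/andP; split; clear -l1 l2 t1 tp pi2 eta1; lra.
      by apply: near; rewrite ler_norml; apply/andP; split; clear -l1 l2 eta0; lra.
    exists (t - eta / 16), t; split; first by rewrite opprB addrC subrK.
    move=> t' /=; rewrite in_itv/= => /andP[l1 l2]; split.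
      by rewrite /D /= in_itv/=; apply/andP; split; clear -l1 l2 t2 tp pi2 eta1; lra.
    by apply: near; rewrite ler_norml; apply/andP; split; clear -l1 l2 eta0; lra.
  have : (mu `[a, b]%classic <= mu (E j))%E.
    by apply: le_measure; rewrite ?inE//; exact: measurable_itv.
  rewrite muE lebesgue_measure_itv/= lte_fin.
  have -> : a < b by clear -ab eta0; lra.
  rewrite -EFinD lee_fin ab => h3.
  by move: h1; rewrite exprS => h1; clear -h1 h3; lra.
pose b j : R := if (2^-1) ^+ k <= 32 * m j then (2 ^+ j.+1) `^ u else 0.
have b0 j : 0 <= b j by rewrite /b; case: ifP => _; rewrite ?powR_ge0.
have FJ t : D t -> F t <= L * 2 ^+ J.
  move=> Dt; rewrite leNgt; apply/negP => /(loc _ _ Dt)[_].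
  rewrite TT => h3; have hm : 0 < 32 * m J by rewrite (lt_le_trans _ h3)// invr_gt0.
  have := HJ; rewrite -(ltr_pM2r hm); apply/negP; rewrite -leNgt.
  apply: (@le_trans _ _ (32 * M)).
    by rewrite mulrCA ler_wpM2l.
  rewrite -[leLHS]mulr1 -[leRHS]mulrA ler_wpM2l ?mulr_ge0//.
  by rewrite -ler_pdivrMl// mulr1.
have Fu t : D t -> F t `^ u <= L `^ u * (1 + \sum_(0 <= j < J) b j * \1_(E j) t).
  move=> Dt.
  have S0 : 0 <= \sum_(0 <= j < J) b j * \1_(E j) t by rewrite sumr_ge0// => j _; rewrite mulr_ge0.
  have ex : exists j, F t <= L * 2 ^+ j by exists J; exact: FJ.
  (* For the least [j] with [F t <= L * 2 ^ j], either [j = 0] or the level just below is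
     exceeded. *)
  have [[|j] hj mj] := ex_minnP ex.
    apply: (@le_trans _ _ (L `^ u)); last by rewrite ler_peMr ?powR_ge0// lerDl.
    by rewrite expr0 mulr1 in hj; rewrite ge0_ler_powR ?nnegrE ?F0 ?(ltW u0) ?(ltW L0).
  have Lj : L * 2 ^+ j < F t by rewrite ltNge; apply/negP => /mj; rewrite ltnn.
  have [Ej Pj] := loc j t Dt Lj.
  have jJ : (j < J)%N by exact: mj (FJ t Dt).
  apply: (@le_trans _ _ (L `^ u * (2 ^+ j.+1) `^ u)).
    rewrite -powRM ?exprn_ge0 ?(ltW L0)//.
    by rewrite ge0_ler_powR ?nnegrE ?F0 ?(ltW u0)// mulr_ge0 ?exprn_ge0 ?(ltW L0).
  rewrite ler_wpM2l ?powR_ge0// (le_trans _ (_ : b j * \1_(E j) t <= _))//.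
    by rewrite /b Pj indicE mem_set// mulr1.
  rewrite big_mkord (bigD1 (Ordinal jJ))//= addrCA lerDl addr_ge0// sumr_ge0// => i _.
  by rewrite mulr_ge0.
have mi j : measurable_fun D (fun t => (b j * \1_(E j) t)%:E).
  by apply/measurable_EFinP; apply: measurable_funM => //; exact: measurable_indic.
have i0 j t : D t -> (0 <= (b j * \1_(E j) t)%:E)%E by rewrite lee_fin mulr_ge0.
have muD : (\int[mu]_(t in D) 1 = (2 * pi)%:E)%E.
  rewrite integral_cst//= mul1e lebesgue_measure_itv/= lte_fin mulr_gt0 ?pi_gt0//.
  by rewrite -EFinD subr0.
apply: (@le_trans _ _ (\int[mu]_(t in D) ((L `^ u)%:E * (1 + \sum_(0 <= j < J) (b j * \1_(E j) t)%:E)))%E).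
  apply: ge0_le_integral_sub => t Dt; last 2 first.
  - by rewrite lee_fin powR_ge0.
  - by rewrite mule_ge0 ?lee_fin ?powR_ge0// adde_ge0// sume_ge0// => j _; exact: i0.
  by split => //; rewrite sumEFin -EFinD -EFinM lee_fin; exact: Fu.
have ms : measurable_fun D (fun t => \sum_(0 <= j < J) (b j * \1_(E j) t)%:E)%E.
  exact: emeasurable_sum.
have s0 t : D t -> (0 <= \sum_(0 <= j < J) (b j * \1_(E j) t)%:E)%E.
  by move=> Dt; rewrite sume_ge0// => j _; exact: i0.
rewrite (ge0_integralZl mu mD)//; last 3 first.
- by apply: emeasurable_funD.
- by move=> t Dt; rewrite adde_ge0// s0.
- by rewrite lee_fin powR_ge0.
rewrite (ge0_integralD mu mD)//.
rewrite muD (ge0_integral_sum mu mD mi i0).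
rewrite (eq_bigr (fun j => (b j * m j)%:E)); last first.
  move=> j _; have mj : measurable_fun D (fun t => (\1_(E j) t : R)%:E).
    by apply/measurable_EFinP; exact: measurable_indic.
  have j0 t : D t -> (0 <= (\1_(E j) t : R)%:E)%E by rewrite lee_fin.
  under eq_integral do rewrite EFinM.
  rewrite (ge0_integralZl mu mD mj j0); last by rewrite lee_fin.
  rewrite integral_indic// EFinM -muE; congr (_ * mu _)%E.
  by rewrite /E setIAC setIid.
rewrite sumEFin -EFinD -EFinM lee_fin -/c.
have -> : L `^ u = c `^ (u / q) by rewrite /L -powRrM mulrC.
rewrite ler_wpM2l ?powR_ge0// /level_sum lerD2l [leRHS]big_mkcond ler_sum// => j _.
by rewrite /b; case: ifP => _; rewrite ?mul0r.
Qed.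

(** The exponent [(s - beta) * u + (u / p - 1)] is [u] times the defect in the condition. If it is
    0, the terms are bounded and their powers [p / u] are summable, so [v >= p] suffices by
    interpolation; if it is negative, they decay geometrically. *)
Lemma embedding_lt (p q u v alpha beta : R) (f : C -> C) :
  0 < p -> 0 < q -> 0 < u -> 0 < v -> 0 < beta -> p < u ->
  p <= v /\ 1 / p + (alpha + 2) / q = 1 / u + beta \/
    1 / p + (alpha + 2) / q < 1 / u + beta ->
  AT p q alpha f -> mixed_norm_space u v beta f.
Proof.
move=> p0 q0 u0 v0 b0 pu cond [fa fAT]; split => //.
have [K K0 HK] := cone_estimate alpha q0.
pose D : set (measurableTypeR R) := `[0%R, (2 * pi)%R]%classic.
have mD : measurable D by exact: measurable_itv.
have mA : measurable_fun D (cone_area f q alpha).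
  by apply: measurable_funTS; exact: measurable_cone_area.
have Dfin : (mu D < +oo)%E by rewrite lebesgue_measure_itv/=; case: ifP => _; rewrite ?ltry.
have [m [M [m0 muE HM]]] := level_measures p0 q0 mD Dfin mA (cone_area_ge0 f q alpha) fAT.
have pi0 : 0 <= 2 * pi :> R by rewrite mulr_ge0// pi_ge0.
have HMj j := level_term_le m0 HM j.
have /choice[J HJ] : forall k, exists J : nat, (0 < k)%N -> forall r : R,
    (2^-1) ^+ k.+1 < 1 - r -> 1 - r <= (2^-1) ^+ k ->
    (circle_integral (fun xi => (cabs (f (r%:C%C * xi)) `^ u)%:E) <=
      ((K * (2 ^+ k) `^ (alpha + 2)) `^ (u / q) * level_sum u (2 * pi) m J k)%:E)%E.
  move=> k.
  have [k0|k0] := ltnP 0 k; last by exists 0%N.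
  have [J HJ] := circle_level_bound p0 q0 u0 K0 fa HK m0 muE HMj k0.
  by exists J => _.
pose s := (alpha + 2) / q.
pose Dk k := level_sum u (2 * pi) m (J k) k.
have D0 k : 0 <= Dk k by exact: level_sum_ge0.
pose y k := K `^ (u / q) * ((2 ^+ k) `^ ((s - beta) * u) * Dk k).
have z0 k : 0 <= (2 ^+ k) `^ ((s - beta) * u) * Dk k by rewrite mulr_ge0 ?powR_ge0.
have y0 k : 0 <= y k by rewrite mulr_ge0 ?powR_ge0.
have Hy k (r : R) : (0 < k)%N -> (2^-1) ^+ k.+1 < 1 - r -> 1 - r <= (2^-1) ^+ k ->
    (circle_integral (fun xi => (cabs (f (r%:C%C * xi)) `^ u)%:E) <=
      ((2 ^+ k) `^ (beta * u) * y k)%:E)%E.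
  move=> k0 h1 h2; apply: le_trans (HJ k k0 r h1 h2) _; rewrite lee_fin.
  have T0 : 0 < 2 ^+ k :> R by rewrite exprn_gt0.
  rewrite le_eqVlt; apply/orP; left; apply/eqP.
  rewrite /y powRM ?powR_ge0 ?(ltW K0)// [RHS]mulrCA -!mulrA; congr (_ * _).
  rewrite mulrA; congr (_ * _); rewrite -powRD; last by rewrite (gt_eqF T0) implybT.
  by rewrite -powRrM; congr (_ `^ _); rewrite /s; field; lra.
have vu0 : 0 < v / u by rewrite divr_gt0.
suff [B HB] : exists B : R, forall n,
    \sum_(0 <= k < n) ((2 ^+ k) `^ ((s - beta) * u) * Dk k) `^ (v / u) <= B.
  apply: (mixed_norm_finite u0 v0 b0 fa y0 Hy (K := (K `^ (u / q)) `^ (v / u) * B)) => n.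
  by rewrite sum_powR_scale ?powR_ge0// ler_wpM2l ?powR_ge0.
have [c c0 Hc] : exists2 c, 0 <= c & forall k, Dk k <= c * (2 ^+ k) `^ (u / p - 1).
  eexists; last first.
    by move=> k; exact: (level_sum_le p0 pu pi0 m0 HM).
  have M0 : 0 <= M by apply: le_trans (HM 0%N); rewrite big_geq.
  by apply: addr_ge0 => //; rewrite !mulr_ge0 ?powR_ge0.
have zle k : (2 ^+ k) `^ ((s - beta) * u) * Dk k <=
    c * (2 `^ ((s - beta) * u + (u / p - 1))) ^+ k.
  have T0 : 0 < 2 ^+ k :> R by rewrite exprn_gt0.
  rewrite powR_exprn// powRD; last by rewrite (gt_eqF T0) implybT.
  by rewrite mulrCA ler_wpM2l ?powR_ge0.
have eE : (s - beta) * u + (u / p - 1) = ((1 / p + s) - (1 / u + beta)) * u.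
  by field; lra.
case: cond => [[pv crit]|ncrit].
  rewrite eE /s crit subrr mul0r powRr0 in zle.
  have zle' k : 0 <= (2 ^+ k) `^ ((s - beta) * u) * Dk k <= c.
    by rewrite z0/=; have := zle k; rewrite expr1n mulr1.
  have pu0 : 0 < p / u by rewrite divr_gt0.
  have puv : p / u <= v / u by rewrite ler_wpM2r// invr_ge0 ltW.
  have [B HB] := sum_level_sum p0 pu pi0 m0 HM J.
  exists (c `^ (v / u - p / u) * B) => n.
  apply: le_trans (sum_powR_interpolate
    (b := fun k => ((2 ^+ k) `^ ((s - beta) * u) * Dk k) `^ (p / u)) n c0 pu0 puv zle' _) _ => //.
  rewrite ler_wpM2l ?powR_ge0// (le_trans _ (HB n))// le_eqVlt; apply/orP; left; apply/eqP.
  apply: eq_bigr => k _; rewrite powRM ?powR_ge0// -powRrM; congr (_ * _).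
  have -> : (s - beta) * u * (p / u) = - (1 - p / u).
    have : s - beta = 1 / u - 1 / p by rewrite /s; lra.
    by move=> ->; field; lra.
  by rewrite powRN exprVn -powR_inv1 ?exprn_ge0// powRAC powR_inv1 ?powR_ge0.
pose rho : R := (2 `^ ((s - beta) * u + (u / p - 1))) `^ (v / u).
have rho0 : 0 <= rho by exact: powR_ge0.
have rho1 : rho < 1.
  by rewrite /rho -powRrM powR2_lt1// eE pmulr_llt0// pmulr_llt0// subr_lt0.
exists (c `^ (v / u) * (1 - rho)^-1) => n.
apply: (@le_trans _ _ (\sum_(0 <= k < n) c `^ (v / u) * rho ^+ k)).
  apply: ler_sum => k _; rewrite /rho powR_exprn ?powR_ge0// -powRM ?exprn_ge0 ?powR_ge0//.
  by rewrite ge0_ler_powR ?nnegrE ?(ltW vu0) ?mulr_ge0 ?exprn_ge0 ?powR_ge0.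
by rewrite -mulr_sumr ler_wpM2l ?powR_ge0// sum_expr_le.
Qed.

End EmbeddingLt.

(** * Lacunary series *)

Section LacunarySeries.
Variable R : realType.
Local Notation C := R[i].
Local Notation Re := (@complex.Re R).
Local Notation Im := (@complex.Im R).
Implicit Types (g h : C -> C) (rho m D : R).

(** The sum is taken in real and imaginary parts; for absolutely convergent series [csum_near] gives
    it its meaning. *)
Definition csum (c : nat -> C) : C :=
  Complex (limn (series (fun k => Re (c k)))) (limn (series (fun k => Im (c k)))).

Lemma series_near (x : nat -> R) (S : R) :
  (forall n, \sum_(0 <= k < n) `|x k| <= S) -> forall e : R, 0 < e ->
  exists n0, forall n, (n0 <= n)%N -> `|limn (series x) - \sum_(0 <= k < n) x k| <= e.
Proof.
move=> xS e e0; have cx : cvgn (series x).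
  apply: normed_cvg; apply: nondecreasing_is_cvgn.
    by apply: nondecreasing_series => n *; exact: normr_ge0.
  by exists S => _ [n _ <-]; exact: xS.
have /cvgrPdist_le/(_ _ e0)[n0 _ Hn] := cx; exists n0 => n nn; exact: Hn.
Qed.

Lemma csum_near (c : nat -> C) (S : R) :
  (forall n, \sum_(0 <= k < n) cabs (c k) <= S) -> forall e : R, 0 < e ->
  exists n0, forall n, (n0 <= n)%N -> cabs (csum c - \sum_(0 <= k < n) c k) <= e.
Proof.
move=> cS e e0; have e2 : 0 < e / 2 by rewrite divr_gt0.
have HR n : \sum_(0 <= k < n) `|Re (c k)| <= S.
  by apply: le_trans (cS n); apply: ler_sum => k _; exact: Re_le_cabs.
have HI n : \sum_(0 <= k < n) `|Im (c k)| <= S.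
  by apply: le_trans (cS n); apply: ler_sum => k _; exact: Im_le_cabs.
have [n1 H1] := series_near HR e2; have [n2 H2] := series_near HI e2.
exists (maxn n1 n2) => n; rewrite geq_max => /andP[h1 h2].
rewrite (le_trans (cabs_le_ReIm _))// (raddfB Re) (raddfB Im) (raddf_sum Re) (raddf_sum Im) /=.
by rewrite (splitr e) lerD ?H1 ?H2.
Qed.

(** On the disk of radius [rho], [m] bounds the modulus and [D] acts as a degree: it controls the
    first and second order behaviour relative to [m]. The format is stable under products, with [m]
    multiplied and [D] added, as for [z ^ n] with [rho ^ n] and [n / rho]. *)
Definition tame rho m D g := exists g' : C -> C, forall z w,
  cabs z <= rho -> cabs w <= rho ->
  [/\ cabs (g z) <= m, cabs (g w - g z) <= m * D * cabs (w - z), cabs (g' z) <= m * D &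
      cabs (g w - g z - g' z * (w - z)) <= m * D ^+ 2 * cabs (w - z) ^+ 2].

(** Leibniz' rule; the mixed second-order term fits into [(D1 + D2) ^ 2]. *)
Lemma tameM rho m1 D1 g m2 D2 h : 0 <= m1 -> 0 <= m2 -> 0 <= D1 -> 0 <= D2 ->
  tame rho m1 D1 g -> tame rho m2 D2 h -> tame rho (m1 * m2) (D1 + D2) (fun z => g z * h z).
Proof.
move=> m10 m20 D10 D20 [g' Hg] [h' Hh]; exists (fun z => g' z * h z + g z * h' z) => z w zr wr.
have [g1 g2 g3 g4] := Hg z w zr wr; have [h1 h2 h3 h4] := Hh z w zr wr.
have [_ _ _ _] := Hg w z wr zr; have [hw _ _ _] := Hh w z wr zr.
set d := cabs (w - z) in g2 g4 h2 h4 *; have d0 : 0 <= d by exact: cabs_ge0.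
have B (x y : C) (a b : R) : cabs x <= a -> cabs y <= b -> cabs (x * y) <= a * b.
  by move=> xa yb; rewrite cabsM ler_pM ?cabs_ge0.
split; first exact: B.
- have -> : g w * h w - g z * h z = (g w - g z) * h w + g z * (h w - h z) by ring.
  apply: (le_trans (cabsD _ _)); apply: (le_trans (lerD (B _ _ _ _ g2 hw) (B _ _ _ _ g1 h2))).
  by rewrite le_eqVlt; apply/orP; left; apply/eqP; ring.
- apply: (le_trans (cabsD _ _)); apply: (le_trans (lerD (B _ _ _ _ g3 h1) (B _ _ _ _ g1 h3))).
  by rewrite le_eqVlt; apply/orP; left; apply/eqP; ring.
have -> : g w * h w - g z * h z - (g' z * h z + g z * h' z) * (w - z) =
    (g w - g z - g' z * (w - z)) * h w + g z * (h w - h z - h' z * (w - z)) +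
    g' z * (h w - h z) * (w - z) by ring.
have dd : cabs (w - z) <= d by [].
apply: (le_trans (cabsD _ _)).
apply: (le_trans (lerD (cabsD _ _) (B _ _ _ _ (B _ _ _ _ g3 h2) dd))).
apply: (le_trans (lerD (lerD (B _ _ _ _ g4 hw) (B _ _ _ _ g1 h4)) (lexx _))).
have P : 0 <= m1 * m2 * (D1 * D2) * d ^+ 2 by rewrite !mulr_ge0 ?exprn_ge0.
have -> : m1 * m2 * (D1 + D2) ^+ 2 * d ^+ 2 = m1 * D1 ^+ 2 * d ^+ 2 * m2 +
  m1 * (m2 * D2 ^+ 2 * d ^+ 2) + m1 * D1 * (m2 * D2 * d) * d + m1 * m2 * (D1 * D2) * d ^+ 2 by ring.
by rewrite lerDl.
Qed.

Lemma tame_le rho m1 D1 m2 D2 g : 0 <= m1 -> 0 <= D1 -> m1 <= m2 -> D1 <= D2 ->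
  tame rho m1 D1 g -> tame rho m2 D2 g.
Proof.
move=> m10 D10 mm DD [g' H]; exists g' => z w zr wr; have [g1 g2 g3 g4] := H z w zr wr.
have mD : m1 * D1 <= m2 * D2 by rewrite ler_pM.
split; first exact: le_trans mm.
- by rewrite (le_trans g2)// ler_wpM2r ?cabs_ge0.
- exact: le_trans mD.
rewrite (le_trans g4)// ler_wpM2r ?exprn_ge0 ?cabs_ge0// ler_pM ?exprn_ge0//.
by rewrite ler_pXn2r ?nnegrE// (le_trans D10).
Qed.

Lemma tame_cst1 rho : tame rho 1 0 (fun=> 1).
Proof.
exists (fun=> 0) => z w _ _; rewrite subrr mul0r subr0 cabs0 cabs1 mulr0 mul0r.
by rewrite expr0n /= mulr0 mul0r.
Qed.

Lemma tame_scale rho (om : C) : 0 < rho -> cabs om = 1 ->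
  tame rho rho rho^-1 (fun z => om * z).
Proof.
move=> r0 o1; exists (fun=> om) => z w zr wr.
rewrite -mulrBr subrr cabs0 !cabsM o1 !mul1r mulfV ?gt_eqF// mul1r.
by split => //; rewrite !mulr_ge0 ?exprn_ge0 ?invr_ge0 ?cabs_ge0 ?(ltW r0).
Qed.

Lemma tameX rho m D g n : 0 <= m -> 0 <= D -> tame rho m D g ->
  tame rho (m ^+ n) (n%:R * D) (fun z => g z ^+ n).
Proof.
move=> m0 D0 tg; elim: n => [|n IH]; first by rewrite expr0 mul0r; exact: tame_cst1.
have -> : (fun z => g z ^+ n.+1) = (fun z => g z * g z ^+ n).
  by apply/funext => z; rewrite exprS.
have -> : n.+1%:R * D = D + n%:R * D by rewrite -natr1 mulrDl mul1r addrC.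
by rewrite exprS; apply: tameM; rewrite ?exprn_ge0 ?mulr_ge0.
Qed.

Definition Dn (n : nat) (z : C) : C := n%:R^-1 * \sum_(0 <= l < n) z ^+ l.

Lemma tame_average rho m D (gs : nat -> C -> C) n : (0 < n)%N -> 0 <= m -> 0 <= D ->
  (forall l, (l < n)%N -> tame rho m D (gs l)) ->
  tame rho m D (fun z => n%:R^-1 * \sum_(0 <= l < n) gs l z).
Proof.
move=> n0 m0 D0 tg.
have /choice[G HG] : forall l, exists g' : C -> C, (l < n)%N -> forall z w,
  cabs z <= rho -> cabs w <= rho ->
  [/\ cabs (gs l z) <= m, cabs (gs l w - gs l z) <= m * D * cabs (w - z), cabs (g' z) <= m * D &
      cabs (gs l w - gs l z - g' z * (w - z)) <= m * D ^+ 2 * cabs (w - z) ^+ 2].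
  move=> l; have [ln|ln] := ltnP l n; last by exists (fun=> 0).
  by have [g' Hg'] := tg l ln; exists g' => _.
have av (F : nat -> C) (b : R) : 0 <= b -> (forall l, (l < n)%N -> cabs (F l) <= b) ->
    cabs (n%:R^-1 * \sum_(0 <= l < n) F l) <= b.
  move=> b0 Fb; rewrite cabsM cabsV cabs_nat ler_pdivrMl ?ltr0n//.
  rewrite (le_trans (cabs_sum _ _ _))// !big_nat.
  apply: (@le_trans _ _ (\sum_(0 <= l < n | (0 <= l < n)%N) b)).
    by apply: ler_sum => l /andP[_ ln]; exact: Fb.
  by rewrite -big_nat sumr_const_nat subn0 mulr_natl.
exists (fun z => n%:R^-1 * \sum_(0 <= l < n) G l z) => z w zr wr.
have E1 : n%:R^-1 * \sum_(0 <= l < n) gs l w - n%:R^-1 * \sum_(0 <= l < n) gs l z =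
    n%:R^-1 * \sum_(0 <= l < n) (gs l w - gs l z) by rewrite -mulrBr -sumrB.
have E2 : n%:R^-1 * \sum_(0 <= l < n) gs l w - n%:R^-1 * \sum_(0 <= l < n) gs l z -
    n%:R^-1 * (\sum_(0 <= l < n) G l z) * (w - z) =
    n%:R^-1 * \sum_(0 <= l < n) (gs l w - gs l z - G l z * (w - z)).
  by rewrite E1 -mulrA mulr_suml -mulrBr -sumrB.
rewrite E2 E1.
by split; apply: av => [|l ln]; rewrite ?mulr_ge0 ?exprn_ge0 ?cabs_ge0//;
  have [] := HG l ln z w zr wr.
Qed.

Lemma tame_Dn rho (om : C) n : (0 < n)%N -> 0 < rho -> rho <= 1 -> cabs om = 1 ->
  tame rho 1 (n%:R / rho) (fun z => Dn n (om * z)).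
Proof.
move=> n0 r0 r1 o1; apply: tame_average => //; first by rewrite divr_ge0 ?(ltW r0).
move=> l ln; apply: tame_le (tameX l (ltW r0) _ (tame_scale r0 o1)); rewrite ?exprn_ge0 ?(ltW r0)//.
- by rewrite mulr_ge0// invr_ge0 ltW.
- by rewrite exprn_ile1 ?(ltW r0).
- by rewrite ler_wpM2r ?invr_ge0 ?(ltW r0)// ler_nat ltnW.
- by rewrite invr_ge0 ltW.
Qed.

(** Termwise differentiation: the second-order remainders add up to at most [S |w - z| ^ 2]. The
    convergence of partial sums is kept as a second conclusion, since bounds on the modulus are read
    off from them. *)
Lemma series_analytic (b : nat -> R) (gs : nat -> C -> C) :
  (forall rho : R, 0 < rho -> rho < 1 -> exists m D : nat -> R, exists S : R,
    [/\ forall k, 0 <= m k, forall k, 0 <= D k, forall k, tame rho (m k) (D k) (gs k) &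
     forall n, \sum_(0 <= k < n) `|b k| * m k * (1 + D k + D k ^+ 2) <= S]) ->
  analytic_on_disk (fun z => csum (fun k => (b k)%:C%C * gs k z)) /\
  forall z, cabs z < 1 -> forall e : R, 0 < e -> exists n0, forall n, (n0 <= n)%N ->
    cabs (csum (fun k => (b k)%:C%C * gs k z) - \sum_(0 <= k < n) (b k)%:C%C * gs k z) <= e.
Proof.
move=> H; have near z : cabs z < 1 -> forall e : R, 0 < e -> exists n0, forall n, (n0 <= n)%N ->
    cabs (csum (fun k => (b k)%:C%C * gs k z) - \sum_(0 <= k < n) (b k)%:C%C * gs k z) <= e.
  move=> z1; have z0 := cabs_ge0 z; pose rho := (1 + cabs z) / 2.
  have [||m [D [S [m0 D0 tg HS]]]] := H rho; rewrite /rho; try lra.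
  apply: csum_near (S) _ => n; apply: le_trans (HS n); apply: ler_sum => k _.
  have [g' Hg] := tg k; have [||g1 _ _ _] := Hg z z; rewrite /rho; try lra.
  rewrite cabsM cabs_real -mulrA ler_wpM2l// (le_trans g1)// ler_peMr//.
  by rewrite -addrA lerDl addr_ge0 ?exprn_ge0.
split => // z z1'; have z1 : cabs z < 1 := z1'; apply/derivable_cabsP.
have z0 := cabs_ge0 z; pose rho := (1 + cabs z) / 2.
have rz : cabs z < rho by rewrite /rho; lra.
have [||m [D [S [m0 D0 tg HS]]]] := H rho; rewrite /rho; try lra.
have /choice[G HG] := tg.
pose l := csum (fun k => (b k)%:C%C * G k z).
have Sm n : \sum_(0 <= k < n) `|b k| * m k * D k <= S.
  apply: le_trans (HS n); apply: ler_sum => k _; rewrite ler_wpM2l ?mulr_ge0//.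
  by rewrite addrAC lerDr addr_ge0 ?exprn_ge0.
have SD n : \sum_(0 <= k < n) `|b k| * (m k * D k ^+ 2) <= S.
  apply: le_trans (HS n); apply: ler_sum => k _; rewrite mulrA ler_wpM2l ?mulr_ge0//.
  by rewrite lerDr addr_ge0.
have S0 : 0 <= S by apply: le_trans (HS 0%N); rewrite big_geq.
have nl : forall e : R, 0 < e -> exists n0, forall n, (n0 <= n)%N ->
    cabs (l - \sum_(0 <= k < n) (b k)%:C%C * G k z) <= e.
  apply: csum_near (S) _ => n; apply: le_trans (Sm n); apply: ler_sum => k _.
  have [||_ _ g3 _] := HG k z z; rewrite ?(ltW rz)//.
  by rewrite cabsM cabs_real -mulrA ler_wpM2l.
exists l => e e0; exists (Num.min (rho - cabs z) (e / (S + 1))).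
  by rewrite lt_min subr_gt0 rz divr_gt0//; lra.
move=> w; rewrite lt_min => /andP[wz we].
have wr : cabs w < rho.
  by have := cabs_lerB w z; lra.
have w1 : cabs w < 1 by move: wr; rewrite /rho; lra.
pose F z := csum (fun k => (b k)%:C%C * gs k z); rewrite -/(F w) -/(F z).
set d := cabs (w - z) in we *.
have d0 : 0 <= d by exact: cabs_ge0.
have Q : cabs (F w - F z - l * (w - z)) <= S * d ^+ 2.
  apply/ler_addgt0Pr => e' e'0.
  have e2 : 0 < e' / (2 + d) by rewrite divr_gt0//; lra.
  have [n1 H1] := near w w1 _ e2; have [n2 H2] := near z z1 _ e2; have [n3 H3] := nl _ e2.
  pose n := maxn n1 (maxn n2 n3).
  have {}H1 := H1 n (leq_maxl _ _).
  have {}H2 := H2 n (leq_trans (leq_maxl _ _) (leq_maxr _ _)).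
  have {}H3 := H3 n (leq_trans (leq_maxr _ _) (leq_maxr _ _)).
  move: H1 H2 H3; rewrite -/(F w) -/(F z).
  set Sw := \sum_(0 <= k < n) _; set Sz := \sum_(0 <= k < n) _; set Sl := \sum_(0 <= k < n) _.
  move=> H1 H2 H3.
  have H4 : cabs (Sw - Sz - Sl * (w - z)) <= S * d ^+ 2.
    rewrite /Sw /Sz /Sl -sumrB mulr_suml -sumrB (le_trans (cabs_sum _ _ _))//.
    apply: (@le_trans _ _ (\sum_(0 <= k < n) `|b k| * (m k * D k ^+ 2) * d ^+ 2)).
      apply: ler_sum => k _; have [||_ _ _ g4] := HG k z w; rewrite ?(ltW rz) ?(ltW wr)//.
      have -> : (b k)%:C%C * gs k w - (b k)%:C%C * gs k z - (b k)%:C%C * G k z * (w - z) =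
          (b k)%:C%C * (gs k w - gs k z - G k z * (w - z)) by ring.
      by rewrite cabsM cabs_real -mulrA ler_wpM2l.
    by rewrite -mulr_suml ler_wpM2r ?exprn_ge0.
  have -> : F w - F z - l * (w - z) =
    (Sw - Sz - Sl * (w - z)) + ((F w - Sw) - (F z - Sz)) - (l - Sl) * (w - z) by ring.
  apply: (le_trans (cabsB _ _)); rewrite cabsM.
  apply: (le_trans (lerD (cabsD _ _) (lexx _))).
  apply: (le_trans (lerD (lerD H4 (le_trans (cabsB _ _) (lerD H1 H2))) (ler_wpM2r d0 H3))).
  have E : e' / (2 + d) + e' / (2 + d) + e' / (2 + d) * d = e' by field; lra.
  by rewrite -addrA E.
apply: (le_trans Q); rewrite expr2 mulrA ler_wpM2r//.
apply: (@le_trans _ _ ((S + 1) * (e / (S + 1)))).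
  by rewrite ler_pM ?(ltW we)// lerDl.
by rewrite mulrC divfK// gt_eqF//; lra.
Qed.

Lemma exprn_expR (x : R) n : 0 <= x -> x <= 1 -> (1 - x) ^+ n <= expR (- (n%:R * x)).
Proof.
move=> x0 x1; rewrite -mulrN expRM_natl; apply: lerXn2r; rewrite ?nnegrE ?expR_ge0 ?subr_ge0//.
exact: expR_ge1Dx.
Qed.

Lemma exprn_powR (m : R) : 0 < m -> exists2 K : R, 0 < K &
  forall n x, 0 <= x -> x <= 1 -> (1 - x) ^+ n <= K * (1 + n%:R * x) `^ (- m).
Proof.
move=> m0; have [K K0 HK] := expRN_powR m0; exists K => // n x x0 x1.
by apply: le_trans (exprn_expR n x0 x1) (HK _ _); rewrite mulr_ge0.
Qed.

Definition lacunary_coef (tau gam : R) (B k : nat) : R :=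
  (k.+1)%:R `^ (- tau) * ((B ^ k)%N%:R) `^ gam.

Lemma lacunary_coef_ge0 tau gam B k : 0 <= lacunary_coef tau gam B k.
Proof. by rewrite mulr_ge0 ?powR_ge0. Qed.

(* [x^(gam+3) rho^x] is bounded in [x]; take [x = B^k]. *)
Lemma lacunary_summable (tau gam rho c : R) (B : nat) : 0 <= tau -> 0 < gam -> 0 < rho -> rho < 1 ->
  0 <= c -> (1 < B)%N -> exists S : R, forall n,
  \sum_(0 <= k < n) lacunary_coef tau gam B k * rho ^+ (B ^ k) *
    (1 + c * (B ^ k)%N%:R + (c * (B ^ k)%N%:R) ^+ 2) <= S.
Proof.
move=> t0 g0 r0 r1 c0 B1; have m0 : 0 < gam + 3 by rewrite addr_gt0.
have [K K0 HK] := exprn_powR m0; pose x := 1 - rho.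
have x0 : 0 < x by rewrite subr_gt0.
have xr : rho = 1 - x by rewrite /x; lra.
pose b := B%:R^-1 : R.
have B2 : 2 <= B%:R :> R by rewrite ler_nat.
have b0 : 0 <= b by rewrite invr_ge0.
have b1 : b < 1 by rewrite invf_lt1; lra.
exists ((K * x `^ (- (gam + 3)) * (1 + c) ^+ 2) * (1 - b)^-1) => n.
apply: (@le_trans _ _ (\sum_(0 <= k < n) (K * x `^ (- (gam + 3)) * (1 + c) ^+ 2) * b ^+ k)).
  apply: ler_sum => k _; set y : R := (B ^ k)%N%:R.
  have y1 : 1 <= y by rewrite ler1n expn_gt0 (ltnW B1).
  have y0 : 0 < y by rewrite (lt_le_trans ltr01).
  have h1 : rho ^+ (B ^ k) <= K * x `^ (- (gam + 3)) * y `^ (- (gam + 3)).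
    rewrite xr (le_trans (HK _ _ (ltW x0) _))//; first by rewrite /x; lra.
    rewrite -mulrA ler_wpM2l ?(ltW K0)// -powRM ?(ltW x0) ?(ltW y0)//.
    rewrite !powRN lef_pV2 ?posrE ?powR_gt0 ?mulr_gt0//; last by rewrite ltr_wpDr ?mulr_ge0 ?(ltW x0).
    rewrite ge0_ler_powR ?nnegrE ?(ltW m0) ?mulr_ge0 ?(ltW x0) ?(ltW y0)//.
      by rewrite addr_ge0 ?mulr_ge0 ?(ltW x0).
    by rewrite mulrC -/y lerDr.
  have h2 : 1 + c * y + (c * y) ^+ 2 <= (1 + c) ^+ 2 * y ^+ 2.
    have e1 : 0 <= y * y - 1 by rewrite subr_ge0 -[leLHS]mulr1 ler_pM.
    have e2 : 0 <= c * (y * (2 * y - 1)) by rewrite !mulr_ge0 ?(ltW y0)//; lra.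
    by rewrite !expr2; lra.
  have h3 : (k.+1)%:R `^ (- tau) <= 1 :> R.
    rewrite powRN invf_le1 ?powR_gt0//.
    by have := @ler_powR _ k.+1%:R _ _ _ t0; rewrite powRr0; apply; rewrite ler1n.
  have h0 : 0 <= 1 + c * y + (c * y) ^+ 2.
    by rewrite addr_ge0 ?exprn_ge0 ?addr_ge0 ?mulr_ge0 ?(ltW y0).
  apply: (@le_trans _ _ (y `^ gam * (K * x `^ (- (gam + 3)) * y `^ (- (gam + 3))) * ((1 + c) ^+ 2 * y ^+ 2))).
    rewrite ler_pM ?mulr_ge0 ?exprn_ge0 ?(ltW r0) ?lacunary_coef_ge0//.
    rewrite ler_pM ?exprn_ge0 ?(ltW r0) ?lacunary_coef_ge0//.
    by rewrite /lacunary_coef ger_pMl ?powR_gt0.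
  have -> : y `^ gam * (K * x `^ (- (gam + 3)) * y `^ (- (gam + 3))) * ((1 + c) ^+ 2 * y ^+ 2) =
     (K * x `^ (- (gam + 3)) * (1 + c) ^+ 2) * (y `^ gam * y `^ (- (gam + 3)) * y ^+ 2) by ring.
  rewrite ler_wpM2l ?mulr_ge0 ?powR_ge0 ?exprn_ge0 ?(ltW K0) ?addr_ge0//.
  rewrite -(powR_mulrn 2) ?(ltW y0)// -!powRD ?(gt_eqF y0) ?implybT//.
  have -> : gam + - (gam + 3) + 2%:R = -1 by ring.
  by rewrite powRN powRr1 ?(ltW y0)// /y natrX exprVn.
by rewrite -mulr_sumr ler_wpM2l ?sum_expr_le// mulr_ge0 ?exprn_ge0 ?addr_ge0// mulr_ge0 ?powR_ge0 ?(ltW K0).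
Qed.

Lemma cabs_Dn_le1 n (z : C) : cabs z <= 1 -> cabs (Dn n z) <= 1.
Proof.
move=> z1; case: n => [|n]; first by rewrite /Dn big_geq// mulr0 cabs0.
rewrite /Dn cabsM cabsV cabs_nat ler_pdivrMl ?ltr0n// mulr1 (le_trans (cabs_sum _ _ _))//.
apply: (@le_trans _ _ (\sum_(0 <= l < n.+1) 1)); last by rewrite sumr_const_nat subn0.
by apply: ler_sum => l _; rewrite cabsX exprn_ile1 ?cabs_ge0.
Qed.

(** [1 - x >= exp (- 2 x)] on [[0, 1/2]], because [(1 - x) (1 + 2 x) >= 1] there. *)
Lemma exprn_ge_expR (x : R) n : 0 <= x -> x <= 2^-1 -> expR (- (2 * (n%:R * x))) <= (1 - x) ^+ n.
Proof.
move=> x0 x1; rewrite mulrCA -mulrN expRM_natl; apply: lerXn2r; rewrite ?nnegrE ?expR_ge0//; first lra.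
rewrite expRN -div1r ler_pdivrMr ?expR_gt0//.
apply: (@le_trans _ _ ((1 - x) * (1 + 2 * x))); last by rewrite ler_wpM2l ?expR_ge1Dx//; lra.
have : 0 <= x * (1 - 2 * x) by rewrite mulr_ge0//; lra.
lra.
Qed.

(** By [j + i + 1 <= 2 ^ i (j + 1)] the factor [(k + 1) ^ -tau] varies by at most [2 ^ tau] per
    step. *)
Lemma lacunary_coef_below tau gam B j i : 0 <= tau -> (0 < B)%N ->
  lacunary_coef tau gam B j <=
  lacunary_coef tau gam B (j + i) * (2 `^ tau * B%:R `^ (- gam)) ^+ i.
Proof.
move=> t0 B0; have Bi k : 0 < (B ^ k)%N%:R :> R by rewrite ltr0n expn_gt0 B0.
rewrite exprMn !powR_exprn// -!natrX /lacunary_coef expnD natrM powRM ?(ltW (Bi _))//.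
have -> : (j + i).+1%:R `^ (- tau) * ((B ^ j)%N%:R `^ gam * (B ^ i)%N%:R `^ gam) *
    ((2 ^ i)%N%:R `^ tau * (B ^ i)%N%:R `^ (- gam)) =
    ((j + i).+1%:R `^ (- tau) * (2 ^ i)%N%:R `^ tau) * (B ^ j)%N%:R `^ gam *
    ((B ^ i)%N%:R `^ gam * (B ^ i)%N%:R `^ (- gam)) :> R by ring.
rewrite -powRD ?subrr ?powRr0 ?mulr1; last by rewrite (gt_eqF (Bi i)) implybT.
rewrite ler_wpM2r ?powR_ge0// !powRN ler_pdivlMl ?powR_gt0//.
rewrite ler_pdivrMr ?powR_gt0// -powRM// ge0_ler_powR ?nnegrE ?mulr_ge0//.
have h : ((j + i).+1 <= 2 ^ i * j.+1)%N.
  apply: leq_trans (leq_mul (ltn_expl i (ltnSn 1)) (leqnn j.+1)).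
  by rewrite mulSn -addSn leq_add2l leq_pmulr.
by rewrite -natrM ler_nat.
Qed.

(** For [x >= B ^ -k / 2] the power [(1 - x) ^ (B ^ (k + i))] decays like [B ^ (- i (gam + 1))], one
    power faster than the coefficients grow. *)
Lemma lacunary_coef_above tau gam K B k i (x : R) : 0 <= tau -> 0 < gam -> (0 < B)%N ->
  (forall n x, 0 <= x -> x <= 1 -> (1 - x) ^+ n <= K * (1 + n%:R * x) `^ (- (gam + 1))) ->
  0 <= K -> ((B ^ k)%N%:R)^-1 / 2 <= x -> x <= 1 ->
  lacunary_coef tau gam B (k + i) * (1 - x) ^+ (B ^ (k + i)) <=
  lacunary_coef tau gam B k * (K * 2 `^ (gam + 1) * B%:R^-1 ^+ i).
Proof.
move=> t0 g0 B0 HK K0 x1 x2; have Bi j : 0 < (B ^ j)%N%:R :> R by rewrite ltr0n expn_gt0 B0.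
have x0 : 0 <= x by rewrite (le_trans _ x1)// divr_ge0// invr_ge0.
have g1 : 0 <= gam + 1 by rewrite addr_ge0// ltW.
set Y : R := (B ^ i)%N%:R; have Y0 : 0 < Y by exact: Bi.
have h1 : (1 - x) ^+ (B ^ (k + i)) <= K * 2 `^ (gam + 1) * Y `^ (- (gam + 1)).
  apply: le_trans (HK _ _ x0 x2) _; rewrite -mulrA ler_wpM2l//.
  have P0 : 0 < 1 + (B ^ (k + i))%N%:R * x by rewrite ltr_pwDl// mulr_ge0// ltW.
  rewrite !powRN ler_pdivlMr ?powR_gt0// mulrC ler_pdivrMr ?powR_gt0//.
  rewrite -powRM ?(ltW P0)// ge0_ler_powR ?nnegrE ?mulr_ge0 ?(ltW Y0) ?(ltW P0)//.
  have : Y / 2 <= (B ^ (k + i))%N%:R * x.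
    rewrite expnD natrM mulrAC -/Y [leRHS]mulrC ler_wpM2l ?(ltW Y0)//.
    by move: x1; rewrite -(ler_pM2l (Bi k)) mulrA mulfV ?gt_eqF// mul1r.
  lra.
have -> : lacunary_coef tau gam B (k + i) = (k + i).+1%:R `^ (- tau) * ((B ^ k)%N%:R `^ gam * Y `^ gam).
  by rewrite /lacunary_coef expnD natrM powRM ?(ltW (Bi _)).
have h2 : (k + i).+1%:R `^ (- tau) <= k.+1%:R `^ (- tau) :> R.
  rewrite !powRN lef_pV2 ?posrE ?powR_gt0//.
  by rewrite ge0_ler_powR ?nnegrE// ler_nat ltnS leq_addr.
apply: (@le_trans _ _ ((k.+1%:R `^ (- tau) * ((B ^ k)%N%:R `^ gam * Y `^ gam)) *
    (K * 2 `^ (gam + 1) * Y `^ (- (gam + 1))))).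
  rewrite ler_pM ?mulr_ge0 ?powR_ge0 ?exprn_ge0 ?subr_ge0//.
  by rewrite ler_wpM2r// mulr_ge0 ?powR_ge0.
rewrite /lacunary_coef -!mulrA ler_wpM2l ?powR_ge0// ler_wpM2l ?powR_ge0//.
rewrite mulrCA ler_wpM2l// mulrCA ler_wpM2l ?powR_ge0//.
rewrite -powRD ?(gt_eqF Y0) ?implybT//.
by rewrite (_ : gam + - (gam + 1) = -1) ?powRN ?powRr1 ?(ltW Y0)//; [rewrite /Y natrX exprVn|ring].
Qed.

Lemma sum_below_le (b : R) k : 0 <= b -> b <= 2^-1 ->
  \sum_(0 <= j < k) b ^+ (k - j) <= 2 * b.
Proof.
move=> b0 b1; rewrite big_nat_rev /=.
rewrite (eq_big_nat _ _ (F2 := fun j => b * b ^+ j)); last first.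
  by move=> j /andP[_ jk]; rewrite add0n subKn// exprS.
rewrite -mulr_sumr mulrC ler_wpM2r// (le_trans (sum_expr_le _ b0 _))//; first lra.
by rewrite -[leRHS]invrK lef_pV2 ?posrE; lra.
Qed.

Lemma sum_above_le (b : R) k n : 0 <= b -> b <= 2^-1 ->
  \sum_(k.+1 <= j < n) b ^+ (j - k) <= 2 * b.
Proof.
move=> b0 b1; rewrite -[k.+1]add0n big_addn.
rewrite (eq_bigr (fun j => b * b ^+ j)); last first.
  by move=> j _; rewrite addnS -addSn addnK exprS.
rewrite -mulr_sumr mulrC ler_wpM2r// (le_trans (sum_expr_le _ b0 _))//; first lra.
by rewrite -[leRHS]invrK lef_pV2 ?posrE; lra.
Qed.

(** [B] is chosen before [n] and [om], large enough for the [k]-th term to dominate where [1 - |z|]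
    is about [B ^ -k]: the earlier terms, the later ones and the error of the partial sum each cost
    at most a quarter of [e0], and [c] is the quarter left. *)
Lemma lacunary_function (tau gam : R) (N : nat) : 0 <= tau -> 0 < gam ->
  exists B : nat, exists2 c : R, 0 < c & (4 <= B)%N /\
  forall (n : nat -> nat) (om : nat -> C),
  (forall k, 0 < n k <= B ^ k)%N -> (forall k, cabs (om k) = 1) ->
  exists f : C -> C, [/\ analytic_on_disk f,
    forall z, cabs z < 1 -> exists M, cabs (f z) <= 2 * \sum_(0 <= k < M)
      lacunary_coef tau gam B k * cabs z ^+ (B ^ k) * cabs (Dn (n k) (om k * z)) ^+ N &
    forall k z, (0 < k)%N -> ((B ^ k)%N%:R)^-1 / 2 <= 1 - cabs z -> 1 - cabs z <= ((B ^ k)%N%:R)^-1 ->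
      2^-1 <= cabs (Dn (n k) (om k * z)) -> c * lacunary_coef tau gam B k <= cabs (f z)].
Proof.
move=> t0 g0; have m0 : 0 < gam + 1 by rewrite addr_gt0.
have [K K0 HK] := exprn_powR m0.
(* A lower bound for [|z| ^ (B ^ k) |Dn| ^ N] where the [k]-th term is active. *)
pose e0 : R := expR (- 2) * 2^-1 ^+ N.
have e00 : 0 < e0 by rewrite mulr_gt0 ?expR_gt0 ?exprn_gt0.
have e01 : e0 <= 1.
  have h1 : expR (- 2) <= 1 :> R by rewrite expR_le1; lra.
  have h2 : 2^-1 ^+ N <= 1 :> R by rewrite exprn_ile1//; lra.
  by apply: mulr_ile1 => //; rewrite ?expR_ge0 ?exprn_ge0.
pose K' := K * 2 `^ (gam + 1); have K'0 : 0 <= K' by rewrite mulr_ge0 ?powR_ge0 ?(ltW K0).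
pose X := 8 * 2 `^ tau / e0; pose Y := 8 * K' / e0.
have X0 : 0 <= X by rewrite divr_ge0 ?mulr_ge0 ?powR_ge0 ?(ltW e00).
have Y0 : 0 <= Y by apply: divr_ge0; [exact: mulr_ge0|exact: ltW].
have Z0 : 0 <= X `^ gam^-1 + Y + 4 by rewrite !addr_ge0 ?powR_ge0.
(* [X] brings the ratio [be] of the earlier terms below [e0 / 8], [Y] does so for [K' / B], which
   governs the later terms, and 4 separates the heights. *)
pose B := Num.Def.archi_bound (X `^ gam^-1 + Y + 4).
have HB : X `^ gam^-1 + Y + 4 < B%:R := archi_boundP Z0.
have XP := powR_ge0 X gam^-1.
have B4 : (4 <= B)%N by rewrite -(ler_nat R); clear -HB XP Y0; lra.
have B0 : (0 < B)%N by exact: leq_trans B4.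
have BR : 0 < B%:R :> R by rewrite ltr0n.
have B1 : (1 < B)%N by exact: leq_trans B4.
pose be := 2 `^ tau * B%:R `^ (- gam).
have be0 : 0 <= be by rewrite mulr_ge0 ?powR_ge0.
have be1 : be <= e0 / 8.
  rewrite /be powRN ler_pdivrMr ?powR_gt0//.
  have : X <= B%:R `^ gam.
    have -> : X = (X `^ gam^-1) `^ gam by rewrite -powRrM mulVf ?gt_eqF// powRr1.
    by rewrite ge0_ler_powR ?nnegrE ?(ltW g0) ?(ltW BR)//; clear -HB XP Y0; lra.
  rewrite /X ler_pdivrMr// => h; clear -h; lra.
have K1 : K' * B%:R^-1 <= e0 / 8.
  rewrite ler_pdivrMr//; have : Y <= B%:R by clear -HB XP Y0; lra.
  rewrite /Y ler_pdivrMr// => h; clear -h; lra.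
have Bh : B%:R^-1 <= 2^-1 :> R by rewrite lef_pV2 ?posrE// ler_nat.
exists B, (e0 / 4); first by rewrite divr_gt0.
split => // n om Hn Hom.
have [n0 nB] : (forall k, 0 < n k)%N /\ (forall k, n k <= B ^ k)%N.
  by split => k; have /andP[] := Hn k.
have coef0 k : 0 <= lacunary_coef tau gam B k by exact: lacunary_coef_ge0.
pose gs k (z : C) := z ^+ (B ^ k) * Dn (n k) (om k * z) ^+ N.
have cg k z : cabs ((lacunary_coef tau gam B k)%:C%C * gs k z) =
    lacunary_coef tau gam B k * (cabs z ^+ (B ^ k) * cabs (Dn (n k) (om k * z)) ^+ N).
  by rewrite cabsM cabs_real ger0_norm// /gs cabsM !cabsX.
have [|fa near] := series_analytic (b := lacunary_coef tau gam B) (gs := gs).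
  move=> rho r0 r1; have c0 : 0 <= (N.+1)%:R / rho by rewrite divr_ge0// ltW.
  have [S HS] := lacunary_summable t0 g0 r0 r1 c0 B1.
  exists (fun k => rho ^+ (B ^ k)), (fun k => N.+1%:R / rho * (B ^ k)%N%:R), S; split.
  - by move=> k; rewrite exprn_ge0 ?(ltW r0).
  - by move=> k; rewrite mulr_ge0.
  - move=> k; have t1 := tameX (B ^ k) (ltW r0) _ (tame_scale r0 (@cabs1 R)).
    have t2 := tameX N ler01 _ (tame_Dn (n0 k) r0 (ltW r1) (Hom k)).
    have i0 : 0 <= rho^-1 by rewrite invr_ge0 ltW.
    have i1 : 0 <= (n k)%:R / rho by rewrite mulr_ge0.
    have := tameM _ _ _ _ (t1 i0) (t2 i1).
    rewrite !exprn_ge0 ?(ltW r0)// !mulr_ge0// => /(_ isT isT isT isT).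
    have -> : (fun z : C => (1 * z) ^+ (B ^ k) * Dn (n k) (om k * z) ^+ N) = gs k.
      by apply/funext => z; rewrite mul1r.
    apply: tame_le; rewrite ?expr1n ?mulr1 ?exprn_ge0 ?(ltW r0) ?addr_ge0 ?mulr_ge0//.
    rewrite mulrA -mulrDl mulrAC ler_wpM2r//.
    rewrite -natrM -natrD -natrM ler_nat mulSn leq_add2l leq_mul2l nB orbT//.
  - move=> M; rewrite (le_trans _ (HS M))// ler_sum// => k _.
    by rewrite ger0_norm.
set f := fun z => csum _ in fa near; exists f; split => //.
  move=> z z1; have [fz|fz] := eqVneq (cabs (f z)) 0.
    by exists 0%N; rewrite fz big_geq// mulr0.
  (* A partial sum within [|f z| / 2] of [f z] is at least half as large, whence the factor 2 and a
     finite [M]. *)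
  have fz0 : 0 < cabs (f z) / 2 by rewrite divr_gt0// lt_def fz cabs_ge0.
  have [M HM] := near z z1 _ fz0; exists M; have {}HM := HM M (leqnn M).
  have h := cabs_lerB (f z) (\sum_(0 <= k < M) (lacunary_coef tau gam B k)%:C%C * gs k z).
  have h2 : cabs (\sum_(0 <= k < M) (lacunary_coef tau gam B k)%:C%C * gs k z) <= \sum_(0 <= k < M)
      lacunary_coef tau gam B k * cabs z ^+ (B ^ k) * cabs (Dn (n k) (om k * z)) ^+ N.
    rewrite (le_trans (cabs_sum _ _ _))// ler_sum// => k _.
    by rewrite cg mulrA.
  clear -HM h h2; lra.
move=> k z k0 z1 z2 Dk.
set x := 1 - cabs z in z1 z2; have zx : cabs z = 1 - x by rewrite /x opprB addrC subrK.
set y : R := (B ^ k)%N%:R in z1 z2.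
have y0 : 0 < y by rewrite ltr0n expn_gt0 B0.
have y4 : y^-1 <= 4^-1.
  rewrite lef_pV2 ?posrE// /y ler_nat (leq_trans B4)// -[X in (X <= _)%N]expn1.
  by rewrite leq_exp2l.
have x0 : 0 <= x by rewrite (le_trans _ z1)// divr_ge0// invr_ge0 ltW.
have x1 : x <= 2^-1 by clear -z2 y4; lra.
have xy : y * x <= 1 by rewrite -(mulfV (lt0r_neq0 y0)) ler_wpM2l ?(ltW y0).
set a := lacunary_coef tau gam B k; have a0 : 0 <= a by exact: coef0.
have a00 : 0 < a by rewrite mulr_gt0 ?powR_gt0// ltr0n.
have z1' : cabs z < 1.
  rewrite zx; have : 0 < y^-1 / 2 by rewrite divr_gt0// invr_gt0.
  by clear -z1; lra.
have E0 : 0 < a * (e0 / 4) by rewrite mulr_gt0// divr_gt0.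
have [M0 HM] := near z z1' _ E0; pose M := maxn M0 k.+1.
have {}HM := HM M (leq_maxl _ _).
have kM : (k < M)%N by exact: leq_maxr.
pose t j := (lacunary_coef tau gam B j)%:C%C * gs j z.
have ct j : cabs (t j) <= lacunary_coef tau gam B j * (1 - x) ^+ (B ^ j).
  rewrite /t cg ler_wpM2l// -zx ler_piMr ?exprn_ge0 ?cabs_ge0//.
  by rewrite exprn_ile1 ?cabs_ge0// cabs_Dn_le1// cabsM Hom mul1r ltW.
have main : a * e0 <= cabs (t k).
  rewrite /t cg ler_wpM2l// /e0 ler_pM ?expR_ge0 ?exprn_ge0//.
    rewrite zx; apply: le_trans (exprn_ge_expR _ x0 x1); rewrite ler_expR lerN2.
    by rewrite -/y; clear -xy; lra.
  by apply: lerXn2r; rewrite ?nnegrE ?cabs_ge0.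
have low : cabs (\sum_(0 <= j < k) t j) <= a * (e0 / 4).
  apply: (le_trans (cabs_sum _ _ _)).
  apply: (@le_trans _ _ (\sum_(0 <= j < k) a * be ^+ (k - j))).
    rewrite !big_nat; apply: ler_sum => j /andP[_ jk].
    apply: (le_trans (ct j)); apply: (@le_trans _ _ (lacunary_coef tau gam B j)).
      by rewrite ler_piMr// exprn_ile1//; clear -x0 x1; lra.
    have := lacunary_coef_below gam j (k - j) t0 B0.
    by rewrite subnKC ?(ltnW jk).
  rewrite -mulr_sumr ler_wpM2l// (le_trans (sum_below_le _ be0 _))//.
    by clear -be1 e01; lra.
  by clear -be1; lra.
have b0 : 0 <= B%:R^-1 :> R by rewrite invr_ge0.
have high : cabs (\sum_(k.+1 <= j < M) t j) <= a * (e0 / 4).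
  apply: (le_trans (cabs_sum _ _ _)).
  apply: (@le_trans _ _ (\sum_(k.+1 <= j < M) a * (K' * B%:R^-1 ^+ (j - k)))).
    rewrite !big_nat; apply: ler_sum => j /andP[kj _].
    apply: (le_trans (ct j)).
    have x1' : x <= 1 by clear -x1; lra.
    have := lacunary_coef_above (j - k) t0 g0 B0 HK (ltW K0) z1 x1'.
    by rewrite subnKC ?(ltnW kj).
  rewrite -mulr_sumr ler_wpM2l// -mulr_sumr.
  apply: (le_trans (ler_wpM2l K'0 (sum_above_le k M b0 Bh))).
  by clear -K1; lra.
have S : \sum_(0 <= j < M) t j = \sum_(0 <= j < k) t j + (t k + \sum_(k.+1 <= j < M) t j).
  by rewrite (@big_cat_nat _ _ _ k 0%N M)//= ?(ltnW kM)// (big_ltn kM).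
have h1 := cabs_lerB (\sum_(0 <= j < M) t j) (\sum_(0 <= j < M) t j - f z).
rewrite subKr cabsBC in h1.
have h2 := cabs_lerB (t k) (- \sum_(k.+1 <= j < M) t j).
rewrite opprK cabsN in h2.
have h3 := cabs_lerB (t k + \sum_(k.+1 <= j < M) t j) (- \sum_(0 <= j < k) t j).
rewrite opprK cabsN [X in _ <= cabs X]addrC -S in h3.
have {}HM : cabs (f z - \sum_(0 <= j < M) t j) <= a * (e0 / 4) by exact: HM.
rewrite [e0 / 4 * a]mulrC.
by clear -h1 h2 h3 HM low high main; lra.
Qed.

End LacunarySeries.

(** * Extremal estimates *)

Section ExtremalEstimates.
Variable R : realType.
Local Notation C := R[i].
Notation mu := (@lebesgue_measure R).
Local Notation RR := (measurableTypeR R * measurableTypeR R)%type.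
Implicit Types (f : C -> C).

(** With [T = B ^ k] and [del = 1 - |z|], the size of one lacunary term becomes the critical growth
    [del ^ -s] times a power of the weight. *)
Lemma wt_powRE (T del s : R) : 0 < T -> 0 < del ->
  T `^ s * (1 + T * del) `^ (- (2 * s)) = del `^ (- s) * wt (T * del) `^ s.
Proof.
move=> T0 d0; have y0 : 0 < 1 + T * del by rewrite ltr_pwDl// mulr_ge0 ?ltW.
rewrite /wt powRM ?mulr_ge0 ?invr_ge0 ?exprn_ge0 ?(ltW T0) ?(ltW d0) ?(ltW y0)//.
rewrite powRM ?(ltW T0) ?(ltW d0)//.
have -> : (((1 + T * del) ^+ 2)^-1) `^ s = (1 + T * del) `^ (- (2 * s)).
  rewrite -powR_inv1 ?exprn_ge0 ?(ltW y0)// -powRrM -(powR_mulrn 2) ?(ltW y0)// -powRrM.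
  by congr (_ `^ _); ring.
rewrite mulrA [del `^ (- s) * _]mulrCA -powRD; last by rewrite (gt_eqF d0) implybT.
by rewrite addNr powRr0 mulr1.
Qed.

Lemma Gamma_dist (t : R) (z : C) : Gamma (expi t) z ->
  [/\ 0 < 1 - cabs z, 1 - cabs z <= 1 & cabs (z - expi t) <= 2 * (1 - cabs z)].
Proof.
move=> [z1 z2]; rewrite cabs_1Bconj in z2; have z0 := cabs_ge0 z.
have z1' : cabs z < 1 by exact: z1.
split; [lra|lra|]; rewrite cabsBC (le_trans (ltW z2))//.
have -> : 1 - cabs z ^+ 2 = (1 - cabs z) * (1 + cabs z) by ring.
by rewrite mulrC ler_wpM2r; lra.
Qed.

(** By [powR_weighted_sum] the power [q] moves inside the sum at the price of half of the exponent
    of the weights. The other half makes the integral over the cone converge: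
    [|f| ^ q (1 - |z|) ^ alpha] leaves [(1 - |z|) ^ -2], which matches the area of the cone near its
    vertex, so that [dyadic_integral] applies with [m = 2]. *)
Lemma cone_area_upper (q alpha : R) (B : nat) : 0 < q -> -2 < alpha -> (1 < B)%N ->
  exists2 K : R, 0 <= K & forall f (t : R) (b : nat -> R), (forall k, 0 <= b k) ->
  (forall z, Gamma (expi t) z -> exists M, cabs (f z) <= \sum_(0 <= k < M) b k *
     ((B ^ k)%N%:R `^ ((alpha + 2) / q) *
      (1 + (B ^ k)%N%:R * (1 - cabs z)) `^ (- (2 * ((alpha + 2) / q))))) ->
  (cone_area f q alpha t <= K%:E * \sum_(0 <= k <oo) (b k `^ q)%:E)%E.
Proof.
move=> q0 al B1; set s := (alpha + 2) / q.
have s0 : 0 < s by rewrite divr_gt0//; lra.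
have s2 : 0 < s / 2 by rewrite divr_gt0.
have sq : s * q = alpha + 2 by rewrite /s divfK// gt_eqF.
have BR : 1 < B%:R :> R by rewrite ltr1n.
have B0 : 0 < B%:R :> R by rewrite (lt_trans ltr01).
pose W : R := wt_bound (B%:R `^ (s / 2)).
have W0 : 0 <= W.
  by apply: le_trans (sum_wt_powR (t := 1) 0 BR ltr01 s2); rewrite big_geq.
pose c : R := 2 `^ `|alpha| * W `^ q.
have c0 : 0 <= c by rewrite mulr_ge0 ?powR_ge0.
pose kap : R := s / 2 * q.
have kap0 : 0 < kap by rewrite mulr_gt0.
pose K' := 2 ^+ 2 * 4 `^ kap * 16 * wt_bound (2 `^ kap) : R.
have wb0 : 0 <= wt_bound (2 `^ kap) :> R.
  have b1 : 1 < 2 :> R by rewrite ltr1n.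
  by apply: le_trans (sum_wt_powR (t := 1) 0 b1 ltr01 kap0); rewrite big_geq.
have K'0 : 0 <= K' by apply: mulr_ge0.
exists (K' * c) => [|f t b b0 Hb]; first exact: mulr_ge0.
have D : (\int[mu \x mu]_(w in [set w : RR | Gamma (expi t) (Complex w.1 w.2)])
    (density f q alpha (Complex w.1 w.2))%:E <=
  (2 ^+ 2 * 4 `^ kap * 16 * wt_bound (2 `^ kap))%R%:E * \sum_(0 <= k <oo) (c * b k `^ q)%:E)%E.
  apply: (@dyadic_integral _ RR R (mu \x mu)%E _ (fun w => 1 - cabs (Complex w.1 w.2))
    (fun i => square (cos t) (sin t) (2 * (2^-1) ^+ i)) 16 B%:R kap 2%N (fun k => c * b k `^ q)) => //.
  - by move=> i; exact: measurable_square.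
  - move=> i; have <- : (mu \x mu)%E (square (cos t) (sin t) (2 * (2^-1) ^+ i)) =
        (16 * (2^-1) ^+ (i * 2))%:E.
      rewrite lebesgue_square ?mulr_gt0 ?exprn_gt0 ?invr_gt0//.
      by congr (_%:E); rewrite exprM exprMn; ring.
    exact: lexx.
  - by move=> w /Gamma_dist[-> ->].
  - move=> i w /Gamma_dist[d0 d1 d2] di; apply/squareP.
    have dw : cabs (Complex w.1 w.2 - expi t) <= 2 * 2^-1 ^+ i.
      by rewrite (le_trans d2)// ler_wpM2l.
    split; apply: le_trans dw.
      by have := Re_le_cabs (Complex w.1 w.2 - expi t).
    by have := Im_le_cabs (Complex w.1 w.2 - expi t).
  - by move=> k; rewrite mulr_ge0 ?powR_ge0.
  move=> w Gw; rewrite lee_fin density_ge0/=.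
  have [d0 d1 d2] := Gamma_dist Gw; have [M HM] := Hb _ Gw.
  set z := Complex w.1 w.2 in Gw d0 d1 d2 HM *; set del := 1 - cabs z in d0 d1 d2 HM *.
  have Bk k : 0 < (B ^ k)%N%:R :> R by rewrite ltr0n expn_gt0 (ltnW B1).
  pose wk k := wt (B%:R ^+ k * del) `^ (s / 2).
  have wk0 k : 0 <= wk k by exact: powR_ge0.
  have wt0 k : 0 <= wt (B%:R ^+ k * del) by rewrite wt_ge0// mulr_ge0 ?exprn_ge0 ?(ltW d0).
  apply: (@le_trans _ _ (\sum_(0 <= k < M) (c * b k `^ q * (del ^+ 2)^-1 *
      (wt (B%:R ^+ k * del)) `^ kap)%:E)%E); last first.
    apply: nneseries_lim_ge => k _ _.
    by rewrite lee_fin !mulr_ge0 ?powR_ge0 ?invr_ge0 ?exprn_ge0 ?(ltW d0).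
  rewrite sumEFin lee_fin.
  have E : \sum_(0 <= k < M) c * b k `^ q * (del ^+ 2)^-1 * (wt (B%:R ^+ k * del)) `^ kap =
      c * (del ^+ 2)^-1 * \sum_(0 <= k < M) (b k * wk k) `^ q.
    rewrite mulr_sumr; apply: eq_bigr => k _.
    by rewrite powRM// /wk -powRrM -/kap; ring.
  rewrite E /density.
  have h1 : cabs (f z) <= del `^ (- s) * \sum_(0 <= k < M) b k * wk k ^+ 2.
    rewrite (le_trans HM)// mulr_sumr le_eqVlt; apply/orP; left; apply/eqP.
    apply: eq_bigr => k _; rewrite wt_powRE// mulrCA; congr (_ * (_ * _)).
    rewrite natrX /wk -[RHS](powR_mulrn 2) ?powR_ge0// -powRrM.
    by congr (_ `^ _); field.
  have h2 : cabs (f z) `^ q <= del `^ (- (alpha + 2)) * (W `^ q * \sum_(0 <= k < M) (b k * wk k) `^ q).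
    apply: (@le_trans _ _ ((del `^ (- s) * \sum_(0 <= k < M) b k * wk k ^+ 2) `^ q)).
      rewrite ge0_ler_powR ?nnegrE ?(ltW q0) ?cabs_ge0//.
      by rewrite mulr_ge0 ?powR_ge0// sumr_ge0// => k _; rewrite mulr_ge0 ?exprn_ge0.
    rewrite powRM ?powR_ge0//; last by rewrite sumr_ge0// => k _; rewrite mulr_ge0 ?exprn_ge0.
    rewrite -powRrM mulNr sq ler_wpM2l ?powR_ge0//.
    apply: powR_weighted_sum => //; exact: sum_wt_powR.
  have h3 : (1 - cabs z ^+ 2) `^ alpha <= 2 `^ `|alpha| * del `^ alpha.
    have -> : 1 - cabs z ^+ 2 = (1 + cabs z) * del by rewrite /del; ring.
    have z0 := cabs_ge0 z.
    have z1 : 1 <= 1 + cabs z by rewrite lerDl.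
    rewrite powRM ?(ltW d0) ?addr_ge0// ler_wpM2r ?powR_ge0//.
    rewrite (le_trans (ler_powR z1 (ler_norm alpha)))//.
    by rewrite ge0_ler_powR ?nnegrE ?addr_ge0// -[leRHS]/(1 + 1) lerD2l -subr_ge0 ltW.
  apply: (le_trans (ler_pM _ _ h2 h3)); rewrite ?powR_ge0//.
  set S := \sum_(0 <= k < M) _ `^ q.
  rewrite le_eqVlt; apply/orP; left; apply/eqP.
  have -> : (del ^+ 2)^-1 = del `^ (- (alpha + 2)) * del `^ alpha.
    rewrite -powRD ?(gt_eqF d0) ?implybT// opprD addrAC addNr add0r powRN.
    by rewrite (powR_mulrn 2) ?(ltW d0).
  by rewrite /c; ring.
apply: (le_trans D); rewrite -/K' (EFinM K' c) -muleA.
apply: lee_wpmul2l; first by rewrite lee_fin.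
rewrite -nneseriesZl//; last by move=> k _; rewrite lee_fin powR_ge0.
Qed.

Lemma harmonic_unbounded (M : R) : exists n, M < \sum_(1 <= k < n) k.+1%:R^-1.
Proof.
apply: contrapT => H; apply: (@dvg_harmonic R).
have nd : nondecreasing_seq (series (@harmonic R)).
  by apply: nondecreasing_series => n *; rewrite /= invr_ge0.
apply: nondecreasing_is_cvgn => //; exists (1 + M) => _ [n _ <-].
apply: (@le_trans _ _ (series (@harmonic R) n.+1)); first exact: nd (leqnSn n).
rewrite /series/= big_ltn//= invr1 lerD2l leNgt; apply/negP => h; apply: H; by exists n.+1.
Qed.

(** The radial intervals [[1 - B ^ -k, 1 - B ^ -k / 2]] are disjoint as [B >= 4], and on the [k]-th
    one the arc of length [ell k] from [a k] alone contributes at least a multiple of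
    [1 / (k + 1)]. *)
Lemma mixed_norm_infinite f (u v beta c : R) (B : nat) (A ell a : nat -> R) :
  0 < u -> 0 < v -> 0 < c -> (4 <= B)%N ->
  (forall k, 0 <= A k) -> (forall k, 0 <= ell k) -> (forall k, 0 <= a k) ->
  (forall k, a k + ell k <= 2 * pi) ->
  (forall k r t, (0 < k)%N -> ((B ^ k)%N%:R)^-1 / 2 <= 1 - r -> 1 - r <= ((B ^ k)%N%:R)^-1 ->
     a k <= t -> t <= a k + ell k -> A k <= cabs (f (r%:C%C * expi t))) ->
  (forall k, (0 < k)%N -> c <= k.+1%:R * (ell k `^ u^-1 * A k * (B ^ k)%N%:R `^ (- beta)) `^ v) ->
  ~ (mixed_norm u v beta f < +oo)%E.
Proof.
move=> u0 v0 c0 B4 A0 l0 a0 al HA Hc.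
rewrite /mixed_norm => /(lty_poweRy _)-/(_ (ltac:(by rewrite invr_eq0 gt_eqF))).
set I := (\int[mu]_(r in _) _)%E => Ifin.
have Bk k : 0 < (B ^ k)%N%:R :> R by rewrite ltr0n expn_gt0 (leq_trans _ B4).
have BkV k : 0 < ((B ^ k)%N%:R)^-1 :> R by rewrite invr_gt0.
pose e := beta * v - 1.
pose cc : R := ((2 * pi)^-1) `^ (v / u) * 4 `^ (- `|e|).
have pi0 : 0 < (2 * pi)^-1 :> R by rewrite invr_gt0 mulr_gt0 ?pi_gt0.
have cc0 : 0 < cc by rewrite mulr_gt0 ?powR_gt0.
pose h k := cc * (ell k `^ u^-1 * A k) `^ v * (B ^ k)%N%:R `^ (- e).
have h0 k : 0 <= h k by rewrite !mulr_ge0 ?powR_ge0 ?(ltW cc0).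
pose J k : set (measurableTypeR R) := `[1 - ((B ^ k)%N%:R)^-1, 1 - ((B ^ k)%N%:R)^-1 / 2]%classic.
have JP k r : J k r -> ((B ^ k)%N%:R)^-1 / 2 <= 1 - r /\ 1 - r <= ((B ^ k)%N%:R)^-1.
  by rewrite /J /= in_itv/= => /andP[? ?]; split; lra.
pose G r := (integral_mean u r f `^ v * ((1 - r) `^ e)%R%:E)%E.
have G0 r : (0 <= G r)%E by rewrite mule_ge0 ?poweR_ge0// lee_fin powR_ge0.
have hG k r : (0 < k)%N -> J k r -> ((h k)%:E <= G r)%E.
  move=> k0 /JP[r1 r2].
  have C1 : ((ell k * A k `^ u)%:E <= circle_integral (fun xi => (cabs (f (r%:C%C * xi)) `^ u)%:E))%E.
    apply: (@le_trans _ _ (\int[mu]_(t in `[a k, (a k + ell k)%R]) (A k `^ u)%:E)%E).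
      rewrite integral_cst//= lebesgue_measure_itv/= lte_fin -EFinD [(a k + _ - _)%R]addrAC subrr add0r.
      case: ifPn => [_|]; first by rewrite -EFinM mulrC.
      rewrite -leNgt gerDl => h1; have -> : ell k = 0 by apply/le_anti; rewrite h1 l0.
      by rewrite mul0r mule0.
    apply: ge0_le_integral_sub => t /=; rewrite ?in_itv/=; last 2 first.
    - by rewrite lee_fin powR_ge0.
    - by rewrite lee_fin powR_ge0.
    move=> /andP[t1 t2]; split.
      by apply/andP; split; [exact: le_trans t1|exact: le_trans (al k)].
    by rewrite lee_fin ge0_ler_powR ?nnegrE ?(ltW u0) ?cabs_ge0// (HA k).
  have vu0 : 0 < v / u by rewrite divr_gt0.
  apply: (@le_trans _ _ ((((2 * pi)^-1 * (ell k * A k `^ u)) `^ (v / u))%:E * ((1 - r) `^ e)%:E)%E).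
    rewrite -EFinM lee_fin /h powRM ?mulr_ge0 ?powR_ge0 ?(ltW pi0)// powRM ?mulr_ge0 ?powR_ge0 ?(ltW pi0)//.
    rewrite powRM ?powR_ge0 ?(ltW pi0)// -powRrM -powRrM.
    have -> : u^-1 * v = v / u by rewrite mulrC.
    have -> : u * (v / u) = v by rewrite mulrC divfK ?gt_eqF.
    have w1 : 4^-1 <= (B ^ k)%N%:R * (1 - r).
      by move: r1; rewrite -(ler_pM2l (Bk k)) mulrA mulfV ?gt_eqF// => r1; clear -r1; lra.
    have w2 : (B ^ k)%N%:R * (1 - r) <= 4.
      by move: r2; rewrite -(ler_pM2l (Bk k)) mulfV ?gt_eqF// => r2; clear -r2; lra.
    have r0 : 0 < 1 - r by apply: lt_le_trans r1; rewrite divr_gt0.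
    have := powR_window e w1 w2; rewrite powRM ?(ltW (Bk k)) ?(ltW r0)// => w3.
    have w4 : 4 `^ (- `|e|) * (B ^ k)%N%:R `^ (- e) <= (1 - r) `^ e.
      by rewrite powRN ler_pdivrMr ?powR_gt0// mulrC.
    rewrite /cc; set X := _ `^ (v / u); set Y := ell k `^ _; set Z := A k `^ v.
    have -> : X * 4 `^ (- `|e|) * (Y * Z) * (B ^ k)%N%:R `^ (- e) =
      X * (Y * Z) * (4 `^ (- `|e|) * (B ^ k)%N%:R `^ (- e)) by ring.
    by rewrite ler_wpM2l// !mulr_ge0 ?powR_ge0.
  apply: lee_wpmul2r; first by rewrite lee_fin powR_ge0.
  rewrite /integral_mean -poweRrM [u^-1 * v]mulrC -poweR_EFin.
  have c1 : (((2 * pi)^-1 * (ell k * A k `^ u))%:E <= ((2 * pi)^-1)%:E *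
      circle_integral (fun xi => (cabs (f (r%:C%C * xi)) `^ u)%:E))%E.
    by rewrite EFinM lee_wpmul2l// lee_fin ltW.
  have c2 : 0 <= (2 * pi)^-1 * (ell k * A k `^ u) by rewrite !mulr_ge0 ?powR_ge0 ?(ltW pi0).
  apply: gt0_ler_poweR c1; rewrite ?(ltW vu0)// in_itv/= leey andbT ?lee_fin//.
  rewrite mule_ge0 ?lee_fin ?(ltW pi0)//.
  by apply: integral_ge0 => t _; rewrite lee_fin powR_ge0.
have disj j k r : (j < k)%N -> J j r -> J k r -> False.
  move=> jk /JP[j1 _] /JP[_ k2].
  have h1 : ((B ^ k)%N%:R)^-1 <= ((B ^ j)%N%:R)^-1 * 4^-1 :> R.
    rewrite -invfM lef_pV2 ?posrE ?mulr_gt0//.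
    rewrite -natrM ler_nat (leq_trans (_ : _ <= B ^ j * B)%N) ?leq_mul//.
    by rewrite -expnSr leq_exp2l// (leq_trans _ B4).
  have h2 := BkV k; have h3 := BkV j; clear -h1 h2 h3 j1 k2; lra.
have J01 k r : (0 < k)%N -> J k r -> 0 < r < 1.
  move=> k0 /JP[r1 r2]; have := BkV k.
  have : ((B ^ k)%N%:R)^-1 <= 4^-1 :> R.
    rewrite lef_pV2 ?posrE// ler_nat (leq_trans B4)// -[X in (X <= _)%N]expn1.
    by rewrite leq_exp2l// (leq_trans _ B4).
  by move=> x1 x2; apply/andP; split; clear -r1 r2 x1 x2; lra.
pose D : set (measurableTypeR R) := `]0%R, 1%R[%classic.
have mD : measurable D by exact: measurable_itv.
have mJ k : measurable (J k) by exact: measurable_itv.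
have i0 k r : D r -> (0 <= (h k * \1_(J k) r)%:E)%E by rewrite lee_fin mulr_ge0.
have mi k : measurable_fun D (fun r => (h k * \1_(J k) r)%:E).
  by apply/measurable_EFinP; apply: measurable_funM => //; exact: measurable_indic.
have sumI n : (\sum_(1 <= k < n) (cc / 2 * c * k.+1%:R^-1)%:E <= I)%E.
  apply: (@le_trans _ _ (\int[mu]_(r in D) \sum_(1 <= k < n) (h k * \1_(J k) r)%:E)%E); last first.
    apply: ge0_le_integral_sub => r Dr; last 2 first.
    - by apply: sume_ge0 => k _; exact: (i0 k r Dr).
    - exact: G0.
    split => //; rewrite -/(G r) sumEFin.
    have [[k [k1 kn Jk]]|H] := pselect (exists k, [/\ (1 <= k)%N, (k < n)%N & J k r]).
      apply: le_trans (hG k r k1 Jk); rewrite lee_fin.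
      rewrite (bigD1_seq k) ?mem_index_iota ?k1 ?kn ?iota_uniq//= big1 ?addr0.
        by rewrite indicE mem_set// mulr1.
      move=> j jk; rewrite indicE memNset ?mulr0// => Jj.
      by have [jk'|kj|jk'] := ltngtP j k; [exact: disj jk' Jj Jk|exact: disj kj Jk Jj|rewrite jk' eqxx in jk].
    rewrite big_nat big1 ?G0// => k /andP[k1 kn].
    rewrite indicE memNset ?mulr0// => Jk; apply: H; by exists k.
  rewrite (ge0_integral_sum mu mD mi i0) !big_nat; apply: lee_sum => k /andP[k1 kn].
  have mj : measurable_fun D (fun t => (\1_(J k) t : R)%:E).
    by apply/measurable_EFinP; exact: measurable_indic.
  have j0 t : D t -> (0 <= (\1_(J k) t : R)%:E)%E by rewrite lee_fin.
  under eq_integral do rewrite EFinM.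
  rewrite (ge0_integralZl mu mD mj j0); last by rewrite lee_fin.
  rewrite integral_indic//.
  have -> : J k `&` D = J k.
    by apply/setIidPl => r /(J01 k r k1); rewrite /D /= in_itv.
  have muJ : mu (J k) = (((B ^ k)%N%:R)^-1 / 2)%:E.
    rewrite /J lebesgue_measure_itv/= lte_fin.
    have -> : 1 - ((B ^ k)%N%:R)^-1 < 1 - ((B ^ k)%N%:R)^-1 / 2 :> R by have := BkV k; lra.
    by rewrite -EFinD; congr (_%:E); lra.
  apply: (@le_trans _ _ ((h k)%:E * (((B ^ k)%N%:R)^-1 / 2)%:E)%E); last by rewrite -muJ; exact: lexx.
  rewrite -EFinM lee_fin.
  have := Hc k k1; rewrite powRM ?mulr_ge0 ?powR_ge0// -powRrM.
  have -> : (B ^ k)%N%:R `^ (- beta * v) = (B ^ k)%N%:R `^ (- e) * ((B ^ k)%N%:R)^-1 :> R.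
    rewrite -[X in _ = _ * X](powR_inv1 (ltW (Bk k))) -powRD ?(gt_eqF (Bk k)) ?implybT//.
    by congr (_ `^ _); rewrite /e; ring.
  rewrite mulrC -ler_pdivrMr ?ltr0n// => /(ler_wpM2l (ltW cc0)) h1.
  rewrite /h; move: h1; set X := (_ * A k) `^ v; set Y := _ `^ (- e); set Z := ((B ^ k)%N%:R)^-1.
  set Q := k.+1%:R^-1 => h1.
  by clear -h1; lra.
have [N NE] : exists N, I = N%:E.
  exists (fine I); rewrite fineK// ge0_fin_numE//.
  by apply: integral_ge0 => r _; exact: G0.
have [n] := harmonic_unbounded (N / (cc / 2 * c)).
have cc1 : 0 < cc / 2 * c by apply: mulr_gt0 => //; exact: divr_gt0.
rewrite (ltr_pdivrMr _ _ cc1) => Hn.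
by have := sumI n; rewrite NE sumEFin lee_fin -mulr_sumr mulrC leNgt Hn.
Qed.

End ExtremalEstimates.

(** * Functions violating the embedding *)

Section LacunaryExamples.
Variable R : realType.
Local Notation C := R[i].
Notation mu := (@lebesgue_measure R).
Implicit Types (f : C -> C).

Lemma sum_blocks (x y : nat -> R) M :
  (forall m, \sum_(2 ^ m <= k < 2 ^ m.+1) x k <= y m) ->
  \sum_(1 <= k < 2 ^ M) x k <= \sum_(0 <= m < M) y m.
Proof.
move=> H; elim: M => [|M IH]; first by rewrite !big_geq.
rewrite big_nat_recr//= (@big_cat_nat _ _ _ (2 ^ M)%N)//=; first exact: lerD.
- by rewrite expn_gt0.
- by rewrite leq_exp2l.
Qed.

Lemma sum_le_blocks (x y : nat -> R) (S : R) :
  (forall k, 0 <= x k) -> (forall m, \sum_(2 ^ m <= k < 2 ^ m.+1) x k <= y m) ->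
  (forall M, \sum_(0 <= m < M) y m <= S) -> forall n, \sum_(0 <= k < n) x k <= x 0%N + S.
Proof.
move=> x0 H HS n; apply: (@le_trans _ _ (\sum_(0 <= k < 2 ^ n) x k)).
  rewrite [leRHS](@big_cat_nat _ _ _ n)//= ?(ltnW (ltn_expl n _))//.
  by rewrite lerDl sumr_ge0.
rewrite big_ltn ?expn_gt0// lerD2l (le_trans (sum_blocks n H))//.
Qed.

(** Cauchy condensation: the block [2 ^ m <= k < 2 ^ (m + 1)] contributes at most
    [(2 ^ (1 - s)) ^ m]. *)
Lemma sum_powRN (s : R) : 1 < s -> exists2 S : R, 0 <= S &
  forall n, \sum_(0 <= k < n) k.+1%:R `^ (- s) <= S.
Proof.
move=> s1; pose r : R := 2 `^ (1 - s).
have r0 : 0 <= r by exact: powR_ge0.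
have r1 : r < 1 by rewrite powR2_lt1// subr_lt0.
exists (1 + (1 - r)^-1) => [|n]; first by rewrite addr_ge0// invr_ge0 subr_ge0 ltW.
have -> : 1 + (1 - r)^-1 = 0.+1%:R `^ (- s) + (1 - r)^-1 by rewrite powR1.
apply: (sum_le_blocks (x := fun k => k.+1%:R `^ (- s)) (y := fun m => r ^+ m)).
- by move=> k; exact: powR_ge0.
- move=> m; have T0 : 0 < (2 ^ m)%N%:R :> R by rewrite ltr0n expn_gt0.
  apply: (@le_trans _ _ (\sum_(2 ^ m <= k < 2 ^ m.+1) ((2 ^ m)%N%:R `^ (- s)))).
    rewrite !big_nat; apply: ler_sum => k /andP[mk _].
    rewrite !powRN lef_pV2 ?posrE ?powR_gt0//.
    by rewrite ge0_ler_powR ?nnegrE// ?ler_nat ?(leq_trans mk)//; lra.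
  rewrite sumr_const_nat expnS mul2n -addnn addnK -[leLHS]mulr_natl.
  rewrite /r powR_exprn// -natrX powRB ?powRr1 ?(ltW T0)//; last by rewrite (gt_eqF T0) implybT.
  by rewrite powRN.
- by move=> M; exact: sum_expr_le.
Qed.

Lemma exprn_ge_linear (b : R) : 1 < b -> exists2 c : R, 0 < c &
  forall k, c * k.+1%:R <= b ^+ k.
Proof.
move=> b1; exists (Num.min 1 (b - 1)); first by rewrite lt_min ltr01 subr_gt0.
set c := Num.min _ _; have c1 : c <= 1 by rewrite /c ge_min lexx.
have c2 : c <= b - 1 by rewrite /c ge_min lexx orbT.
elim=> [|k IH]; first by rewrite mulr1 expr0.
have bk : 1 <= b ^+ k by rewrite exprn_ege1// ltW.
rewrite -natr1 mulrDr mulr1 exprS.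
have : (b - 1) * 1 <= (b - 1) * b ^+ k by rewrite ler_wpM2l// subr_ge0 ltW.
lra.
Qed.

(** This treats the critical case, where [tau v <= 1] decides, together with the supercritical one,
    where [B ^ (k eps)] outgrows every power of [k + 1]. *)
Lemma lacunary_growth (tau eps v : R) (B : nat) : 0 <= tau -> 0 < v -> (1 < B)%N ->
  eps = 0 /\ tau * v <= 1 \/ 0 < eps ->
  exists2 c : R, 0 < c & forall k, c <= k.+1%:R * (k.+1%:R `^ (- tau) * (B ^ k)%N%:R `^ eps) `^ v.
Proof.
move=> t0 v0 B1 [[-> tv]|e0].
  exists 1 => // k; rewrite powRr0 mulr1 -powRrM.
  have k1 : 1 <= k.+1%:R :> R by rewrite ler1n.
  rewrite mulNr powRN ler_pdivlMr ?powR_gt0// mul1r.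
  by apply: le_trans (ler_powR k1 tv) _; rewrite powRr1.
have BR : 1 < B%:R :> R by rewrite ltr1n.
have t1 : 0 < tau + 1 by rewrite ltr_wpDl.
(* The root is such that [B ^ (k eps) = (b ^ k) ^ (tau + 1)], with [b ^ k] growing at least linearly
   in [k]. *)
pose b : R := B%:R `^ (eps / (tau + 1)).
have b1 : 1 < b.
  by rewrite powR_gt1// divr_gt0.
have [c c0 Hc] := exprn_ge_linear b1.
exists ((c `^ (tau + 1)) `^ v) => [|k]; first by rewrite !powR_gt0.
have k1 : 1 <= k.+1%:R :> R by rewrite ler1n.
have k0 : 0 < k.+1%:R :> R by rewrite ltr0n.
have h : c `^ (tau + 1) <= k.+1%:R `^ (- tau) * (B ^ k)%N%:R `^ eps.
  have -> : (B ^ k)%N%:R `^ eps = (b ^+ k) `^ (tau + 1).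
    rewrite /b powR_exprn// -powRrM natrX; congr (_ `^ _); field.
    by rewrite gt_eqF.
  rewrite mulrC powRN ler_pdivlMr ?powR_gt0//.
  apply: (@le_trans _ _ ((c * k.+1%:R) `^ (tau + 1))).
    rewrite powRM ?(ltW c0)// ler_wpM2l ?powR_ge0// ler_powR//.
    by rewrite lerDl.
  by rewrite ge0_ler_powR ?nnegrE ?(ltW t1) ?mulr_ge0 ?(ltW c0) ?exprn_ge0 ?powR_ge0.
rewrite -[leLHS]mul1r ler_pM ?powR_ge0//.
by rewrite ge0_ler_powR ?nnegrE ?(ltW v0) ?powR_ge0 ?mulr_ge0 ?powR_ge0.
Qed.

Lemma Dn1 (z : C) : Dn 1 z = 1.
Proof. by rewrite /Dn big_nat1 expr0 invr1 mulr1. Qed.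

Lemma Dn_at1 n : (0 < n)%N -> Dn n (1 : C) = 1.
Proof.
move=> n0; rewrite /Dn; under eq_bigr do rewrite expr1n.
rewrite sumr_const_nat subn0 mulVf// pnatr_eq0 -lt0n//.
Qed.

Lemma Dn_exprn_lip n N (om z w : C) : (0 < n)%N -> cabs om = 1 -> cabs z <= 1 -> cabs w <= 1 ->
  cabs (Dn n (om * w)) ^+ N <= cabs (Dn n (om * z)) ^+ N + N%:R * n%:R * cabs (w - z).
Proof.
move=> n0 o1 z1 w1; have t1 := tame_Dn n0 ltr01 (lexx 1) o1.
have d0 : 0 <= n%:R / 1 :> R by rewrite divr_ge0.
have [g' Hg] := tameX N ler01 d0 t1.
have [_ + _ _] := Hg z w z1 w1; rewrite expr1n mul1r divr1.
set x := _ ^+ N; set y := _ ^+ N => h.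
have := le_trans (cabs_lerB x y) h; rewrite !cabsX lerBlDl; exact.
Qed.

Lemma Dn_near1 n (x : C) : (0 < n)%N -> cabs x <= 1 -> n%:R * cabs (1 - x) <= 2^-1 ->
  2^-1 <= cabs (Dn n x).
Proof.
move=> n0 x1 h; have c1 : cabs (1 : C) <= 1 by rewrite cabs1.
have := Dn_exprn_lip 1 n0 (@cabs1 R) x1 c1; rewrite !mul1r !expr1 Dn_at1// cabs1; lra.
Qed.

Lemma cabs_1B_polar (a r t : R) : 0 <= r -> r <= 1 ->
  cabs (1 - expi (- a) * (r%:C%C * expi t)) <= (1 - r) + `|t - a|.
Proof.
move=> r0 r1; have -> : expi (- a) * (r%:C%C * expi t) = r%:C%C * expi (t - a).
  by rewrite mulrCA -expiD addrC.
have := cabs_dist 1 (expi (t - a)) (r%:C%C * expi (t - a)).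
have -> : expi (t - a) - r%:C%C * expi (t - a) = (1 - r)%:C%C * expi (t - a).
  by rewrite (rmorphB (real_complex R)) rmorph1 mulrBl mul1r.
rewrite cabsM cabs_real cabs_expi mulr1 ger0_norm ?subr_ge0// => h.
have := cabs_expiB 0 (t - a); rewrite expi0 sub0r normrN; lra.
Qed.

Lemma lacunary_not_mixed f (u v beta tau gam c c1 : R) (B : nat) (n : nat -> nat)
    (om : nat -> C) (ell a : nat -> R) :
  0 < u -> 0 < v -> 0 < c -> 0 < c1 -> (4 <= B)%N ->
  (forall k z, (0 < k)%N -> ((B ^ k)%N%:R)^-1 / 2 <= 1 - cabs z -> 1 - cabs z <= ((B ^ k)%N%:R)^-1 ->
      2^-1 <= cabs (Dn (n k) (om k * z)) -> c * lacunary_coef tau gam B k <= cabs (f z)) ->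
  (forall k, 0 <= ell k) -> (forall k, 0 <= a k) -> (forall k, a k + ell k <= 2 * pi) ->
  (forall k r t, (0 < k)%N -> 0 <= r -> r <= 1 -> 1 - r <= ((B ^ k)%N%:R)^-1 ->
     a k <= t -> t <= a k + ell k -> 2^-1 <= cabs (Dn (n k) (om k * (r%:C%C * expi t)))) ->
  (forall k, (0 < k)%N -> c1 <= k.+1%:R *
     (ell k `^ u^-1 * (k.+1%:R `^ (- tau) * (B ^ k)%N%:R `^ (gam - beta))) `^ v) ->
  ~ (mixed_norm u v beta f < +oo)%E.
Proof.
move=> u0 v0 c0 c10 B4 low l0 a0 al HD Hc.
have Bk k : 0 < (B ^ k)%N%:R :> R by rewrite ltr0n expn_gt0 (leq_trans _ B4).
apply: (@mixed_norm_infinite R f u v beta (c1 * c `^ v) B (fun k => c * lacunary_coef tau gam B k) ell a) => //.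
- by rewrite mulr_gt0 ?powR_gt0.
- by move=> k; rewrite mulr_ge0 ?lacunary_coef_ge0 ?(ltW c0).
- move=> k r t k0 r1 r2 t1 t2.
  have b1 : ((B ^ k)%N%:R)^-1 <= 1 :> R.
    by rewrite invf_le1// ler1n expn_gt0 (leq_trans _ B4).
  have rr0 : 0 <= r by clear -r2 b1; lra.
  have rr1 : r <= 1.
    have : 0 <= ((B ^ k)%N%:R)^-1 / 2 :> R by rewrite divr_ge0// invr_ge0.
    by clear -r1; lra.
  by apply: low; rewrite ?cabs_polar//; exact: HD.
move=> k k0; have := ler_wpM2r (powR_ge0 c v) (Hc k k0) => /le_trans; apply.
rewrite -[leLHS]mulrA -powRM ?mulr_ge0 ?powR_ge0 ?(ltW c0)// le_eqVlt; apply/orP; left; apply/eqP.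
congr (_ * _ `^ v); rewrite /lacunary_coef powRD; last by rewrite (gt_eqF (Bk k)) implybT.
by ring.
Qed.

Lemma AT_of_cone_bound f (p q alpha M : R) : 0 < p -> 0 < q -> analytic_on_disk f ->
  (forall t, (cone_area f q alpha t <= M%:E)%E) -> AT p q alpha f.
Proof.
move=> p0 q0 fa H; split => //; rewrite AT_normpE.
have pq0 : 0 < p / q by rewrite divr_gt0.
have M0 : 0 <= M by rewrite -lee_fin (le_trans _ (H 0))// cone_area_ge0.
apply: (@le_lt_trans _ _ (\int[mu]_(t in `[0%R, (2 * pi)%R]) (M `^ (p / q))%:E)%E).
  apply: ge0_le_integral_sub => t ht; last 2 first.
  - exact: poweR_ge0.
  - by rewrite lee_fin powR_ge0.
  split => //; rewrite -poweR_EFin; apply: gt0_ler_poweR (H t); rewrite ?(ltW pq0)//.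
    by rewrite in_itv/= leey cone_area_ge0.
  by rewrite in_itv/= leey lee_fin M0.
rewrite integral_cst//= lebesgue_measure_itv/= lte_fin mulr_gt0 ?pi_gt0//.
by rewrite -EFinD -EFinM ltry.
Qed.

(** With [n = 1] and [N = 0] the averages are 1. At the critical growth [gam = (alpha + 2) / q] the
    cone integral is [O (sum_k (k + 1) ^ (- tau q))], uniformly on the circle. *)
Lemma counterexample_constant (p q u v alpha beta tau : R) :
  0 < p -> 0 < q -> 0 < u -> 0 < v -> -2 < alpha -> 0 <= tau -> 1 < tau * q ->
  (alpha + 2) / q = beta /\ tau * v <= 1 \/ beta < (alpha + 2) / q ->
  exists2 f, AT p q alpha f & ~ (mixed_norm u v beta f < +oo)%E.
Proof.
move=> p0 q0 u0 v0 al t0 tq cond; set s := (alpha + 2) / q.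
have s0 : 0 < s by rewrite divr_gt0//; lra.
have [B [c c0 [B4 H]]] := lacunary_function 0 t0 s0.
have B1 : (1 < B)%N by exact: leq_trans B4.
have [||f [fa up low]] := H (fun=> 1%N) (fun=> 1); first by move=> k; rewrite expn_gt0 (ltnW B1).
  by move=> k; exact: cabs1.
exists f; last first.
  have cond' : s - beta = 0 /\ tau * v <= 1 \/ 0 < s - beta.
    by case: cond => [[<- ?]|?]; [left; rewrite subrr|right; rewrite subr_gt0].
  have [c1 c10 Hc1] := lacunary_growth t0 v0 B1 cond'.
  have pi0 : 0 < 2 * pi :> R by rewrite mulr_gt0 ?pi_gt0.
  apply: (@lacunary_not_mixed f u v beta tau s c (((2 * pi) `^ u^-1) `^ v * c1) B (fun=> 1%N)
    (fun=> 1) (fun=> 2 * pi) (fun=> 0)) => //.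
  - by rewrite mulr_gt0 ?powR_gt0.
  - by move=> k; exact: ltW.
  - by move=> k; rewrite add0r.
  - by move=> k r t _ _ _ _ _ _; rewrite Dn1 cabs1; lra.
  by move=> k _; rewrite [X in _ <= _ * X]powRM ?mulr_ge0 ?powR_ge0// [leRHS]mulrCA ler_wpM2l ?powR_ge0.
have m0 : 0 < 2 * s by rewrite mulr_gt0.
have [K K0 HK] := exprn_powR m0.
have [L L0 HL] := cone_area_upper q0 al B1.
have [S S0 HS] := sum_powRN tq.
apply: (AT_of_cone_bound (M := L * ((2 * K) `^ q * S)) p0 q0 fa) => t.
pose b k : R := 2 * K * k.+1%:R `^ (- tau).
have b0 k : 0 <= b k by rewrite mulr_ge0 ?powR_ge0// mulr_ge0 ?(ltW K0).
have := HL f t b b0 => /(_ _)/le_trans; apply; last first.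
  rewrite EFinM lee_wpmul2l ?lee_fin//; apply: nneseries_EFin_le => [k|n]; first exact: powR_ge0.
  rewrite (eq_bigr (fun k => (2 * K) `^ q * k.+1%:R `^ (- (tau * q)))); last first.
    by move=> k _; rewrite /b powRM ?powR_ge0 ?mulr_ge0 ?(ltW K0)// -powRrM mulNr.
  by rewrite -mulr_sumr ler_wpM2l ?powR_ge0.
move=> z /Gamma_dist[d0 d1 _].
have z1 : cabs z < 1 by rewrite -subr_gt0.
have [M HM] := up z z1; exists M; apply: (le_trans HM); rewrite mulr_sumr; apply: ler_sum => k _.
rewrite expr0 mulr1 /lacunary_coef /b -/s.
have := HK (B ^ k)%N (1 - cabs z) (ltW d0) d1; rewrite subKr => h.
have h2 : 0 <= 2 * (k.+1%:R `^ (- tau) * (B ^ k)%N%:R `^ s) by rewrite !mulr_ge0 ?powR_ge0.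
have := ler_wpM2l h2 h; rewrite !mulrA => /le_trans; apply.
by rewrite le_eqVlt; apply/orP; left; apply/eqP; ring.
Qed.

End LacunaryExamples.

(** * Functions that rotate around the circle *)

Section RotatingExample.
Variable R : realType.
Local Notation C := R[i].
Notation mu := (@lebesgue_measure R).
Implicit Types (f : C -> C).

Lemma sum_shift n (F : nat -> R) : \sum_(n <= j < n + n) F j = \sum_(0 <= j < n) F (j + n)%N.
Proof. by rewrite -{1}[n]add0n big_addn addnK. Qed.

Lemma sum_exprn_double n (x : C) :
  \sum_(0 <= l < n.*2) x ^+ l = (1 + x) * \sum_(0 <= l < n) (x ^+ 2) ^+ l.
Proof.
elim: n => [|n IH]; first by rewrite !big_geq// mulr0.
rewrite doubleS !big_nat_recr//= IH mulrDr -addrA; congr (_ + _).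
by rewrite -exprM mul2n exprS; ring.
Qed.

Lemma Dn_double n (x : C) : Dn n.*2 x = (1 + x) / 2 * Dn n (x ^+ 2).
Proof. by rewrite /Dn sum_exprn_double -mul2n natrM invfM; ring. Qed.

Lemma parallelogram1 (x : C) : cabs (1 + x) ^+ 2 + cabs (1 - x) ^+ 2 = 2 + 2 * cabs x ^+ 2.
Proof.
case: x => a b; have -> : 1 + Complex a b = Complex (1 + a) b by simpc.
have -> : 1 - Complex a b = Complex (1 - a) (- b) by simpc.
by rewrite !cabs_sqr; ring.
Qed.

Lemma expiDpi (t : R) : expi (t - pi) = - expi t.
Proof. by rewrite expiD {2}/expi cosN sinN cospi sinpi oppr0; simpc. Qed.

(* Parseval on the group of [2^m]-th roots of unity. *)
Lemma sum_Dn_sq m (w : C) : cabs w <= 1 -> \sum_(0 <= j < 2 ^ m)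
  cabs (Dn (2 ^ m) (expi (- (2 * pi * j%:R / (2 ^ m)%N%:R)) * w)) ^+ 2 <= 1.
Proof.
elim: m w => [|m IH] w w1.
  by rewrite expn0 big_nat1 Dn1 cabs1 expr1n.
set n := (2 ^ m)%N in IH *; have n0 : (0 < n)%N by rewrite expn_gt0.
have nR : n%:R != 0 :> R by rewrite pnatr_eq0 -lt0n.
have -> : (2 ^ m.+1 = n + n)%N by rewrite expnS mul2n addnn.
rewrite (@big_cat_nat _ _ _ n)//= ?leq_addr// sum_shift -big_split/=.
have w2 : cabs (w ^+ 2) <= 1 by rewrite cabsX exprn_ile1 ?cabs_ge0.
apply: le_trans (IH _ w2); apply: ler_sum => j _.
set th : R := 2 * pi * j%:R / (n + n)%:R.
(* The index [j + n] rotates by a further [pi] and replaces [x] by [- x]. The two terms share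
   [Dn n (x ^ 2)], and the parallelogram law bounds [|(1 + x) / 2| ^ 2 + |(1 - x) / 2| ^ 2] by 1. *)
have -> : 2 * pi * (j + n)%:R / (n + n)%:R = th + pi :> R.
  rewrite /th !natrD; field; move: nR; set y := n%:R; move=> y0.
  by rewrite -mulr2n mulrn_eq0.
rewrite opprD expiDpi mulNr; set x := expi (- th) * w.
have -> : expi (- (2 * pi * j%:R / n%:R)) * w ^+ 2 = x ^+ 2.
  rewrite /x exprMn [expi _ ^+ 2]expr2 -expiD; congr (expi _ * _).
  rewrite /th natrD; have nn : n%:R + n%:R != 0 :> R by rewrite -mulr2n mulrn_eq0.
  by field; rewrite ?nR ?nn.
rewrite addnn !Dn_double sqrrN; move: (Dn n (x ^+ 2)) => D.
rewrite !cabsM !exprMn -mulrDl ler_piMl ?exprn_ge0 ?cabs_ge0//.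
rewrite cabsV cabs_nat -mulrDl parallelogram1.
have x1 : cabs x ^+ 2 <= 1 by rewrite exprn_ile1 ?cabs_ge0// cabsM cabs_expi mul1r.
have -> : 2^-1 ^+ 2 = 4^-1 :> R by rewrite exprVn -natrX.
by rewrite ler_pdivrMr//; lra.
Qed.

Lemma powRD_le2 (a b q : R) : 0 <= a -> 0 <= b -> 0 <= q ->
  (a + b) `^ q <= 2 `^ q * (a `^ q + b `^ q).
Proof.
move=> a0 b0 q0; wlog ab : a b a0 b0 / a <= b => [H|].
  have [/H->//|/ltW ba] := leP a b.
  by rewrite addrC [X in _ * X]addrC; exact: H.
apply: (@le_trans _ _ ((2 * b) `^ q)).
  by rewrite ge0_ler_powR ?nnegrE ?addr_ge0 ?mulr_ge0//; lra.
by rewrite powRM// ler_wpM2l ?powR_ge0// lerDr powR_ge0.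
Qed.

Lemma exprn_powR_le_sq (d q : R) N : 0 <= d -> d <= 1 -> 2 <= N%:R * q ->
  (d ^+ N) `^ q <= d ^+ 2.
Proof.
move=> d0 d1 Nq; have [->|dn] := eqVneq d 0.
  case: N Nq => [|N Nq]; first by rewrite mul0r => h; lra.
  rewrite !expr0n /= powR0//; apply/eqP => q0; move: Nq; rewrite q0 mulr0; lra.
have dp : 0 < d by rewrite lt_def dn.
rewrite -(powR_mulrn N)// -powRrM -(powR_mulrn 2)//.
by apply: ger_powR => //; rewrite dp.
Qed.

(** For [k = 2 ^ m + j] with [j < 2 ^ m] this is [2 ^ m], and [block_index k] is [j]. At [k = 0] the
    conventions of [trunc_log] and of subtraction give size 1 and index 0. *)
Definition block_size (k : nat) : nat := 2 ^ trunc_log 2 k.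
Definition block_index (k : nat) : nat := k - block_size k.

Lemma block_size_gt0 k : (0 < block_size k)%N.
Proof. by rewrite expn_gt0. Qed.

Lemma block_size_le k : (block_size k <= k.+1)%N.
Proof.
case: k => [//|k]; rewrite /block_size.
by have /andP[h _] := @trunc_log_bounds 2 k.+1 isT isT; rewrite (leq_trans h).
Qed.

Lemma block_size_le_pow B k : (4 <= B)%N -> (0 < k)%N -> (block_size k * 4 <= B ^ k)%N.
Proof.
move=> B4; case: k => [//|k] _.
have /andP[h _] := @trunc_log_bounds 2 k.+1 isT isT.
rewrite expnSr leq_mul// (leq_trans h)//.
by rewrite ltn_expl// (leq_trans _ B4).
Qed.

Lemma block_index_lt k : (block_index k < block_size k)%N.
Proof.
rewrite /block_index /block_size; case: k => [//|k].
have /andP[h1 h2] := @trunc_log_bounds 2 k.+1 isT isT.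
by rewrite ltn_subLR// addnn -mul2n -expnS.
Qed.

Lemma block_shift m j : (j < 2 ^ m)%N ->
  block_size (j + 2 ^ m) = (2 ^ m)%N /\ block_index (j + 2 ^ m) = j.
Proof.
move=> jm; have E : block_size (j + 2 ^ m) = (2 ^ m)%N.
  rewrite /block_size (@trunc_log_eq 2 m)//.
  by rewrite leq_addl/= expnS mul2n -addnn ltn_add2r.
by split => //; rewrite /block_index E addnK.
Qed.

Definition block_rotation (k : nat) : R := 2 * pi * (block_index k)%:R / (block_size k)%:R.

(** As [N q >= 2], the [q]-th powers are at most squares. The block [2 ^ m <= k < 2 ^ (m + 1)] runs
    once through all rotations, so that Parseval bounds its contribution by [2 ^ (- m tau q)]. *)
Lemma sum_block_Dn (q tau : R) N (t : R) : 0 < tau -> 0 < q -> 2 <= N%:R * q ->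
  forall n, \sum_(0 <= k < n) (k.+1%:R `^ (- tau) *
    cabs (Dn (block_size k) (expi (- block_rotation k) * expi t)) ^+ N) `^ q <=
  1 + (1 - 2 `^ (- (tau * q)))^-1.
Proof.
move=> t0 q0 Nq n; pose d k := cabs (Dn (block_size k) (expi (- block_rotation k) * expi t)).
have d1 k : d k <= 1 by apply: cabs_Dn_le1; rewrite cabsM !cabs_expi mulr1.
have d0 k : 0 <= d k by exact: cabs_ge0.
have tq : 0 < tau * q by rewrite mulr_gt0.
pose x k := (k.+1%:R `^ (- tau) * d k ^+ N) `^ q.
have x0 k : 0 <= x k by exact: powR_ge0.
have x1 : x 0%N <= 1.
  rewrite /x powRN powR1 invr1 mul1r (le_trans (exprn_powR_le_sq (d0 _) (d1 _) Nq))//.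
  by rewrite exprn_ile1.
set r : R := 2 `^ (- (tau * q)).
have r1 : r < 1 by rewrite powR2_lt1// oppr_lt0.
apply: (@le_trans _ _ (x 0%N + (1 - r)^-1)); last by rewrite lerD2r.
apply: (sum_le_blocks x0 (y := fun m => r ^+ m)) => [m|M]; last first.
  by apply: sum_expr_le => //; exact: powR_ge0.
rewrite expnS mul2n -addnn sum_shift.
have T0 : 0 < (2 ^ m)%N%:R :> R by rewrite ltr0n expn_gt0.
have c1 : cabs (expi t) <= 1 by rewrite cabs_expi.
rewrite -[leRHS]mulr1 (le_trans _ (ler_wpM2l _ (sum_Dn_sq m c1))) ?exprn_ge0 ?powR_ge0//.
rewrite mulr_sumr !big_nat; apply: ler_sum => j /andP[_ jm].
have [E1 E2] := block_shift jm.
rewrite /x powRM ?powR_ge0 ?exprn_ge0// ler_pM ?powR_ge0//.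
  rewrite /r powR_exprn// -natrX -powRrM mulNr !powRN lef_pV2 ?posrE ?powR_gt0//.
  by rewrite ge0_ler_powR ?nnegrE ?(ltW tq)// ler_nat ltnW// ltnS leq_addl.
rewrite (le_trans (exprn_powR_le_sq (d0 _) (d1 _) Nq))//.
by rewrite /d /block_rotation E1 E2.
Qed.

(** At height [B ^ -k] the function is large on an arc whose length is at least a multiple of
    [1 / (k + 1)], and [tau = 1 / v - 1 / u] makes the [k]-th radial contribution comparable to
    [1 / (k + 1)] from below. The cone integrals stay bounded by [sum_block_Dn]. *)
Lemma counterexample_rotating (p q u v alpha : R) :
  0 < p -> 0 < q -> 0 < u -> 0 < v -> -2 < alpha -> v < u ->
  exists2 f, AT p q alpha f & ~ (mixed_norm u v ((alpha + 2) / q) f < +oo)%E.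
Proof.
move=> p0 q0 u0 v0 al vu; set s := (alpha + 2) / q.
have s0 : 0 < s by rewrite divr_gt0//; lra.
pose tau := v^-1 - u^-1.
have t0 : 0 < tau by rewrite subr_gt0 ltf_pV2 ?posrE.
pose N := Num.Def.archi_bound (2 / q).
have Nq : 2 <= N%:R * q.
  have Z0 : 0 <= 2 / q by rewrite divr_ge0// ltW.
  by rewrite -ler_pdivrMr//; exact/ltW/(archi_boundP Z0).
have [B [c c0 [B4 H]]] := lacunary_function N (ltW t0) s0.
have B1 : (1 < B)%N by exact: leq_trans B4.
have BkN k : (0 < B ^ k)%N by rewrite expn_gt0 (ltnW B1).
have Bk k : 0 < (B ^ k)%N%:R :> R by rewrite ltr0n.
have pow4 k : ((2 * 2) ^ k <= B ^ k)%N by case: k => [//|k]; rewrite leq_exp2r.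
have ns0 k : 0 < (block_size k)%:R :> R by rewrite ltr0n block_size_gt0.
have [||f [fa up low]] := H block_size (fun k => expi (- block_rotation k)).
- move=> k; rewrite block_size_gt0/=; case: k => [//|k].
  by rewrite (leq_trans _ (block_size_le_pow B4 (isT : 0 < k.+1)%N))// leq_pmulr.
- by move=> k; exact: cabs_expi.
have cn k : (0 < k)%N -> (block_size k)%:R * ((B ^ k)%N%:R)^-1 <= 4^-1 :> R.
  move=> k0; rewrite ler_pdivrMr// ler_pdivlMl// mulrC -natrM ler_nat.
  exact: block_size_le_pow.
exists f; last first.
  have pi2 : 2 <= pi :> R by exact: pi_ge2.
  apply: (@lacunary_not_mixed R f u v s tau s c ((4 `^ (- u^-1)) `^ v) B block_size
    (fun k => expi (- block_rotation k)) (fun k => (4 * (block_size k)%:R)^-1) block_rotation) => //.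
  - by move=> k; rewrite !mulr_ge0 ?invr_ge0 ?(ltW (ns0 k))//; lra.
  - move=> k; rewrite /block_rotation invfM.
    have h : (block_index k)%:R + 1 <= (block_size k)%:R :> R.
      by rewrite natr1 ler_nat block_index_lt.
    have -> : 2 * pi * (block_index k)%:R / (block_size k)%:R + 4^-1 * (block_size k)%:R^-1 =
      (2 * pi * (block_index k)%:R + 4^-1) / (block_size k)%:R :> R by rewrite [RHS]mulrDl.
    rewrite ler_pdivrMr//; have := ler_wpM2l (ltac:(lra) : 0 <= 2 * pi) h; lra.
  - move=> k r t k0 r0 r1 rB t1 t2; apply: Dn_near1.
    + exact: block_size_gt0.
    + by rewrite cabsM cabs_expi mul1r cabs_polar.
    have h1 := cabs_1B_polar (block_rotation k) t r0 r1.
    have h2 : `|t - block_rotation k| <= (4 * (block_size k)%:R)^-1.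
      by rewrite ger0_norm ?subr_ge0// lerBlDl.
    apply: (@le_trans _ _ ((block_size k)%:R * (((B ^ k)%N%:R)^-1 + (4 * (block_size k)%:R)^-1))).
      by rewrite ler_wpM2l ?(ltW (ns0 k))//; lra.
    rewrite mulrDr; have := cn k k0.
    have -> : (block_size k)%:R * (4 * (block_size k)%:R)^-1 = 4^-1 :> R.
      by field; rewrite gt_eqF.
    lra.
  move=> k k0; rewrite subrr powRr0 mulr1.
  have k1 : 0 < k.+1%:R :> R by rewrite ltr0n.
  have h : 4 `^ (- u^-1) * k.+1%:R `^ (- v^-1) <= (4 * (block_size k)%:R)^-1 `^ u^-1 * k.+1%:R `^ (- tau).
    have -> : - v^-1 = - u^-1 - tau by rewrite /tau; ring.
    rewrite powRD ?(gt_eqF k1) ?implybT// mulrA ler_wpM2r ?powR_ge0//.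
    rewrite -powRM// powRN -[leRHS]invrK lef_pV2 ?posrE ?invr_gt0 ?powR_gt0 ?invr_gt0 ?mulr_gt0//.
    have -> : ((4 * (block_size k)%:R)^-1 `^ u^-1)^-1 = (4 * (block_size k)%:R) `^ u^-1.
      rewrite -powRN -powR_inv1 ?mulr_ge0 ?(ltW (ns0 k))// -powRrM.
      by congr (_ `^ _); rewrite mulN1r opprK.
    rewrite ge0_ler_powR ?nnegrE ?invr_ge0 ?mulr_ge0 ?(ltW u0) ?(ltW (ns0 k)) ?(ltW k1)//.
    by rewrite ler_wpM2l// ler_nat block_size_le.
  have := ge0_ler_powR (ltW v0) _ _ h; rewrite !nnegrE !mulr_ge0 ?powR_ge0// => /(_ isT isT).
  move=> /(ler_wpM2l (ltW k1)); apply: le_trans.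
  rewrite powRM ?powR_ge0// -[(k.+1%:R `^ _) `^ _]powRrM mulNr mulVf ?gt_eqF//.
  by rewrite powR_inv1 ?(ltW k1)// mulrCA mulfV ?mulr1// gt_eqF.
(* One power more than the weight requires: it absorbs the factor [1 - |z|] in the error of
   replacing [z] by the vertex [expi t] inside [Dn]. *)
have m0 : 0 < 2 * s + 1 by clear -s0; lra.
have [K K0 HK] := exprn_powR m0.
have [L L0 HL] := cone_area_upper q0 al B1.
pose r2 : R := (2^-1) `^ q.
have r20 : 0 <= r2 by exact: powR_ge0.
have r21 : r2 < 1.
  by rewrite powR_lt1//; lra.
pose S := (2 * K) `^ q * (2 `^ q * ((1 + (1 - 2 `^ (- (tau * q)))^-1) + (2 * N%:R) `^ q * (1 - r2)^-1)).
apply: (AT_of_cone_bound (M := L * S) p0 q0 fa) => t.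
pose X k := cabs (Dn (block_size k) (expi (- block_rotation k) * expi t)) ^+ N.
have X0 k : 0 <= X k by rewrite exprn_ge0 ?cabs_ge0.
(* What remains of that error; it decays like [2 ^ -k] because [block_size k <= 2 ^ k] and
   [B >= 4]. *)
pose Y k : R := 2 * N%:R * ((block_size k)%:R / (B ^ k)%N%:R).
have Y0 k : 0 <= Y k by rewrite !mulr_ge0 ?invr_ge0 ?(ltW (ns0 k)) ?(ltW (Bk k)).
have kt0 k : 0 <= k.+1%:R `^ (- tau) :> R by exact: powR_ge0.
pose b k : R := 2 * K * (k.+1%:R `^ (- tau) * (X k + Y k)).
have K20 : 0 <= 2 * K by rewrite mulr_ge0// ltW.
have b0 k : 0 <= b k by rewrite mulr_ge0// mulr_ge0// addr_ge0.
have := HL f t b b0 => /(_ _)/le_trans; apply; last first.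
  rewrite EFinM lee_wpmul2l ?lee_fin//; apply: nneseries_EFin_le => [k|n]; first exact: powR_ge0.
  apply: (@le_trans _ _ (\sum_(0 <= k < n) (2 * K) `^ q * (2 `^ q *
      ((k.+1%:R `^ (- tau) * X k) `^ q + (2 * N%:R) `^ q * r2 ^+ k)))).
    apply: ler_sum => k _.
    have XY0 : 0 <= k.+1%:R `^ (- tau) * (X k + Y k) by apply: mulr_ge0 => //; exact: addr_ge0.
    rewrite /b (powRM _ K20 XY0) ler_wpM2l ?powR_ge0//.
    rewrite mulrDr (le_trans (powRD_le2 _ _ (ltW q0))) ?mulr_ge0// ler_wpM2l ?powR_ge0// lerD2l.
    have n2 : 0 <= 2 * N%:R :> R by rewrite mulr_ge0.
    rewrite /r2 powR_exprn ?invr_ge0// -powRM ?exprn_ge0 ?invr_ge0//.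
    rewrite ge0_ler_powR ?nnegrE ?(ltW q0) ?mulr_ge0 ?exprn_ge0 ?invr_ge0//.
    have h1 : k.+1%:R `^ (- tau) <= 1 :> R.
      rewrite powRN invf_le1 ?powR_gt0//.
      by have := @ler_powR _ k.+1%:R _ _ _ (ltW t0); rewrite powRr0; apply; rewrite ler1n.
    apply: (@le_trans _ _ (Y k)); first by rewrite ler_piMl.
    rewrite /Y ler_wpM2l// ler_pdivrMr// exprVn ler_pdivlMl ?exprn_gt0// -natrX -natrM ler_nat.
    apply: (@leq_trans (2 ^ k * 2 ^ k)); last by rewrite -expnMn pow4.
    by rewrite leq_mul// (leq_trans (block_size_le k))// ltn_expl.
  rewrite -!mulr_sumr /S ler_wpM2l ?powR_ge0// ler_wpM2l ?powR_ge0// big_split/=.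
  rewrite lerD//; first exact: sum_block_Dn.
  by rewrite -mulr_sumr ler_wpM2l ?powR_ge0// sum_expr_le.
move=> z /Gamma_dist[d0 d1 d2].
have z1 : cabs z < 1 by rewrite -subr_gt0.
have [M HM] := up z z1; exists M; apply: (le_trans HM); rewrite mulr_sumr; apply: ler_sum => k _.
rewrite -/s; set y : R := (B ^ k)%N%:R; set del := 1 - cabs z in d0 d1 d2 *.
have y0 : 0 < y by exact: Bk.
have hz : cabs z ^+ (B ^ k) <= K * (1 + y * del) `^ (- (2 * s + 1)).
  by have := HK (B ^ k)%N del (ltW d0) d1; rewrite subKr.
have E0 : 0 < 1 + y * del by rewrite ltr_pwDl// mulr_ge0 ?ltW.
have hD : cabs (Dn (block_size k) (expi (- block_rotation k) * z)) ^+ N <=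
    X k + N%:R * (block_size k)%:R * (2 * del).
  have e1 : cabs (expi t) <= 1 by rewrite cabs_expi.
  have := Dn_exprn_lip N (block_size_gt0 k) (cabs_expi (- block_rotation k)) e1 (ltW z1).
  by move=> /le_trans; apply; rewrite lerD2l ler_wpM2l// mulr_ge0// ltW.
rewrite /b /lacunary_coef -/y.
set P := (1 + y * del) `^ (- (2 * s)).
have PE : (1 + y * del) `^ (- (2 * s + 1)) = P * (1 + y * del)^-1.
  by rewrite opprD powRD ?(gt_eqF E0) ?implybT// powRN [X in _ * X]powRN powRr1 ?(ltW E0)// -powRN.
rewrite PE in hz.
have XY : (1 + y * del)^-1 * (X k + N%:R * (block_size k)%:R * (2 * del)) <= X k + Y k.
  rewrite mulrDr lerD//.
    by rewrite ler_piMl// invf_le1// lerDl mulr_ge0 ?ltW.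
  rewrite /Y -/y ler_pdivrMl//.
  have -> : (1 + y * del) * (2 * N%:R * ((block_size k)%:R / y)) =
    N%:R * (block_size k)%:R * (2 * del) + 2 * N%:R * (block_size k)%:R / y.
    by field; rewrite gt_eqF.
  by rewrite lerDl !mulr_ge0 ?invr_ge0 ?(ltW y0) ?(ltW (ns0 k)).
have P0 : 0 <= P by exact: powR_ge0.
have c20 : 0 <= 2 * (k.+1%:R `^ (- tau) * y `^ s) by rewrite !mulr_ge0 ?powR_ge0.
have hz0 : 0 <= cabs z ^+ (B ^ k) by rewrite exprn_ge0 ?cabs_ge0.
have hD0 : 0 <= cabs (Dn (block_size k) (expi (- block_rotation k) * z)) ^+ N.
  by rewrite exprn_ge0 ?cabs_ge0.
have := ler_wpM2l c20 (ler_pM hz0 hD0 hz hD); rewrite !mulrA => /le_trans; apply.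
have := ler_wpM2l (mulr_ge0 (mulr_ge0 c20 (ltW K0)) P0) XY.
move: (X k) (Y k) (k.+1%:R `^ (- tau)) (y `^ s) ((1 + y * del)^-1) => x1 x2 x3 x4 x5 h.
rewrite -subr_ge0 in h; rewrite -subr_ge0; apply: (le_trans h).
by rewrite le_eqVlt; apply/orP; left; apply/eqP; ring.
Qed.

End RotatingExample.

(** * Functions concentrated at the point 1 *)

Section BoundaryPointExample.
Variable R : realType.
Local Notation C := R[i].
Notation mu := (@lebesgue_measure R).
Implicit Types (f : C -> C).

(** With [y = x / 2]: [sin x = 2 sin y cos y >= 2 y (cos y) ^ 2 = y (1 + cos x) >= y], where
    [sin y >= y cos y] comes from the mean value theorem. *)
Lemma half_le_sin (x : R) : 0 <= x -> x <= pi / 2 -> x / 2 <= sin x.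
Proof.
move=> x0 x1; pose y := x / 2; have xE : x = y *+ 2 by rewrite -mulr_natr divfK.
have pi0 : 0 < pi :> R by exact: pi_gt0.
have y0 : 0 <= y by rewrite divr_ge0.
have y1 : y <= pi by rewrite /y; lra.
have cy : 0 <= cos y by apply: cos_ge0_pihalf; apply/andP; split; rewrite /y; lra.
have cx : 0 <= cos x by apply: cos_ge0_pihalf; apply/andP; split; lra.
have sy : y * cos y <= sin y.
  move: y0; rewrite le_eqVlt => /predU1P[<-|yp]; first by rewrite mul0r sin0.
  have [c] := @MVT_segment R sin cos 0 y (ltW yp) (fun y _ => is_derive_sin y)
    (continuous_subspaceT (@continuous_sin R)).
  rewrite in_itv/= sin0 !subr0 => /andP[c0 c1] ->.
  move: c1; rewrite le_eqVlt => /predU1P[->|c1]; first by rewrite mulrC.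
  have cI : c \in `[0, pi] by rewrite in_itv/= c0 (le_trans (ltW c1) y1).
  have yI : y \in `[0, pi] by rewrite in_itv/= (ltW yp) y1.
  by rewrite mulrC ler_wpM2r ?(ltW yp)// ltW// ltr_cos.
have -> : sin x = 2 * (cos y * sin y) by rewrite xE sin_mulr2n -mulr_natl.
have cc : cos y * cos y = (1 + cos x) / 2.
  by rewrite xE cos_mulr2n expr2 -mulr_natl; field.
have := ler_wpM2l cy sy; rewrite mulrCA cc.
have : 0 <= y * cos x by rewrite mulr_ge0.
rewrite -/y; lra.
Qed.

(** The chord is [2 sin (t / 2)]; a half-angle beyond [pi / 2] is reflected. *)
Lemma chord_ge (t : R) : 0 <= t -> t <= 2 * pi -> Num.min t (2 * pi - t) / 2 <= cabs (1 - expi t).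
Proof.
move=> t0 t1; pose h := t / 2; have tE : t = h *+ 2 by rewrite -mulr_natr divfK.
have pi0 : 0 < pi :> R by exact: pi_gt0.
have hs : Num.min t (2 * pi - t) / 4 <= sin h.
  have [h1|h1] := leP h (pi / 2).
    apply: le_trans (half_le_sin _ h1); last by rewrite divr_ge0.
    rewrite /h; have : Num.min t (2 * pi - t) <= t by rewrite ge_min lexx.
    lra.
  have -> : sin h = sin (pi - h) by rewrite sinB sinpi cospi; ring.
  apply: le_trans (half_le_sin _ _); rewrite /h; [|lra|move: h1; rewrite /h; lra].
  have : Num.min t (2 * pi - t) <= 2 * pi - t by rewrite ge_min lexx orbT.
  lra.
have m0 : 0 <= Num.min t (2 * pi - t) by rewrite le_min t0 subr_ge0.
have s0 : 0 <= sin h by apply: le_trans hs; rewrite divr_ge0.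
have -> : cabs (1 - expi t) = 2 * sin h.
  apply/eqP; rewrite -(@eqrXn2 _ 2)// ?cabs_ge0 ?mulr_ge0//.
  have -> : 1 - expi t = Complex (1 - cos t) (- sin t) by rewrite /expi; simpc.
  rewrite cabs_sqr tE cos_mulr2n sin_mulr2n; have := cos2Dsin2 h.
  move: (cos h) (sin h) => a b ab; have {}ab : a ^+ 2 = 1 - b ^+ 2 by rewrite -ab addrK.
  apply/eqP.
  have -> : (1 - (a ^+ 2 *+ 2 - 1)) ^+ 2 + (- (a * b *+ 2)) ^+ 2 = (2 - 2 * a ^+ 2) ^+ 2 + 4 * a ^+ 2 * b ^+ 2.
    by ring.
  by rewrite ab; ring.
lra.
Qed.

(** The closed form [n (1 - z) Dn n z = 1 - z ^ n] accounts for 2, and [|Dn n z| <= 1] for the rest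
    of the 3. *)
Lemma Dn_decay n (z : C) : cabs z <= 1 -> cabs (Dn n z) * (1 + n%:R * cabs (1 - z)) <= 3.
Proof.
move=> z1; rewrite mulrDr mulr1; have h1 := cabs_Dn_le1 n z1.
case: n h1 => [|n] h1; first by rewrite mul0r mulr0 addr0 (le_trans h1)//; lra.
have E : n.+1%:R * Dn n.+1 z * (1 - z) = 1 - z ^+ n.+1.
  rewrite /Dn mulrA mulfV ?pnatr_eq0// mul1r big_mkord mulrC.
  by rewrite -opprB mulNr -subrX1 opprB.
have h2 : cabs (Dn n.+1 z) * (n.+1%:R * cabs (1 - z)) <= 2.
  have -> : cabs (Dn n.+1 z) * (n.+1%:R * cabs (1 - z)) = cabs (n.+1%:R * Dn n.+1 z * (1 - z)).
    by move: (Dn n.+1 z) => D; rewrite !cabsM cabs_nat mulrCA mulrA.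
  rewrite E (le_trans (cabsB _ _))// cabs1 cabsX.
  have : cabs z ^+ n.+1 <= 1 by rewrite exprn_ile1 ?cabs_ge0.
  lra.
lra.
Qed.

(** The bound on partial sums is raised to the power [1 / e], so that the limit is taken in a linear
    inequality. *)
Lemma poweR_series_le (x : nat -> R) (T : \bar R) (e L : R) : 0 < e -> (forall k, 0 <= x k) ->
  0 <= L -> (0 <= T)%E -> (forall n, ((L * \sum_(0 <= k < n) x k) `^ e)%:E <= T)%E ->
  ((L%:E * \sum_(0 <= k <oo) (x k)%:E) `^ e <= T)%E.
Proof.
move=> e0 x0 L0; case: T => [Y| |]; last 2 first.
- by move=> _ _; exact: leey.
- by [].
rewrite lee_fin => Y0 H.
have ei : 0 < e^-1 by rewrite invr_gt0.
have h : (L%:E * \sum_(0 <= k <oo) (x k)%:E <= (Y `^ e^-1)%:E)%E.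
  rewrite -nneseriesZl//; last by move=> k _; rewrite lee_fin.
  apply: nneseries_EFin_le => [k|n]; first by rewrite mulr_ge0.
  have s0 : 0 <= L * \sum_(0 <= k < n) x k by rewrite mulr_ge0// sumr_ge0.
  rewrite -mulr_sumr; have -> : L * \sum_(0 <= k < n) x k = ((L * \sum_(0 <= k < n) x k) `^ e) `^ e^-1.
    by rewrite -powRrM mulfV ?gt_eqF// powRr1.
  by rewrite ge0_ler_powR ?nnegrE ?(ltW ei) ?powR_ge0// -lee_fin H.
have -> : Y%:E = ((Y `^ e^-1)%:E `^ e)%E.
  by rewrite poweR_EFin -powRrM mulVf ?gt_eqF// powRr1.
apply: gt0_ler_poweR h; rewrite ?(ltW e0)// in_itv/= leey andbT ?lee_fin ?powR_ge0//.
by rewrite mule_ge0 ?lee_fin// nneseries_ge0// => k _ _; rewrite lee_fin.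
Qed.

(** A quarter of the distance from [expi t] to 1 along the circle; since [pi <= 4], its values are
    at most 1, as [dyadic_integral] demands. *)
Definition arc_dist (t : R) : R := Num.min t (2 * pi - t) / 4.

Lemma arc_dist_itv t : 0 < t -> t < 2 * pi -> 0 < arc_dist t <= 1.
Proof.
move=> t0 t1; have pi4 : pi <= 4 :> R by have := pihalf_lt2 R; lra.
rewrite divr_gt0 ?lt_min ?t0 ?subr_gt0//= /arc_dist.
have [h|h] := leP t pi.
  have : Num.min t (2 * pi - t) <= t by rewrite ge_min lexx.
  lra.
have : Num.min t (2 * pi - t) <= 2 * pi - t by rewrite ge_min lexx orbT.
lra.
Qed.

Definition arc_box (i : nat) : set (measurableTypeR R) :=
  `[0, 4 * (2^-1) ^+ i]%classic `|` `[2 * pi - 4 * (2^-1) ^+ i, 2 * pi]%classic.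

Lemma measurable_arc_box i : measurable (arc_box i).
Proof. by apply: measurableU; exact: measurable_itv. Qed.

Lemma lebesgue_arc_box i : (mu (arc_box i) <= (8 * (2^-1) ^+ (i * 1))%:E)%E.
Proof.
have p0 : 0 < 4 * 2^-1 ^+ i :> R by rewrite mulr_gt0 ?exprn_gt0 ?invr_gt0.
apply: (le_trans (measureU2 _ _ _)); [exact: measurable_itv|exact: measurable_itv|].
pose I1 : set (measurableTypeR R) := `[0, 4 * (2^-1) ^+ i]%classic.
pose I2 : set (measurableTypeR R) := `[2 * pi - 4 * (2^-1) ^+ i, 2 * pi]%classic.
have <- : (mu I1 + mu I2)%E = (8 * (2^-1) ^+ (i * 1))%:E; last exact: lexx.
rewrite /I1 /I2 !lebesgue_measure_itv/= !lte_fin p0 gtrBl p0 -!EFinD muln1.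
by congr (_%:E); ring.
Qed.

Lemma arc_dist_box i t : 0 < t -> t < 2 * pi -> arc_dist t <= (2^-1) ^+ i -> arc_box i t.
Proof.
move=> t0 t1; rewrite /arc_dist ler_pdivrMr// mulrC ge_min => /orP[h|h]; [left|right].
  by rewrite /= in_itv/= (ltW t0) mulrC.
by rewrite /= in_itv/= (ltW t1) andbT; lra.
Qed.

(** [powR_weighted_sum] with the exponent [p / q] moves the power inside and spends half of the
    weight; the remaining [wt ^ (1 / 2)] and [ps ^ -1] have the form that [dyadic_integral] requires
    on the circle, with [m = 1]. *)
Lemma point_weighted_sum (p q tau L A B ps : R) n :
  0 < p -> 0 < q -> 0 <= L -> 0 <= A -> 1 < B -> 0 < ps ->
  (L * \sum_(0 <= k < n)
     (A * (k.+1%:R `^ (- tau) * (ps `^ (- p^-1) * wt (B ^+ k * ps) `^ p^-1))) `^ q) `^ (p / q) <=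
  \sum_(0 <= k < n)
     L `^ (p / q) * wt_bound (B `^ (q / (2 * p))) `^ (p / q) * (A `^ p * k.+1%:R `^ (- (tau * p))) *
     (ps ^+ 1)^-1 * wt (B ^+ k * ps) `^ 2^-1.
Proof.
move=> p0 q0 L0 A0 B1 ps0; have B0 : 0 <= B by rewrite (le_trans _ (ltW B1)).
have pq0 : 0 < p / q by rewrite divr_gt0.
have ka0 : 0 < q / (2 * p) by rewrite divr_gt0// mulr_gt0.
set W := wt_bound _.
have W0 : 0 <= W.
  by apply: le_trans (sum_wt_powR (t := 1) 0 B1 ltr01 ka0); rewrite big_geq.
pose X k : R := k.+1%:R `^ (- tau); pose P := ps `^ (- p^-1).
have X0 k : 0 <= X k by exact: powR_ge0.
have P0 : 0 <= P by exact: powR_ge0.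
have XP0 k : 0 <= X k * P by exact: mulr_ge0.
have AXP0 k : 0 <= A * (X k * P) by exact: mulr_ge0.
pose a k : R := (A * (X k * P)) `^ q.
pose w k : R := wt (B ^+ k * ps) `^ (q / (2 * p)).
have a0 k : 0 <= a k by exact: powR_ge0.
have w0 k : 0 <= w k by exact: powR_ge0.
have bE k : (A * (X k * (P * wt (B ^+ k * ps) `^ p^-1))) `^ q = a k * w k ^+ 2.
  have -> : A * (X k * (P * wt (B ^+ k * ps) `^ p^-1)) = (A * (X k * P)) * wt (B ^+ k * ps) `^ p^-1.
    by rewrite !mulrA.
  rewrite (powRM _ (AXP0 k) (powR_ge0 _ _)) -/(a k); congr (_ * _).
  rewrite /w -[RHS](powR_mulrn 2 (powR_ge0 _ _)); move: (wt (B ^+ k * ps)) => y.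
  by rewrite -!powRrM; congr (_ `^ _); field; rewrite gt_eqF.
rewrite (eq_bigr _ (fun k _ => bE k)).
have S0 : 0 <= \sum_(0 <= k < n) a k * w k ^+ 2.
  by rewrite sumr_ge0// => k _; rewrite mulr_ge0 ?exprn_ge0.
have SW : \sum_(0 <= k < n) w k <= W by exact: sum_wt_powR.
rewrite (powRM _ L0 S0).
apply: (le_trans (ler_wpM2l (powR_ge0 L (p / q)) (powR_weighted_sum pq0 W0 a0 w0 SW))).
rewrite mulrA mulr_sumr; apply: ler_sum => k _.
have E1 : a k `^ (p / q) = A `^ p * (k.+1%:R `^ (- (tau * p)) * ps^-1).
  rewrite /a -powRrM (_ : q * (p / q) = p); last by field; rewrite gt_eqF.
  rewrite (powRM _ A0 (XP0 k)) (powRM _ (X0 k) P0) /X /P -!powRrM !mulNr mulVf ?gt_eqF//.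
  by rewrite powR_inv1// ltW.
have E2 : w k `^ (p / q) = wt (B ^+ k * ps) `^ 2^-1.
  rewrite /w; move: (wt (B ^+ k * ps)) => y; rewrite -powRrM; congr (_ `^ _).
  by field; rewrite !gt_eqF.
rewrite (powRM _ (a0 k) (w0 k)) E1 E2 expr1 le_eqVlt; apply/orP; left; apply/eqP.
by rewrite !mulrA.
Qed.

(** [gam] exceeds the critical growth by [1 / p], the gain in [L^p] from concentration on an arc of
    length [B ^ -k]; in the mixed norm the same arc costs [B ^ (- k / u)]. So [tau p > 1] ensures
    membership, and the sign of [gam - beta - 1 / u] governs divergence. *)
Lemma counterexample_point (p q u v alpha beta tau : R) :
  0 < p -> 0 < q -> 0 < u -> 0 < v -> -2 < alpha -> 0 <= tau -> 1 < tau * p ->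
  1 / p + (alpha + 2) / q = 1 / u + beta /\ tau * v <= 1 \/
    1 / u + beta < 1 / p + (alpha + 2) / q ->
  exists2 f, AT p q alpha f & ~ (mixed_norm u v beta f < +oo)%E.
Proof.
move=> p0 q0 u0 v0 al t0 tp cond; set s := (alpha + 2) / q in cond *.
have s0 : 0 < s by rewrite divr_gt0//; lra.
have pi0 : 0 < p^-1 by rewrite invr_gt0.
pose gam := s + p^-1; have g0 : 0 < gam by rewrite addr_gt0.
(* [N >= 2 / p] turns the decay of [Dn] into [(1 + B ^ k ps) ^ (- 2 / p)], the form of [wt_powRE]
   for the exponent [1 / p]. *)
pose N := Num.Def.archi_bound (2 / p).
have Np : 2 / p <= N%:R.
  have Z0 : 0 <= 2 / p by rewrite divr_ge0// ltW.
  exact/ltW/(archi_boundP Z0).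
have [B [c c0 [B4 H]]] := lacunary_function N t0 g0.
have B1 : (1 < B)%N by exact: leq_trans B4.
have BR : 4 <= B%:R :> R by rewrite ler_nat.
have BkN k : (0 < B ^ k)%N by rewrite expn_gt0 (ltnW B1).
have Bk k : 0 < (B ^ k)%N%:R :> R by rewrite ltr0n.
(* The predecessor keeps [Dn] near 1 on the arc: [B ^ (k - 1) * 2 B ^ -k = 2 / B <= 1 / 2]. At
   [k = 0] it gives [n = 1]. *)
have [||f [fa up low]] := H (fun k => B ^ k.-1)%N (fun=> 1).
- by move=> k; rewrite BkN/= leq_exp2l// leq_pred.
- by move=> k; exact: cabs1.
exists f; last first.
  have pi2 : 2 <= pi :> R by exact: pi_ge2.
  have [c1 c10 Hc1] := @lacunary_growth R tau (gam - beta - u^-1) v B t0 v0 B1 (ltac:(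
    by case: cond => [[h ?]|h]; [left; split => //|right]; rewrite /gam; lra)).
  have BV k : ((B ^ k)%N%:R)^-1 <= 1 :> R by rewrite invf_le1// ler1n.
  apply: (@lacunary_not_mixed R f u v beta tau gam c c1 B (fun k => B ^ k.-1)%N
    (fun=> 1) (fun k => ((B ^ k)%N%:R)^-1) (fun=> 0)) => //.
  - by move=> k; rewrite add0r (le_trans (BV k))//; lra.
  - move=> k r t k0 r0 r1 rB t1 t2; apply: Dn_near1 => //.
      by rewrite mul1r cabs_polar.
    have := cabs_1B_polar 0 t r0 r1; rewrite oppr0 expi0 addr0 ger0_norm// => h.
    apply: (@le_trans _ _ ((B ^ k.-1)%N%:R * (2 * ((B ^ k)%N%:R)^-1))).
      by rewrite ler_wpM2l//; rewrite add0r in t2; lra.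
    case: k k0 {h t2 rB} => [//|k] _ /=.
    have -> : (B ^ k)%N%:R * (2 * ((B ^ k.+1)%N%:R)^-1) = 2 / B%:R :> R.
      rewrite expnS natrM; have nk := lt0r_neq0 (Bk k).
      have nB : B%:R != 0 :> R by rewrite gt_eqF// (lt_le_trans _ BR).
      by rewrite invfM; move: nk nB; set y := (B ^ k)%N%:R; move=> nk nB; field; rewrite nk nB.
    by rewrite ler_pdivrMr; lra.
  move=> k k0; have := Hc1 k => /le_trans; apply.
  rewrite le_eqVlt; apply/orP; left; apply/eqP; congr (_ * _ `^ v).
  rewrite [RHS]mulrCA; congr (_ * _).
  rewrite [X in X * _](_ : _ = (B ^ k)%N%:R `^ (- u^-1)); last first.
    by rewrite -powR_inv1 ?(ltW (Bk k))// -powRrM mulN1r.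
  by rewrite -powRD ?(gt_eqF (Bk k)) ?implybT//; congr (_ `^ _); ring.
have m0 : 0 < 2 * s by rewrite mulr_gt0.
have [K K0 HK] := exprn_powR m0.
have [L L0 HL] := cone_area_upper q0 al B1.
have [S S0 HS] := sum_powRN tp.
(* The 3 of [Dn_decay] times [3 B / 2], the loss in passing from [B ^ (k - 1)] to [B ^ k] and from
   [|1 - z|] to [ps]. *)
pose C2 : R := 9 * B%:R / 2; have C20 : 0 < C2 by rewrite /C2; lra.
pose A : R := 2 * K * C2 ^+ N.
have A0 : 0 <= A by rewrite mulr_ge0 ?exprn_ge0 ?(ltW C20)// mulr_ge0// ltW.
have pq0 : 0 < p / q by rewrite divr_gt0.
pose ka : R := q / (2 * p).
have ka0 : 0 < ka by rewrite divr_gt0// mulr_gt0.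
have BR1 : 1 < B%:R :> R by rewrite ltr1n.
have BR0 : 0 < B%:R :> R by exact: lt_trans BR1.
pose W : R := wt_bound (B%:R `^ ka).
have W0 : 0 <= W.
  by apply: le_trans (sum_wt_powR (t := 1) 0 BR1 ltr01 ka0); rewrite big_geq.
pose be k : R := L `^ (p / q) * W `^ (p / q) * (A `^ p * k.+1%:R `^ (- (tau * p))).
have be0 k : 0 <= be k by rewrite !mulr_ge0 ?powR_ge0.
pose D : set (measurableTypeR R) := `]0, 2 * pi[%classic.
have DP t : D t -> 0 < t /\ t < 2 * pi by rewrite /D /= in_itv/= => /andP[].
have half0 : 0 < 2^-1 :> R by rewrite invr_gt0.
split => //; rewrite AT_normpE.
have mA : measurable_fun D (fun t => (cone_area f q alpha t `^ (p / q))%E).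
  apply: (measurableT_comp (measurable_poweR _)); apply: measurable_funTS.
  exact: measurable_cone_area.
(* The end points are dropped because [arc_dist] vanishes there. *)
rewrite (integral_itv_bndoo _ _ mA).
have I : (\int[mu]_(t in D) (cone_area f q alpha t `^ (p / q)) <=
   (2 ^+ 1 * 4 `^ 2^-1 * 8 * wt_bound (2 `^ 2^-1))%R%:E * \sum_(0 <= k <oo) (be k)%:E)%E.
  apply: (@dyadic_integral _ (measurableTypeR R) R mu D arc_dist arc_box 8 B%:R 2^-1 1%N be) => //.
  - by move=> i; exact: measurable_arc_box.
  - by move=> i; exact: lebesgue_arc_box.
  - by move=> t /DP[? ?]; exact: arc_dist_itv.
  - by move=> i t /DP[? ?]; exact: arc_dist_box.
  move=> t Dt; have [tp0 tp1] := DP t Dt; rewrite poweR_ge0/=.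
  have /andP[ps0 ps1] := arc_dist_itv tp0 tp1; set ps := arc_dist t in ps0 ps1 *.
  have wt0 k : 0 <= wt (B%:R ^+ k * ps) by rewrite wt_ge0// mulr_ge0 ?exprn_ge0 ?(ltW ps0).
  pose b k : R := A * (k.+1%:R `^ (- tau) * (ps `^ (- p^-1) * wt (B%:R ^+ k * ps) `^ p^-1)).
  have b0 k : 0 <= b k by rewrite /b; apply: mulr_ge0 => //; rewrite !mulr_ge0 ?powR_ge0.
  have CA : (cone_area f q alpha t <= L%:E * \sum_(0 <= k <oo) (b k `^ q)%:E)%E.
    apply: HL => // z Gz; have [d0 d1 d2] := Gamma_dist Gz.
    have z1 : cabs z < 1 by rewrite -subr_gt0.
    have [M HM] := up z z1; exists M; apply: (le_trans HM); rewrite mulr_sumr; apply: ler_sum => k _.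
    rewrite -/s; set y : R := (B ^ k)%N%:R; set del := 1 - cabs z in d0 d1 d2 *.
    have y0 : 0 < y by exact: Bk.
    have hz : cabs z ^+ (B ^ k) <= K * (1 + y * del) `^ (- (2 * s)).
      by have := HK (B ^ k)%N del (ltW d0) d1; rewrite subKr.
    have E0 : 0 < 1 + y * ps by rewrite ltr_pwDl// mulr_ge0 ?ltW.
    (* [2 ps <= |1 - expi t| <= |1 - z| + 2 del], and [del <= |1 - z|]. *)
    have chord : 2 / 3 * ps <= cabs (1 - z).
      have h1 := chord_ge (ltW tp0) (ltW tp1).
      have h2 : del <= cabs (1 - z).
        by have := cabs_lerB 1 z; rewrite cabs1.
      have h3 := cabs_dist 1 z (expi t); move: h1; rewrite /ps /arc_dist.
      by clear -h2 h3 d2; lra.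
    have hD : cabs (Dn (B ^ k.-1) (1 * z)) <= C2 / (1 + y * ps).
      rewrite mul1r ler_pdivlMr//.
      have D0 := cabs_ge0 (Dn (B ^ k.-1) z).
      have h := Dn_decay (B ^ k.-1) (ltW z1).
      have yB : y <= B%:R * (B ^ k.-1)%N%:R.
        by rewrite -natrM -expnS ler_nat leq_exp2l// leqSpred.
      have h2 : 1 + y * ps <= 3 * B%:R / 2 * (1 + (B ^ k.-1)%N%:R * cabs (1 - z)).
        have e1 : y * ps <= B%:R * (B ^ k.-1)%N%:R * ps by rewrite ler_wpM2r// ltW.
        have e2 : (B ^ k.-1)%N%:R * (2 / 3 * ps) <= (B ^ k.-1)%N%:R * cabs (1 - z) by rewrite ler_wpM2l.
        have e3 := ler_wpM2l (ltW BR0) e2.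
        by clear -e1 e3 BR; lra.
      have := ler_wpM2l D0 h2; move=> /le_trans; apply; rewrite mulrCA.
      have BR2 : 0 <= 3 * B%:R / 2 :> R by clear -BR; lra.
      apply: (le_trans (ler_wpM2l BR2 h)); rewrite /C2; clear; lra.
    have hDN : cabs (Dn (B ^ k.-1) (1 * z)) ^+ N <= C2 ^+ N * (1 + y * ps) `^ (- (2 * p^-1)).
      apply: (@le_trans _ _ ((C2 / (1 + y * ps)) ^+ N)).
        apply: lerXn2r => //; rewrite nnegrE ?cabs_ge0//.
        by rewrite divr_ge0 ?(ltW C20) ?(ltW E0).
      rewrite exprMn ler_wpM2l ?exprn_ge0 ?(ltW C20)// exprVn powRN lef_pV2 ?posrE ?exprn_gt0 ?powR_gt0//.
      rewrite -powR_mulrn ?(ltW E0)// ler_powR//.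
      by rewrite lerDl mulr_ge0 ?ltW.
    have hw := wt_powRE p^-1 y0 ps0.
    rewrite /b /lacunary_coef -/y [B%:R ^+ k](_ : _ = y); last by rewrite /y natrX.
    rewrite -hw /gam powRD ?(gt_eqF y0) ?implybT//.
    have c20 : 0 <= 2 * (k.+1%:R `^ (- tau) * (y `^ s * y `^ p^-1)) by rewrite !mulr_ge0 ?powR_ge0.
    have hz0 : 0 <= cabs z ^+ (B ^ k) by rewrite exprn_ge0 ?cabs_ge0.
    have hD0 : 0 <= cabs (Dn (B ^ k.-1) (1 * z)) ^+ N by rewrite exprn_ge0 ?cabs_ge0.
    have := ler_wpM2l c20 (ler_pM hz0 hD0 hz hDN); rewrite !mulrA => /le_trans; apply.
    by rewrite le_eqVlt; apply/orP; left; apply/eqP; rewrite /A; ring.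
  apply: (@le_trans _ _ ((L%:E * \sum_(0 <= k <oo) (b k `^ q)%:E) `^ (p / q))%E).
    apply: gt0_ler_poweR CA; rewrite ?(ltW pq0)// in_itv/= leey andbT ?cone_area_ge0//.
    by rewrite mule_ge0 ?lee_fin// nneseries_ge0// => k _ _; rewrite lee_fin powR_ge0.
  have F0 k : 0 <= be k * (ps ^+ 1)^-1 * wt (B%:R ^+ k * ps) `^ 2^-1.
    by rewrite mulr_ge0 ?powR_ge0// mulr_ge0 ?invr_ge0 ?exprn_ge0 ?(ltW ps0).
  apply: poweR_series_le => //.
  - by move=> k; exact: powR_ge0.
  - by apply: nneseries_ge0 => k _ _; rewrite lee_fin.
  move=> n; apply: le_trans (nneseries_lim_ge n _); last by move=> k _ _; rewrite lee_fin.
  rewrite sumEFin lee_fin.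
  exact: point_weighted_sum.
apply: (le_lt_trans I).
have SB : (\sum_(0 <= k <oo) (be k)%:E <= (L `^ (p / q) * W `^ (p / q) * A `^ p * S)%:E)%E.
  apply: nneseries_EFin_le => // n.
  rewrite (eq_bigr (fun k => L `^ (p / q) * W `^ (p / q) * A `^ p * k.+1%:R `^ (- (tau * p)))); last first.
    by move=> k _; rewrite /be !mulrA.
  by rewrite -mulr_sumr ler_wpM2l ?mulr_ge0 ?powR_ge0.
set c3 : R := _ * wt_bound _.
have b20 : 1 < 2 :> R by rewrite ltr1n.
have c30 : 0 <= c3.
  rewrite /c3; apply: mulr_ge0; first by rewrite !mulr_ge0 ?powR_ge0.
  by apply: le_trans (sum_wt_powR (t := 1) 0 b20 ltr01 half0); rewrite big_geq.
by rewrite (le_lt_trans (lee_wpmul2l _ SB)) ?lee_fin// -EFinM ltry.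
Qed.

End BoundaryPointExample.

(** * Necessity of the conditions, and the equivalence *)

Lemma embedding_necessary (R : realType) (p q u v alpha beta : R) :
  0 < p -> 0 < q -> 0 < u -> 0 < v -> -2 < alpha ->
  AT p q alpha `<=` mixed_norm_space u v beta ->
  Num.max u q <= v /\ (alpha + 2) / q = beta \/ (alpha + 2) / q < beta.
Proof.
move=> p0 q0 u0 v0 al H.
have absurd (P : Prop) : (exists2 f : R[i] -> R[i], AT p q alpha f &
    ~ (mixed_norm u v beta f < +oo)%E) -> P.
  by move=> [f fA]; have [_ h] := H f fA.
have [sb|bs|sb] := ltrgtP ((alpha + 2) / q) beta; first by right.
(* Above the critical exponent any [tau] with [tau q > 1] will do. *)
- apply: absurd; apply: (@counterexample_constant R p q u v alpha beta (q^-1 + 1)) => //.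
  + by rewrite addr_ge0// invr_ge0 ltW.
  + by rewrite mulrDl mulVf ?gt_eqF// mul1r ltrDl.
  + by right.
left; split => //; rewrite leNgt; apply/negP; rewrite lt_max => /orP[vu|vq].
  by rewrite -sb in absurd; apply: absurd; exact: counterexample_rotating.
(* For [v < q] the value [tau = 1 / v] has [tau v = 1] and [tau q > 1]. *)
apply: absurd; apply: (@counterexample_constant R p q u v alpha beta v^-1) => //.
- by rewrite invr_ge0 ltW.
- by rewrite mulrC ltr_pdivlMr ?mul1r.
- by left; rewrite mulVf ?gt_eqF.
Qed.

Lemma embedding_necessary_lt (R : realType) (p q u v alpha beta : R) :
  0 < p -> 0 < q -> 0 < u -> 0 < v -> -2 < alpha ->
  AT p q alpha `<=` mixed_norm_space u v beta ->
  p <= v /\ 1 / p + (alpha + 2) / q = 1 / u + beta \/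
    1 / p + (alpha + 2) / q < 1 / u + beta.
Proof.
move=> p0 q0 u0 v0 al H.
have absurd (P : Prop) : (exists2 f : R[i] -> R[i], AT p q alpha f &
    ~ (mixed_norm u v beta f < +oo)%E) -> P.
  by move=> [f fA]; have [_ h] := H f fA.
have [sb|bs|sb] := ltrgtP (1 / p + (alpha + 2) / q) (1 / u + beta); first by right.
- apply: absurd; apply: (@counterexample_point R p q u v alpha beta (p^-1 + 1)) => //.
  + by rewrite addr_ge0// invr_ge0 ltW.
  + by rewrite mulrDl mulVf ?gt_eqF// mul1r ltrDl.
  + by right.
left; split => //; rewrite leNgt; apply/negP => vp.
(* The same choice, with [p] in the place of [q]. *)
apply: absurd; apply: (@counterexample_point R p q u v alpha beta v^-1) => //.
- by rewrite invr_ge0 ltW.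
- by rewrite mulrC ltr_pdivlMr ?mul1r.
- by left; rewrite mulVf ?gt_eqF.
Qed.

Theorem theorem1p11 (R : realType) (p q u v alpha beta : R)
    (hp : 0 < p) (hq : 0 < q) (hu : 0 < u) (hv : 0 < v)
    (halpha : -2 < alpha) (hbeta : 0 < beta) :
  AT p q alpha `<=` mixed_norm_space u v beta <->
  [\/ p < u /\
        (p <= v /\ 1 / p + (alpha + 2) / q = 1 / u + beta \/
         1 / p + (alpha + 2) / q < 1 / u + beta),
      p = u /\
        (Num.max p q <= v /\ (alpha + 2) / q = beta \/
         (alpha + 2) / q < beta)
    | u < p /\
        (Num.max u q <= v /\ (alpha + 2) / q = beta \/
         (alpha + 2) / q < beta)].
Proof.
split => [H|].
  have [pu|up|pu] := ltrgtP p u.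
  - by apply: Or31; split => //; exact: embedding_necessary_lt H.
  - by apply: Or33; split => //; exact: embedding_necessary H.
  - by apply: Or32; split => //; rewrite pu; exact: embedding_necessary H.
move=> [[pu cond]|[pu cond]|[up cond]] f fA.
- exact: embedding_lt cond fA.
(* For [p = u] both maxima agree, and the case belongs to [u <= p]. *)
- by rewrite pu in cond; apply: embedding_le cond fA; rewrite ?pu.
- exact: embedding_le (ltW up) cond fA.
Qed.
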